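(* Let $S_n$ denote the symmetric group on $n$ letters. (1) Let $K$ be any field with $\operatorname{char}K\neq 2$. Then $\operatorname{ed}_K(S_{n+2})\ge \operatorname{ed}_K(S_n)+1$ for any $n\ge 1$, and $\operatorname{ed}_K(S_n)\ge \lfloor \frac{n}{2}\rfloor$ for any $n\ge 1$. (2) If $K$ is a field with $\operatorname{char}K=2$ and $K\supset\mathbb{F}_4$, then $\operatorname{ed}_K(S_{n+3})\ge \operatorname{ed}_K(S_n)+1$ for any positive integer $n\neq 4$. (3) If $K$ is a field with $\operatorname{char}K=2$, then $\operatorname{ed}_K(S_n)\ge \lfloor\frac{n+1}{3}\rfloor$ for any $n\ge 1$.
   Context: $\mathbb{F}_4$ is the field with four elements. All fields are assumed to contain the ground field $K$. Let $L/L_0$ be a finite separable extension of fields containing $K$. For an intermediate field $K\subset E_0\subset L_0$, one says that $L/L_0$ is defined over $E_0$ if there is a field $E$ with $E_0\subset E\subset L$, $[E:E_0]=[L:L_0]$ and $L=EL_0$. The essential dimension $\operatorname{ed}_K(L/L_0)$ is the minimum of $\operatorname{trdeg}_K E_0$ (transcendence degree over $K$), where $E_0$ runs over all such fields over which $L/L_0$ is defined. For a finite group $G$, define $\operatorname{ed}_K(G)=\operatorname{ed}_K(K(V)/K(V)^G)$, where $G\to GL(V)$ is a faithful finite-dimensional representation over $K$, $K(V)=K(x_1,\ldots,x_n)$ is the rational function field in a basis $x_1,\ldots,x_n$ of the dual space of $V$ with the induced $G$-action, and $K(V)^G$ is the fixed field; this does not depend on the choice of the faithful representation. *)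

(* Defs.v *)
From HB Require Import structures.
From mathcomp Require Import all_boot all_order all_algebra all_fingroup.
From mathcomp Require Import all_solvable all_field all_character.
From mathcomp Require Import boolp.
From mathcomp Require Import mpoly.

Set Implicit Arguments.
Unset Strict Implicit.
Unset Printing Implicit Defensive.

Import GRing.Theory.
Local Open Scope ring_scope.

(* Subfields of a field L are boolean predicates on L; under boolp every      *)
(* subset of L is one, so there is no decidability restriction.               *)
Section FieldExtensions.

Variables (K L : fieldType) (iota : {rmorphism K -> L}).
Implicit Types E F : {pred L}.

Definition intermediate_field E : Prop :=
  divring_closed E /\ (forall a : K, iota a \in E).

Definition is_basis (E0 : {pred L}) E n (e : 'I_n -> L) : Prop :=
  [/\ forall i, e i \in E,
      forall c : 'I_n -> L, (forall i, c i \in E0) ->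
        \sum_(i < n) c i * e i = 0 -> forall i, c i = 0
    & forall x, x \in E -> exists2 c : 'I_n -> L,
        (forall i, c i \in E0) & x = \sum_(i < n) c i * e i].

Definition is_degree (E0 : {pred L}) E n : Prop := exists e : 'I_n -> L, is_basis E0 E e.

Definition alg_independent d (t : 'I_d -> L) : Prop :=
  forall p : {mpoly K[d]}, mmap iota t p = 0 -> p = 0.

(* d is the largest size of a family in E algebraically independent over K.   *)
Definition is_trdeg E d : Prop :=
  (exists2 t : 'I_d -> L, (forall i, t i \in E) & alg_independent t) /\
  (forall d' (t : 'I_d' -> L),
     (forall i, t i \in E) -> alg_independent t -> (d' <= d)%N).

(* L / L0 is defined over E0. The last clause says that the compositum of E   *)
(* and L0 is L.                                                               *)
Definition defined_over (L0 E0 : {pred L}) : Prop :=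
  exists E,
    [/\ intermediate_field E, {subset E0 <= E},
        exists2 n, is_degree E0 E n & is_degree L0 predT n
      & forall F, intermediate_field F ->
          {subset E <= F} -> {subset L0 <= F} -> forall x, x \in F].

Definition descends_to_trdeg (L0 : {pred L}) d : Prop :=
  exists E0 : {pred L}, [/\ intermediate_field E0, {subset E0 <= L0},
                 defined_over L0 E0 & is_trdeg E0 d].

(* ed_K(L / L0); the value is 0 if no E0 has finite transcendence degree,     *)
(* which cannot happen when L is finitely generated over K and L / L0 finite. *)
Definition essdim (L0 : {pred L}) : nat :=
  if pselect (exists d, `[< descends_to_trdeg L0 d >]) is left ex_d
  then ex_minn ex_d else 0%N.

End FieldExtensions.

Section RepresentationField.

Variables (K : fieldType) (gT : finGroupType) (G : {group gT}) (m : nat).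
Variable rG : mx_representation K G m.

(* V is the space of row vectors, on which g acts by v |-> v *m rG g, and     *)
(* 'X_j is the j-th coordinate on V, so K(V) is the field of fractions of     *)
(* K['X_0, ..., 'X_(m-1)].                                                    *)
Definition rat_field : fieldType := {fraction {mpoly K[m]}}.

Definition rat_field_const : {rmorphism K -> rat_field} :=
  (@FracField.tofrac {mpoly K[m]} \o @mpolyC m K)%FUN.

(* p |-> p o (v |-> v *m rG g); as g runs over G these substitutions and the  *)
(* contragredient ones p |-> p o (v |-> v *m rG g^-1) are the same.           *)
Definition poly_act (g : gT) (p : {mpoly K[m]}) : {mpoly K[m]} :=
  p \mPo [tuple \sum_(i < m) rG g i j *: 'X_i | j < m].

Definition rat_act (g : gT) (z : rat_field) : rat_field :=
  let r := generic_quotient.repr z : {ratio {mpoly K[m]}} in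
  FracField.tofrac (poly_act g \n_r) / FracField.tofrac (poly_act g \d_r).

Definition rat_fixed_field : {pred rat_field} :=
  [pred z | [forall g in G, rat_act g z == z]].

(* ed_K(K(V) / K(V)^G) *)
Definition essdim_repr : nat := essdim rat_field_const rat_fixed_field.

End RepresentationField.

Definition contains_F4 (K : fieldType) : Prop :=
  exists2 F : finFieldType, #|F| = 4%N & inhabited {rmorphism F -> K}.

(* Main.v *)
From HB Require Import structures.
From mathcomp Require Import all_boot all_order all_algebra all_fingroup.
From mathcomp Require Import all_solvable all_field all_character.
From mathcomp Require Import boolp.
From mathcomp Require Import mpoly ring.
Require Import Defs.

Set Implicit Arguments.
Unset Strict Implicit.
Unset Printing Implicit Defensive.

Import generic_quotient.
Import GRing.Theory.
Local Open Scope ring_scope.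

(** Let L = K(V). The extension L / L^G is defined over a field of transcendence
    degree at most d if and only if L contains a G-stable subfield E of
    transcendence degree at most d over K on which G acts faithfully
    ([ed_le_descends], [descends_ed_le]); E_0 is then E^G. The latter condition,
    [ed_le], is what the proof works with.

    If H is a subgroup of G, F an infinite field with a faithful action of H and
    f in K[V] is not 0, there is an H-equivariant homomorphism K[V] -> F that does
    not kill f ([equivariant_specialization]). The residues in F of the elements of
    E where it is defined form an H-stable field of no larger transcendence degree, on
    which H is still faithful for suitable f. So the essential dimension of G
    bounds that of every such F ([specialization_ed_le]). In particular it does
    not depend on V, and may be bounded below on a convenient F.

    For G = S_(n+p) and H = S_n x C_p take F = M(t), M any field with a faithful
    action of S_n, where C_p multiplies t by p-th roots of unity; p is 2 when the
    characteristic is not 2, and 3 when it is 2. The t-adic valuation restricts to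
    a stable subfield E of F, ramified by C_p, so that the residue field of E in M
    loses a transcendence degree. Elements of S_n that act trivially on it
    together with C_p embed in the inertia group of a tame discrete valuation,
    which is cyclic; so none of them has order p ([ed_le_drop]). They form a normal
    subgroup of S_n, which therefore is trivial unless S_n has a nontrivial normal
    subgroup of order prime to p, that is, unless p = 2 and n = 3, or p = 3 and
    n = 2 or 4.

    The two exceptional cases n = 3 and n = 2 that occur in the theorem say that
    the essential dimension of S_5 is at least 2, since those of S_3 and S_2 are at
    most 1 ([ed_le1_sym3], [ed_le1_order2]). In characteristic not 2 this comes from
    C_2 x C_2 inside S_5, by two drops. In characteristic 2 it comes from an
    element s of order 4: if E had transcendence degree 1, specialization of the
    group generated by s^2 to K(t) with t |-> t + 1 would embed a stable subfield
    of E in K(t), and by Lueroth's theorem s would act on a rational function field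
    in one variable by a Moebius transformation of order 4, which does not exist in
    characteristic 2 ([ed_gt1_order4]).

    The bound n / 2 follows by induction from n = 0 and n = 1. For (n + 1) / 3 one
    adjoins a cube root of unity to K and starts the induction from involutions
    (n = 2, 3, 4) and elements of order 4 (n = 5, 6, 7). *)

(** * Subfields as types *)

(** A copy of the predicate [k] whose name records the closure proof, so that
    the algebraic structures below can be inferred from it. *)
Definition subfield_pred (L : fieldType) (k : {pred L}) of divring_closed k : {pred L} := k.
HB.instance Definition _ (L : fieldType) (k : {pred L}) (kP : divring_closed k) :=
  GRing.isDivringClosed.Build L (subfield_pred kP) kP.
Record subfield (L : fieldType) (k : {pred L}) (kP : divring_closed k) :=
  Subfield { subfield_val : L; _ : subfield_val \in subfield_pred kP }.
HB.instance Definition _ (L : fieldType) (k : {pred L}) (kP : divring_closed k) :=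
  [isSub for @subfield_val L k kP].
HB.instance Definition _ (L : fieldType) (k : {pred L}) (kP : divring_closed k) :=
  [Choice of subfield kP by <:].
HB.instance Definition _ (L : fieldType) (k : {pred L}) (kP : divring_closed k) :=
  [SubChoice_isSubIntegralDomain of subfield kP by <:].
HB.instance Definition _ (L : fieldType) (k : {pred L}) (kP : divring_closed k) :=
  [SubIntegralDomain_isSubField of subfield kP by <:].
HB.instance Definition _ (L : fieldType) (k : {pred L}) (kP : divring_closed k) :=
  GRing.RMorphism.copy (@subfield_val L k kP) (val : subfield kP -> L).

(** * Relative algebraic closure *)

Section Algebraic.

Variable L : fieldType.
Implicit Types (k : {pred L}) (x y : L) (p : {poly L}).

Definition algebraic k x :=
  exists p : {poly L}, [/\ p != 0, (forall i, p`_i \in k) & root p x].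

Definition alg_closure k : {pred L} := [pred x | `[< algebraic k x >]].

Lemma alg_closureP k x : reflect (algebraic k x) (x \in alg_closure k).
Proof. exact: asboolP. Qed.

Lemma poly_subfield k (kP : divring_closed k) p :
  (forall i, p`_i \in k) ->
  exists q : {poly subfield kP}, p = map_poly (@subfield_val L k kP) q.
Proof.
move=> pk; exists (\poly_(i < size p) Subfield (pk i)).
apply/polyP=> i; rewrite coef_map coef_poly.
by case: ltnP => [//|/leq_sizeP/(_ _ (leqnn _)) ->]; rewrite raddf0.
Qed.

Lemma algebraic_subfieldP k (kP : divring_closed k) x :
  algebraic k x <-> algebraicOver (@subfield_val L k kP) x.
Proof.
split=> [[p [p0 pk rp]]|[p p0 rp]].
  have [q Eq] := poly_subfield kP pk; exists q; last by rewrite -Eq.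
  by apply: contra_neq p0; rewrite Eq => ->; rewrite rmorph0.
exists (map_poly (@subfield_val L k kP) p); split=> //.
  by rewrite map_poly_eq0.
by move=> i; rewrite coef_map /=; case: (p`_i).
Qed.

Lemma alg_closure_divring k : divring_closed k -> divring_closed (alg_closure k).
Proof.
move=> kP; split=> [|x y|x y].
- apply/alg_closureP/(algebraic_subfieldP kP); exact: algebraic1.
- move=> /alg_closureP/(algebraic_subfieldP kP) ax.
  move=> /alg_closureP/(algebraic_subfieldP kP) ay.
  apply/alg_closureP/(algebraic_subfieldP kP); exact: algebraic_sub.
- move=> /alg_closureP/(algebraic_subfieldP kP) ax.
  move=> /alg_closureP/(algebraic_subfieldP kP) ay.
  apply/alg_closureP/(algebraic_subfieldP kP); exact: algebraic_div.
Qed.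

Lemma sub_alg_closure k : divring_closed k -> {subset k <= alg_closure k}.
Proof.
move=> kP x xk; apply/alg_closureP/(algebraic_subfieldP kP).
by rewrite -[x]/(subfield_val (Subfield (xk : x \in subfield_pred kP)));
   exact: algebraic_id.
Qed.

Lemma alg_closure_mono k k' :
  {subset k <= k'} -> {subset alg_closure k <= alg_closure k'}.
Proof.
move=> kk' x /alg_closureP[p [p0 pk rp]]; apply/alg_closureP.
by exists p; split=> // i; apply/kk'.
Qed.

Lemma alg_closure_idem k :
  divring_closed k -> {subset alg_closure (alg_closure k) <= alg_closure k}.
Proof.
move=> kP x /alg_closureP[p [p0 pk rp]]; apply/alg_closureP.
apply/(algebraic_subfieldP kP)/integral_algebraic.
apply: (integral_root p0 rp) => y /(nthP 0)[i _ <-].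
apply/integral_algebraic/(algebraic_subfieldP kP)/alg_closureP; exact: pk.
Qed.

End Algebraic.

Section Adjoin.

Variables (K L : fieldType) (iota : {rmorphism K -> L}).
Implicit Types (k : {pred L}) (x y z : L) (s : seq L).

(** K(s). *)
Definition adjoin s : {pred L} := [pred x |
  `[< forall k, intermediate_field iota k -> {subset s <= k} -> x \in k >]].

Lemma adjoinP s x :
  reflect (forall k, intermediate_field iota k -> {subset s <= k} -> x \in k)
          (x \in adjoin s).
Proof. exact: asboolP. Qed.

Lemma adjoin_field s : intermediate_field iota (adjoin s).
Proof.
split; last by move=> a; apply/adjoinP=> k [_ kK] _; apply: kK.
split=> [|x y /adjoinP xs /adjoinP ys|x y /adjoinP xs /adjoinP ys]; apply/adjoinP=> k kF sk.
- by case: kF => -[].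
- by case: (kF) => -[_ + _] _; apply; [apply: xs | apply: ys].
- by case: (kF) => -[_ _ +] _; apply; [apply: xs | apply: ys].
Qed.

Lemma mem_adjoin s : {subset s <= adjoin s}.
Proof. by move=> x xs; apply/adjoinP=> k _; apply. Qed.

Lemma adjoin_sub s k :
  intermediate_field iota k -> {subset s <= k} -> {subset adjoin s <= k}.
Proof. by move=> kF sk x /adjoinP; apply. Qed.

Lemma intermediate_alg_closure k :
  intermediate_field iota k -> intermediate_field iota (alg_closure k).
Proof.
case=> kP kK; split; first exact: alg_closure_divring.
by move=> a; apply: sub_alg_closure.
Qed.

(** The closure operator of the matroid of algebraic dependence over K. *)
Definition clo s : {pred L} := alg_closure (adjoin s).

Lemma clo_field s : intermediate_field iota (clo s).
Proof. exact/intermediate_alg_closure/adjoin_field. Qed.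

Lemma mem_clo s : {subset s <= clo s}.
Proof.
move=> x xs; apply: sub_alg_closure; first by case: (adjoin_field s).
exact: mem_adjoin.
Qed.

Lemma clo_sub s s' : {subset s <= clo s'} -> {subset clo s <= clo s'}.
Proof.
move=> ss' x xs.
apply: alg_closure_idem; first by case: (adjoin_field s').
by apply: alg_closure_mono xs; apply: adjoin_sub => //; apply: clo_field.
Qed.

Lemma clo_mono s s' : {subset s <= s'} -> {subset clo s <= clo s'}.
Proof. by move=> ss'; apply: clo_sub => x /ss'; apply: mem_clo. Qed.

End Adjoin.

(** * The exchange property of algebraic dependence *)

Lemma map_poly_Horner (R S : nzRingType) (f : {rmorphism R -> S}) (P : {poly R}) b c :
  map_poly f ((b *: P) * 'X + c%:P) = (f b *: map_poly f P) * 'X + (f c)%:P.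
Proof. by rewrite rmorphD rmorphM /= map_polyZ map_polyX map_polyC. Qed.

Lemma horner_map_ev (F L : fieldType) (w : {rmorphism F -> L})
    (Q : {poly {poly F}}) a b :
  (map_poly (horner_eval a \o map_poly w) Q).[b] = (map_poly (map_poly w) Q).[b%:P].[a].
Proof.
have -> : map_poly (horner_eval a \o map_poly w) Q =
          map_poly (horner_eval a) (map_poly (map_poly w) Q).
  by rewrite map_poly_comp.
have E : horner_eval a b%:P = b by exact: hornerC.
by rewrite -{1}E horner_map.
Qed.

Section Fractions.

Variables (R : comNzRingType) (L : fieldType) (f : {rmorphism R -> L}).

(** The fraction field of the image of [f]. *)
Definition fractions : {pred L} :=
  [pred z | `[< exists p q, f q != 0 /\ z = f p / f q >]].

Lemma fractionsP z :
  reflect (exists p q, f q != 0 /\ z = f p / f q) (z \in fractions).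
Proof. exact: asboolP. Qed.

Lemma mem_fractions a : f a \in fractions.
Proof. by apply/fractionsP; exists a, 1; rewrite rmorph1 oner_neq0 divr1. Qed.

Lemma fractions_divring : divring_closed fractions.
Proof.
split=> [|x1 x2|x1 x2]; first by rewrite -(rmorph1 f) mem_fractions.
- case/fractionsP=> p1 [q1 [nz1 ->]] /fractionsP[p2 [q2 [nz2 ->]]].
  apply/fractionsP.
  exists (p1 * q2 - p2 * q1), (q1 * q2); rewrite rmorphM mulf_neq0 //; split=> //.
  rewrite rmorphB !rmorphM; apply: (canRL (mulfK _)); first by rewrite mulf_neq0.
  rewrite mulrBl; congr (_ - _); first by rewrite mulrA divfK.
  by rewrite (mulrC (f q1)) mulrA divfK.
- case/fractionsP=> p1 [q1 [nz1 ->]] /fractionsP[p2 [q2 [nz2 ->]]].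
  apply/fractionsP; have [p20|p2nz] := eqVneq (f p2) 0.
    by exists 0, 1; rewrite rmorph1 oner_neq0 rmorph0 p20 mul0r invr0 mulr0 mul0r.
  exists (p1 * q2), (q1 * p2); rewrite rmorphM mulf_neq0 //; split=> //.
  by rewrite !rmorphM !invfM invrK [RHS]mulrACA (mulrC (f q2)).
Qed.

Lemma clear_denominators (p : {poly L}) : (forall i, p`_i \in fractions) ->
  exists q P, f q != 0 /\ map_poly f P = f q *: p.
Proof.
elim/poly_ind: p => [|p c IH] pk.
  by exists 1, 0; rewrite rmorph1 oner_neq0 !rmorph0 scaler0.
have [i|q [P [nzq EP]]] := IH.
  by have := pk i.+1; rewrite coefD coefMX coefC /= addr0.
have /fractionsP[a [b [nzb Ec]]] : c \in fractions.
  by have := pk 0; rewrite coefD coefMX coefC /= add0r.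
exists (q * b), ((b *: P) * 'X + (q * a)%:P); split.
  by rewrite rmorphM mulf_neq0.
rewrite map_poly_Horner EP rmorphM scalerDr; congr (_ + _).
  by rewrite !scalerA -scalerAl mulrC.
by rewrite -mul_polyC -polyCM Ec rmorphM -mulrA [f b * _]mulrC divfK.
Qed.

End Fractions.

Section Exchange.

Variables (K L : fieldType) (iota : {rmorphism K -> L}).
Implicit Types (k : {pred L}) (x y z : L) (s : seq L).
Local Notation adjoin := (adjoin iota).
Local Notation clo := (clo iota).

Section OneStep.

Variable s : seq L.
Let kP : divring_closed (adjoin s) := proj1 (adjoin_field iota s).
Let F : fieldType := subfield kP.
Let v : {rmorphism F -> L} := @subfield_val L (adjoin s) kP.
Definition ev y : {rmorphism {poly F} -> L} := (horner_eval y \o map_poly v)%FUN.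

Lemma ev_adjoin y p : ev y p \in adjoin (y :: s).
Proof.
have [gP _] := adjoin_field iota (y :: s).
rewrite /= /horner_eval horner_coef.
apply: (@rpred_sum _ (subfield_pred gP)) => i _; apply: rpredM; last first.
  by apply: rpredX; apply: mem_adjoin; rewrite mem_head.
rewrite coef_map /=; case: (p`_i) => c /= cs.
apply: adjoin_sub cs; first exact: adjoin_field.
by move=> z zs; apply: (mem_adjoin iota); rewrite inE zs orbT.
Qed.

Lemma adjoin_cons y : {subset adjoin (y :: s) <= fractions (ev y)}.
Proof.
have evC (c : F) : v c \in fractions (ev y).
  have E : ev y c%:P = v c by rewrite /= /horner_eval map_polyC hornerC.
  by have := mem_fractions (ev y) c%:P; rewrite E.
apply: adjoin_sub; last first.
  move=> z; rewrite inE => /orP[/eqP->|zs].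
    have E : ev y 'X = y by rewrite /= /horner_eval map_polyX hornerX.
    by have := mem_fractions (ev y) 'X; rewrite E.
  have zg : z \in subfield_pred kP by apply: mem_adjoin.
  exact: (evC (Subfield zg)).
split; first exact: fractions_divring.
move=> a; have ag : iota a \in subfield_pred kP by apply: (proj2 (adjoin_field iota s)).
exact: (evC (Subfield ag)).
Qed.

End OneStep.

(** An equation for x over K(s)(y) becomes, once denominators are cleared, a
    polynomial relation P(y, x) = 0 over K(s). Read as a polynomial in y with
    coefficients evaluated at x it is still nonzero, because x is transcendental
    over K(s), so that it is an equation for y over K(s)(x). *)
Lemma clo_exchange s x y :
  x \in clo (y :: s) -> x \notin clo s -> y \in clo (x :: s).
Proof.
move=> /alg_closureP[p [p0 pk rp]] xs.
have [q [P [nzq EP]]] := clear_denominators (fun i => adjoin_cons (pk i)).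
have P0 : map_poly (ev s y) P != 0 by rewrite EP scaler_eq0 negb_or nzq.
have rP : root (map_poly (ev s y) P) x by rewrite EP rootE hornerZ (rootP rp) mulr0.
apply/alg_closureP; exists (map_poly (ev s x) (swapXY P)); split.
- apply/negP => /eqP E; case/negP: P0.
  suff : swapXY P = 0 by move/eqP; rewrite swapXY_eq0 => /eqP ->; rewrite rmorph0.
  apply/polyP=> i; rewrite coef0; apply/eqP; apply: contraNT xs => nz.
  apply/alg_closureP; apply/(algebraic_subfieldP (proj1 (adjoin_field iota s))).
  exists ((swapXY P)`_i) => //; apply/rootP.
  by have := congr1 (fun p : {poly L} => p`_i) E; rewrite coef_map coef0.
- by move=> i; rewrite coef_map; apply: ev_adjoin.
- move/rootP: rP => rP; apply/rootP; rewrite -[RHS]rP.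
  pose w : {rmorphism subfield (proj1 (adjoin_field iota s)) -> L} := 
    @subfield_val L (adjoin s) (proj1 (adjoin_field iota s)).
  have Ev (Q : {poly {poly subfield (proj1 (adjoin_field iota s))}}) a b :
     (map_poly (ev s a) Q).[b] = (map_poly (map_poly w) Q).[b%:P].[a].
    exact: horner_map_ev.
  by rewrite !Ev -swapXY_map horner2_swapXY.
Qed.

(** Every entry of [t] is transcendental over K(A) and the entries before it. *)
Fixpoint indep (A t : seq L) : Prop :=
  if t is x :: t' then x \notin clo A /\ indep (x :: A) t' else True.

Lemma indep_rcons A t x :
  indep A (rcons t x) <-> indep A t /\ x \notin clo (A ++ t).
Proof.
elim: t A => [|y t IH] A /=; first by rewrite cats0; split=> [[]|[]].
have E : {subset clo (A ++ y :: t) <= clo ((y :: A) ++ t)} /\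
         {subset clo ((y :: A) ++ t) <= clo (A ++ y :: t)}.
  by split; apply: clo_mono => z; rewrite !(inE, mem_cat); case: (z == y); rewrite ?orbT.
split=> [[yA /IH[it xt]]|[[yA it] xt]].
  by split=> //; apply: contra xt; apply: (proj1 E).
by split=> //; apply/IH; split=> //; apply: contra xt; apply: (proj2 E).
Qed.

(** Adding the entries of [s] one at a time, there is a first one, y, that makes
    x algebraic; this is where [clo_exchange] applies. *)
Lemma first_jump A s x : x \in clo (A ++ s) -> x \notin clo A ->
  exists s1 y s2, [/\ s = s1 ++ y :: s2, x \notin clo (A ++ s1)
                    & x \in clo (y :: A ++ s1)].
Proof.
elim/last_ind: s => [|s y IH]; first by rewrite cats0 => ->.
move=> xs xA; have [xs'|xs'] := boolP (x \in clo (A ++ s)).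
  have [s1 [z [s2 [-> h1 h2]]]] := IH xs' xA.
  by exists s1, z, (rcons s2 y); rewrite rcons_cat.
exists s, y, [::]; split=> //; first by rewrite cats1.
apply: clo_mono xs => z; rewrite mem_cat mem_rcons !inE mem_cat orbCA.
by rewrite orbC.
Qed.

(** Steinitz: the head of [t] replaces one entry of [s] in the closure and joins
    the base [A], which shortens both lists by one. *)
Theorem steinitz_exchange A s t :
  indep A t -> {subset t <= clo (A ++ s)} -> (size t <= size s)%N.
Proof.
elim: t A s => //= x t IH A s [xA it] ts.
have xs : x \in clo (A ++ s) by apply: ts; rewrite mem_head.
have [s1 [y [s2 [Es xs1 xys1]]]] := first_jump xs xA.
have y_in := clo_exchange xys1 xs1.
suff : (size t <= size (s1 ++ s2))%N by rewrite Es !size_cat /= addnS ltnS.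
apply: IH it _ => z zt; have : z \in clo (A ++ s) by apply: ts; rewrite inE zt orbT.
apply: clo_sub => u; rewrite Es !mem_cat inE => /or4P[uA|us1|/eqP->|us2].
- by apply: mem_clo; rewrite mem_cat inE uA orbT.
- by apply: mem_clo; rewrite !mem_cat us1 orbT.
- apply: clo_mono y_in => w; rewrite !(inE, mem_cat).
  by case/or3P=> ->; rewrite ?orbT.
- by apply: mem_clo; rewrite !mem_cat us2 !orbT.
Qed.

End Exchange.

(** * Polynomials in n + 1 variables as polynomials in the last variable *)

Local Notation widen := (widen_ord (leqnSn _)).

Section ExtendFamily.

Variables (T : Type) (n : nat) (b : 'I_n -> T) (x : T).

Definition extend_family (i : 'I_n.+1) : T :=
  if insub (i : nat) is Some j then b j else x.

Lemma extend_widen : (fun i => extend_family (widen i)) = b.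
Proof.
apply/funext => i; rewrite /extend_family /=; case: insubP => [j _ Ej|].
  by congr b; apply/val_inj.
by rewrite ltn_ord.
Qed.

Lemma extend_max : extend_family ord_max = x.
Proof. by rewrite /extend_family insubF //= ltnn. Qed.

Lemma extend_ind (P : T -> Prop) : (forall j, P (b j)) -> P x ->
  forall i, P (extend_family i).
Proof. by move=> Pb Px i; rewrite /extend_family; case: insub. Qed.

End ExtendFamily.

Section MpolyMorphisms.

Variables (n : nat) (R : comNzRingType) (S : comNzRingType).

Lemma mpoly_rmorphE (f : {rmorphism {mpoly R[n]} -> S}) p :
  f p = mmap (f \o @mpolyC n R)%FUN (fun i => f 'X_i) p.
Proof.
elim/mpolyind: p => [|c m p _ _ IH]; first by rewrite !raddf0.
rewrite !raddfD /= -IH; congr (_ + _).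
rewrite -mul_mpolyC rmorphM [RHS]rmorphM /= mmapC mmapX /=; congr (_ * _).
rewrite mpolyXE_id rmorph_prod /mmap1; apply: eq_bigr => i _.
by rewrite rmorphXn.
Qed.

Lemma eq_mpoly_rmorph (f g : {rmorphism {mpoly R[n]} -> S}) :
  (forall c, f c%:MP = g c%:MP) -> (forall i, f 'X_i = g 'X_i) -> f =1 g.
Proof.
move=> fgC fgX p; rewrite [LHS]mpoly_rmorphE [RHS]mpoly_rmorphE.
rewrite /mmap; apply: eq_bigr => m _ /=; rewrite fgC; congr (_ * _).
by apply: eq_bigr => i _; rewrite fgX.
Qed.

End MpolyMorphisms.


Lemma mpoly0E (R : nzRingType) (p : {mpoly R[0]}) : p = (p@_0)%:MP.
Proof.
apply/mpolyP=> m; rewrite mcoeffC; have -> : m = 0%MM by apply/mnmP => -[].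
by rewrite eqxx mulr1.
Qed.

Section Muni.

Variables (n : nat) (R : comNzRingType).

Lemma muniX_max : muni ('X_ord_max : {mpoly R[n.+1]}) = 'X.
Proof.
rewrite /muni mmapX mmap1U; case: splitP => // -[j ltj] /= /eqP.
by rewrite eq_sym ltn_eqF.
Qed.

Lemma muniX_widen i : muni ('X_(widen i) : {mpoly R[n.+1]}) = ('X_i)%:P.
Proof.
rewrite /muni mmapX mmap1U; case: splitP => [j eq_ij|j].
  by congr ('X__)%:P; apply/val_inj.
by rewrite ord1 /= addn0 => /eqP; rewrite ltn_eqF.
Qed.

Lemma muni_widen (p : {mpoly R[n]}) : muni (mwiden p) = p%:P.
Proof.
pose f : {rmorphism {mpoly R[n]} -> {poly {mpoly R[n]}}} := (@muni n R \o @mwiden n R)%FUN.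
apply: (eq_mpoly_rmorph (f := f) (g := polyC)) => [c|i] /=.
  by rewrite mwidenC muniC.
by rewrite mwidenX mnmwiden1 muniX_widen.
Qed.

Lemma ord_maxVwiden (i : 'I_n.+1) : i = ord_max \/ exists j, i = widen j.
Proof.
have [lt_in|] := ltnP i n; last first.
  by move=> le_ni; left; apply/val_inj/eqP; rewrite /= eqn_leq le_ni andbT -ltnS.
by right; exists (Ordinal lt_in); apply/val_inj.
Qed.

Definition of_muni : {rmorphism {poly {mpoly R[n]}} -> {mpoly R[n.+1]}} :=
  (horner_eval 'X_ord_max \o map_poly (@mwiden n R))%FUN.

Lemma of_muniK P : muni (of_muni P) = P.
Proof.
rewrite /= /horner_eval -horner_map /= muniX_max -map_poly_comp.
rewrite (eq_map_poly (g := polyC)); last by move=> p /=; rewrite muni_widen.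
by rewrite -/(comp_poly 'X P) comp_polyXr.
Qed.

Lemma muniK p : of_muni (muni p) = p.
Proof.
pose f : {rmorphism {mpoly R[n.+1]} -> {mpoly R[n.+1]}} := (of_muni \o @muni n R)%FUN.
apply: (eq_mpoly_rmorph (f := f) (g := idfun)) => [c|i].
  by rewrite /= muniC /horner_eval map_polyC hornerC /= mwidenC.
case: (ord_maxVwiden i) => [->|[j ->]].
  by rewrite /= muniX_max /horner_eval map_polyX hornerX.
by rewrite /= muniX_widen /horner_eval map_polyC hornerC /= mwidenX mnmwiden1.
Qed.

Lemma muni_eq0 (p : {mpoly R[n.+1]}) : (muni p == 0) = (p == 0).
Proof.
apply/eqP/eqP => [E|->]; last by rewrite raddf0.
by rewrite -(muniK p) E rmorph0.
Qed.

Lemma mmap_muni (S : comNzRingType) (f : {rmorphism R -> S}) (t : 'I_n.+1 -> S) p :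
  mmap f t p = (map_poly (mmap f (fun i => t (widen i))) (muni p)).[t ord_max].
Proof.
pose g : {rmorphism {mpoly R[n]} -> S} := mmap f (fun i => t (widen i)).
pose h : {rmorphism {mpoly R[n.+1]} -> S} :=
  (horner_eval (t ord_max) \o (map_poly g \o @muni n R))%FUN.
apply: (eq_mpoly_rmorph (f := mmap f t) (g := h)) => [c|i] /=.
  by rewrite muniC /horner_eval map_polyC hornerC /= !mmapC.
rewrite mmapX mmap1U; case: (ord_maxVwiden i) => [->|[j ->]].
  by rewrite muniX_max /horner_eval map_polyX hornerX.
by rewrite muniX_widen /horner_eval map_polyC hornerC /= mmapX mmap1U.
Qed.

End Muni.
Arguments of_muni {n R}.

(** * Transcendence degree *)

Section Trdeg.

Variables (K L : fieldType) (iota : {rmorphism K -> L}).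
Implicit Types (E : {pred L}) (s : seq L).
Local Notation clo := (clo iota).
Local Notation adjoin := (adjoin iota).

Lemma codom_ordSr n (t : 'I_n.+1 -> L) :
  codom t = rcons (codom (fun i => t (widen i))) (t ord_max).
Proof. by rewrite /codom /image_mem enum_ordSr map_rcons -map_comp. Qed.

Lemma alg_independent0 (t : 'I_0 -> L) : alg_independent iota t.
Proof.
move=> p; rewrite (mpoly0E p) mmapC => /eqP; rewrite fmorph_eq0 => /eqP ->.
exact: mpolyC0.
Qed.

Lemma adjoin_codom n (t : 'I_n -> L) :
  {subset adjoin (codom t) <= fractions (mmap iota t)}.
Proof.
apply: adjoin_sub; first split; first exact: fractions_divring.
  by move=> a; rewrite -(mmapC t iota a); apply: mem_fractions.
move=> _ /codomP[i ->]; rewrite -(mmap1U t i) -(mmapX t iota).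
exact: mem_fractions.
Qed.

Lemma alg_independent_widen n (t : 'I_n.+1 -> L) :
  alg_independent iota t -> alg_independent iota (fun i => t (widen i)).
Proof.
move=> it p Ep; have : mwiden p = 0.
  apply: it; rewrite mmap_muni muni_widen map_polyC hornerC.
  exact: Ep.
by rewrite -(mwiden0 n K) => /inj_mwiden.
Qed.

(** An algebraic equation of the last element over the others, freed of its
    denominators, is a polynomial relation between all of them. *)
Lemma alg_independent_indep n (t : 'I_n -> L) :
  alg_independent iota t -> indep iota [::] (codom t).
Proof.
elim: n t => [|n IH] t it.
  by rewrite /codom /image_mem enum_ord0.
rewrite codom_ordSr; apply/indep_rcons; split.
  exact/IH/alg_independent_widen.
apply/negP => /alg_closureP[p [p0 pk rp]].
have [q [P [nzq EP]]] := clear_denominators (fun i => adjoin_codom (pk i)).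
suff P0 : P = 0.
  by move: EP; rewrite P0 rmorph0 => /esym/eqP; rewrite scaler_eq0 (negbTE nzq) (negbTE p0).
rewrite -(of_muniK P) (it (of_muni P)) ?raddf0 //.
by rewrite mmap_muni of_muniK EP hornerZ (rootP rp) mulr0.
Qed.

(** Half of [is_trdeg]; unlike the latter it passes to subsets and to residue
    fields, which is how upper bounds are transported below. *)
Definition trdeg_le E d := forall n (t : 'I_n -> L),
  (forall i, t i \in E) -> alg_independent iota t -> (n <= d)%N.

Lemma trdeg_le_sub E E' d :
  {subset E <= E'} -> trdeg_le E' d -> trdeg_le E d.
Proof. by move=> EE' E'd n t tE; apply: E'd => i; apply/EE'. Qed.

(** Steinitz exchange, for independence in the sense of polynomial relations. *)
Lemma trdeg_le_clo s : trdeg_le (clo s) (size s).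
Proof.
move=> n t ts /alg_independent_indep it.
have := steinitz_exchange (s := s) it; rewrite size_codom card_ord; apply.
by move=> _ /codomP[i ->].
Qed.

Lemma dependent_alg n (t : 'I_n.+1 -> L) :
  alg_independent iota (fun i => t (widen i)) -> ~ alg_independent iota t ->
  t ord_max \in clo (codom (fun i => t (widen i))).
Proof.
move=> iw nit; have [p [p0 Ep]] : exists p, p != 0 /\ mmap iota t p = 0.
  apply: contrapT => H; apply: nit => p Ep; apply: contrapT => p0.
  by apply: H; exists p; split=> //; apply/eqP.
apply/alg_closureP.
exists (map_poly (mmap iota (fun i => t (widen i))) (muni p)); split.
- rewrite map_poly_eq0_id0 ?muni_eq0 //.
  apply/negP => /eqP /iw/eqP; rewrite lead_coef_eq0 muni_eq0.
  exact/negP.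
- move=> i; rewrite coef_map /=.
  set q := (muni p)`_i; have [gP gK] := adjoin_field iota (codom (fun i => t (widen i))).
  rewrite /mmap; apply: (@rpred_sum _ (subfield_pred gP)) => m _.
  apply: rpredM; first exact: gK.
  apply: rpred_prod => j _; apply: rpredX; apply: mem_adjoin; exact: codom_f.
- by apply/rootP; rewrite -mmap_muni.
Qed.

(** A largest independent family in E is a transcendence basis. *)
Lemma trdeg_basis E d : trdeg_le E d ->
  exists n (b : 'I_n -> L), [/\ (n <= d)%N, forall i, b i \in E,
    alg_independent iota b, {subset E <= clo (codom b)} & is_trdeg iota E n].
Proof.
move=> Ed.
pose Q n := `[< exists t : 'I_n -> L, (forall i, t i \in E) /\ alg_independent iota t >].
have Q0 : exists n, Q n.
  by exists 0%N; apply/asboolP; exists (fun=> 0); split=> [[]//|]; apply: alg_independent0.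
have Qd n : Q n -> (n <= d)%N by case/asboolP=> t [tE it]; apply: Ed it.
case: (ex_maxnP Q0 Qd) => n /asboolP[b [bE ib]] nmax.
exists n, b; split=> //; first by apply: Ed ib.
  move=> x xE; have := @dependent_alg n (extend_family b x).
  rewrite extend_widen extend_max; apply=> // it.
  suff : (n.+1 <= n)%N by rewrite ltnn.
  apply: nmax; apply/asboolP; exists (extend_family b x); split=> //.
    exact: (extend_ind (P := fun z => z \in E)).
by split; [exists b | move=> d' t tE it; apply: nmax; apply/asboolP; exists t].
Qed.

Lemma is_trdeg_le E d : is_trdeg iota E d -> trdeg_le E d.
Proof. by case=> _ Ed n t; apply: Ed. Qed.

End Trdeg.

Section BaseChange.

Variables (K K' L : fieldType) (kappa : {rmorphism K -> K'}).
Variables (iota : {rmorphism K -> L}) (iota' : {rmorphism K' -> L}).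
Hypothesis iotaE : forall a, iota a = iota' (kappa a).

Lemma clo_base_change s : {subset clo iota s <= clo iota' s}.
Proof.
apply: alg_closure_mono; apply: adjoin_sub; last exact: mem_adjoin.
have [gP gK] := adjoin_field iota' s; split=> // a; rewrite iotaE; exact: gK.
Qed.

End BaseChange.

(** * Finite groups of automorphisms and essential dimension *)

Section Dedekind.

Variables (L : fieldType) (I : finType) (sigma : I -> {rmorphism L -> L}).
Variable E : {pred L}.
Hypothesis sigma_sep :
  forall i j, i != j -> exists2 y, y \in E & sigma i y != sigma j y.
Hypotheses (E1 : 1 \in E) (EM : forall x y, x \in E -> y \in E -> x * y \in E).

(** If lambda annihilates E, so does i |-> lambda i * (sigma i y - c) for every y
    in E and every scalar c. Taking c = sigma j y with y separating i0 from j
    kills the coefficient at j and keeps the one at i0; doing this for all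
    j <> i0 leaves a single coefficient, which vanishes because 1 is in E. *)
Lemma dedekind_independence (lambda : I -> L) :
  (forall x, x \in E -> \sum_i lambda i * sigma i x = 0) ->
  forall i, lambda i = 0.
Proof.
move=> lambda0 i0.
suff kill (r : seq I) : i0 \notin r -> exists kappa : I -> L,
    [/\ kappa i0 != 0, forall j, j \in r -> kappa j = 0 &
      forall x, x \in E -> \sum_i lambda i * kappa i * sigma i x = 0].
  have [|kappa [k0 kr kE]] := kill (rem i0 (enum I)).
    by rewrite (mem_rem_uniq _ (enum_uniq I)) inE eqxx.
  have := kE 1 E1; rewrite (bigD1 i0) //= big1 => [|j ji0]; last first.
    rewrite kr ?mulr0 ?mul0r // (mem_rem_uniq _ (enum_uniq I)) inE /= ji0.
    by rewrite mem_enum.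
  rewrite addr0 rmorph1 mulr1 => /eqP; rewrite mulf_eq0 (negbTE k0) orbF.
  by move/eqP.
elim: r => [_|j r IH].
  exists (fun=> 1); split=> // [|x xE]; first exact: oner_neq0.
  by rewrite -[RHS](lambda0 x xE); apply: eq_bigr => i _; rewrite mulr1.
rewrite inE negb_or => /andP[i0j /IH[kappa [k0 kr kE]]].
have [y yE yij] := sigma_sep i0j.
exists (fun i => kappa i * (sigma i y - sigma j y)); split=> [|i|x xE].
- by rewrite mulf_neq0 // subr_eq0.
- by rewrite inE => /orP[/eqP->|/kr->]; rewrite ?subrr ?mulr0 ?mul0r.
transitivity (\sum_i lambda i * kappa i * sigma i (y * x)
    - sigma j y * \sum_i lambda i * kappa i * sigma i x); last first.
  by rewrite (kE x xE) (kE _ (EM yE xE)) mulr0 subr0.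
rewrite mulr_sumr -sumrB; apply: eq_bigr => i _.
by rewrite rmorphM mulrA -mulrA mulrBl mulrBr [sigma j y * (_ * _)]mulrCA.
Qed.

End Dedekind.

(** Multiplication by y in E is a matrix over E0 with eigenvalue y, so that y is
    a root of its characteristic polynomial. *)
Lemma finite_degree_alg (L : fieldType) (E0 E : {pred L}) n :
  divring_closed E0 -> divring_closed E -> is_degree E0 E n ->
  {subset E <= alg_closure E0}.
Proof.
move=> E0P EP [e [eE _ esp]] y yE.
have ye i : y * e i \in E by apply: (@rpredM _ (subfield_pred EP)); [|apply: eE].
have /choice[a aP] i : exists a : 'I_n -> L,
    (forall j, a j \in E0) /\ y * e i = \sum_j a j * e j.
  by have [a aE0 Ea] := esp _ (ye i); exists a.
pose A : 'M[subfield E0P]_n :=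
  \matrix_(j, i) Subfield ((aP i).1 j : a i j \in subfield_pred E0P).
apply/alg_closureP/(algebraic_subfieldP E0P).
exists (char_poly A); first exact/monic_neq0/char_poly_monic.
rewrite map_char_poly -eigenvalue_root_char; apply/eigenvalueP.
exists (\row_j e j); first last.
  apply/eqP => e0; have [c _] := esp 1 (let: And3 h _ _ := EP in h).
  rewrite big1 => [/eqP|i _]; first by rewrite oner_eq0.
  by have /rowP/(_ i) := e0; rewrite !mxE => ->; rewrite mulr0.
apply/rowP => i; rewrite !mxE (aP i).2; apply: eq_bigr => j _.
by rewrite !mxE mulrC.
Qed.

Section Action.

Variables (K L : fieldType) (iota : {rmorphism K -> L}).
Variables (gT : finGroupType) (act : gT -> {rmorphism L -> L}).
Implicit Types (E F : {pred L}) (g h : gT).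

Definition is_action : Prop :=
  [/\ forall x, act 1%g x = x,
      forall g h x, act (g * h)%g x = act g (act h x)
    & forall g a, act g (iota a) = iota a].

Definition stable E := forall g x, x \in E -> act g x \in E.

Definition faithful_on E := forall g, (forall x, x \in E -> act g x = x) -> g = 1%g.

(** The equivariant form of an upper bound for the essential dimension of
    L / L^G: a G-stable subfield of L of transcendence degree at most d over K
    on which G acts faithfully. *)
Definition ed_le d := exists E, [/\ intermediate_field iota E, stable E,
  faithful_on E & trdeg_le iota E d].

Hypothesis actP : is_action.

Lemma act_one x : act 1%g x = x. Proof. by case: actP. Qed.
Lemma act_mul g h x : act (g * h)%g x = act g (act h x). Proof. by case: actP. Qed.
Lemma act_const g a : act g (iota a) = iota a. Proof. by case: actP. Qed.
Lemma act_cancel g : cancel (act g) (act g^-1%g).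
Proof. by move=> x; rewrite -act_mul mulVg act_one. Qed.
Lemma faithful_sep E : faithful_on E ->
  forall g h, g != h -> exists2 y, y \in E & act g y != act h y.
Proof.
move=> Ef g h gh; apply: contrapT => H; case/eqP: gh.
apply: (mulgI g^-1%g); rewrite mulVg; apply/esym/Ef => x xE.
rewrite act_mul; apply: (canLR (act_cancel g)); apply/eqP; apply: contrapT => nx.
by apply: H; exists x => //; apply/negP => /eqP E0; case: nx; rewrite E0.
Qed.

Lemma faithful_moves E : faithful_on E ->
  forall g, g != 1%g -> exists2 y, y \in E & act g y != y.
Proof.
move=> Ef g /(faithful_sep Ef)[y yE gy]; exists y => //.
by apply: contra_neq gy => ->; rewrite act_one.
Qed.

Definition fixed_field : {pred L} := [pred z | [forall g, act g z == z]].

Lemma fixed_fieldP z : reflect (forall g, act g z = z) (z \in fixed_field).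
Proof. exact: 'forall_eqP. Qed.

Lemma fixed_field_intermediate : intermediate_field iota fixed_field.
Proof.
split; last by move=> a; apply/fixed_fieldP => g; apply: act_const.
split=> [|x y /fixed_fieldP fx /fixed_fieldP fy|x y /fixed_fieldP fx /fixed_fieldP fy];
  apply/fixed_fieldP => g.
- exact: rmorph1.
- by rewrite rmorphB fx fy.
- by rewrite fmorph_div fx fy.
Qed.

Section Artin.

Variable E : {pred L}.
Hypotheses (EP : divring_closed E) (Ef : faithful_on E).

Let n := #|{: gT}|.
Let conj (i : 'I_n) : {rmorphism L -> L} := act (enum_val i).

(** Choose the e i so that the rows (conj j (e i))_j are independent and as many
    as possible. If they do not span, some nonzero vector is orthogonal to all of
    them, hence, by maximality, to (conj j x)_j for every x in E, which
    contradicts the independence of the automorphisms on E. *)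
Lemma conj_matrix_unit : exists2 e : 'I_n -> L, (forall i, e i \in E) &
  (\matrix_(i, j) conj j (e i)) \in unitmx.
Proof.
pose M k (e : 'I_k -> L) := \matrix_(i < k, j < n) conj j (e i).
pose Q k := `[< exists2 e : 'I_k -> L, (forall i, e i \in E) & row_free (M k e) >].
have Q0 : exists k, Q k.
  exists 0%N; apply/asboolP; exists (fun=> 0) => [[]//|].
  by rewrite /row_free -leqn0 rank_leq_row.
have Qn k : Q k -> (k <= n)%N.
  by case/asboolP=> e _ /eqP <-; apply: rank_leq_col.
case: (ex_maxnP Q0 Qn) => k /asboolP[e eE ef] kmax.
have [kn|kn] := eqVneq k n.
  by move: e eE ef; rewrite kn => e eE; rewrite row_free_unit; exists e.
have lt_kn : (k < n)%N by rewrite ltn_neqAle kn Qn //; apply/asboolP; exists e.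
have : kermx (M k e)^T != 0.
  rewrite -mxrank_eq0 mxrank_ker mxrank_tr -lt0n subn_gt0.
  by apply: leq_ltn_trans lt_kn; apply: rank_leq_row.
case/rowV0Pn => v /sub_kermxP vM v0; case/eqP: v0.
have sep (i j : 'I_n) : i != j -> exists2 y, y \in E & conj i y != conj j y.
  by move=> ij; apply: faithful_sep => //; rewrite (inj_eq enum_val_inj).
case: EP => E1 _ Ediv; have EM x y : x \in E -> y \in E -> x * y \in E.
  by move=> xE yE; apply: (@rpredM _ (subfield_pred EP)).
apply/rowP => i; rewrite mxE; move: i.
apply: (dedekind_independence sep E1 EM) => x xE.
pose u : 'rV_n := \row_j conj j x.
have uM : (u <= M k e)%MS.
  have le_k : (\rank (M k e + u)%MS <= k)%N.
    rewrite leqNgt; apply/negP => lt_k; suff : (k.+1 <= k)%N by rewrite ltnn.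
    apply: kmax; apply/asboolP; exists (extend_family e x).
      exact: (extend_ind (P := fun z => z \in E)).
    rewrite /row_free eqn_leq rank_leq_row; apply: leq_trans lt_k _.
    apply: mxrankS; rewrite addsmx_sub; apply/andP; split; apply/row_subP => i.
      have -> : row i (M k e) =
          row (widen_ord (leqnSn k) i) (M k.+1 (extend_family e x)).
        apply/rowP => j; rewrite !mxE.
        by rewrite -[in LHS](extend_widen e x).
      exact: row_sub.
    have -> : row i u = row ord_max (M k.+1 (extend_family e x)).
      by apply/rowP => j; rewrite !mxE extend_max.
    exact: row_sub.
  have := mxrank_leqif_sup (addsmxSl (M k e) u).
  rewrite (eqP ef) => -[_ H].
  have : (M k e + u <= M k e)%MS.
    by rewrite -H eqn_leq le_k andbT -{1}(eqP ef) mxrankS // addsmxSl.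
  by apply: submx_trans; apply: addsmxSr.
have : v *m u^T = 0.
  by case/submxP: uM => D ->; rewrite trmx_mul mulmxA vM mul0mx.
move/rowP/(_ ord0); rewrite !mxE => vu.
by rewrite -[RHS]vu; apply: eq_bigr => i _; rewrite !mxE.
Qed.

(** One family e in E is at once a basis of E / E^G and of L / L^G: the
    coordinates of x are the solution of the invertible linear system
    g x = sum_i c i * g (e i), g in G, whose uniqueness makes them fixed by G. *)
Lemma artin_basis : exists e : 'I_n -> L, (forall i, e i \in E) /\
  forall F, divring_closed F -> stable F -> {subset E <= F} ->
    is_basis [pred z | (z \in F) && (z \in fixed_field)] F e.
Proof.
have [e eE Mu] := conj_matrix_unit; exists e; split=> // F FP Fs EF.
set M := (\matrix_(i, j) _) in Mu.
have expand (c : 'I_n -> L) y (g : gT) : (forall i, c i \in fixed_field) ->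
    y = \sum_i c i * e i -> act g y = \sum_i c i * act g (e i).
  move=> cf ->; rewrite rmorph_sum; apply: eq_bigr => i _.
  by rewrite rmorphM; congr (_ * _); apply/fixed_fieldP.
split=> [i|c cf c0 i|x xF]; first exact/EF/eE.
- have cM : (\row_i c i) *m M = 0.
    apply/rowP => j; rewrite !mxE.
    transitivity (act (enum_val j) (\sum_(i < n) c i * e i)); last by rewrite c0 rmorph0.
    have cff k : c k \in fixed_field by have /andP[] := cf k.
    rewrite [RHS](expand c _ (enum_val j) cff erefl).
    by apply: eq_bigr => k _; rewrite !mxE.
  have /rowP/(_ i) : \row_i c i = 0 by rewrite -(mulmxK Mu (\row_i c i)) cM mul0mx.
  by rewrite !mxE.
pose X : 'rV_n := \row_j conj j x; pose c := X *m invmx M.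
have cM : c *m M = X by rewrite mulmxKV.
have cF i : c 0 i \in F.
  pose v := @subfield_val L F FP.
  have [M0 EM] : exists M0, M = map_mx v M0.
    have MF i' j' : M i' j' \in subfield_pred FP by rewrite mxE; apply/Fs/EF.
    exists (\matrix_(i', j') Subfield (MF i' j')); apply/matrixP=> i' j'.
    by rewrite [RHS]mxE [in RHS]mxE.
  have [X0 EX] : exists X0, X = map_mx v X0.
    have XF i' j' : X i' j' \in subfield_pred FP by rewrite mxE; apply/Fs.
    exists (\matrix_(i', j') Subfield (XF i' j')); apply/matrixP=> i' j'.
    by rewrite [RHS]mxE [in RHS]mxE.
  rewrite /c EX EM -map_invmx -map_mxM mxE /=; case: (_ 0 i) => z zF; exact: zF.
have cG i : c 0 i \in fixed_field.
  apply/fixed_fieldP => h.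
  suff : map_mx (act h) c = c by move/rowP/(_ i); rewrite mxE.
  apply: (can_inj (mulmxK Mu)); rewrite cM; apply/rowP => j.
  pose j' := enum_rank (h^-1 * enum_val j)%g.
  have Ej (y : L) : conj j y = act h (conj j' y).
    by rewrite /conj enum_rankK -act_mul mulKVg.
  have /rowP/(_ j') := cM; rewrite !mxE => E'.
  rewrite Ej -E' rmorph_sum; apply: eq_bigr => k _.
  by rewrite rmorphM !mxE Ej.
exists (fun i => c 0 i) => [i|]; first by rewrite inE cF cG.
have /rowP/(_ (enum_rank 1%g)) := cM; rewrite !mxE /conj enum_rankK act_one => <-.
by apply: eq_bigr => k _; rewrite [M _ _]mxE /conj enum_rankK act_one.
Qed.

End Artin.

Section Essdim.

Variable L0 : {pred L}.
Hypothesis L0E : L0 =i fixed_field.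

(** L / L^G is defined over E^G. *)
Lemma ed_le_descends d : ed_le d ->
  exists2 d', (d' <= d)%N & descends_to_trdeg iota L0 d'.
Proof.
case=> E [[EP EK] Es Ef Ed].
have [e [eE eB]] := artin_basis EP Ef.
pose E0 : {pred L} := [pred z | (z \in E) && (z \in fixed_field)].
have E0E : {subset E0 <= E} by move=> z /andP[].
have [d' [b [d'd _ _ _ d'E]]] := trdeg_basis (trdeg_le_sub E0E Ed).
exists d' => //; exists E0; split=> //.
- have [fP fK] := fixed_field_intermediate; split; last first.
    by move=> a; rewrite inE EK fK.
  case: EP fP => [E1 EB ED] [f1 fB fD].
  split=> [|x y /andP[xE xf] /andP[yE yf]|x y /andP[xE xf] /andP[yE yf]];
    rewrite inE; first by rewrite E1 f1.
    by rewrite EB // fB.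
  by rewrite ED // fD.
- by move=> z /andP[_]; rewrite L0E.
exists E; split=> //.
  exists #|{: gT}|; first by exists e; apply: eB.
  exists e; have [|//|//|h1 h2 h3] := eB predT; first by split.
  split=> // [c cL|x xT]; first by apply: h2 => i; rewrite inE /= -L0E.
  have [c cf ->] := h3 x xT; exists c => // i.
  by have := cf i; rewrite inE /= L0E.
move=> F [FP _] EF LF x.
have [|//|//|_ _ h3] := eB predT; first by split.
have [//|c cf ->] := h3 x.
apply: (@rpred_sum _ (subfield_pred FP)) => i _; apply: rpredM; last exact/EF/eE.
by apply: LF; have := cf i; rewrite inE /= L0E.
Qed.

(** If L / L0 is defined over E0 by E, the algebraic closure of E0 in L is
    stable, because G fixes E0, and contains E. An element of G that fixes it
    fixes both E and L0, hence all of L. *)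
Lemma descends_ed_le d : faithful_on predT -> descends_to_trdeg iota L0 d -> ed_le d.
Proof.
move=> Lf [E0 [E0F E0L [E [EF E0E [n nE nL] EL] E0d]]].
have [m [b [md bE ib E0b mE]]] := trdeg_basis (is_trdeg_le E0d).
have clE0 : {subset clo iota (codom b) <= alg_closure E0}.
  by apply: alg_closure_mono; apply: adjoin_sub => // _ /codomP[i ->].
have clb : {subset alg_closure E0 <= clo iota (codom b)}.
  move=> x xE0; apply: alg_closure_idem; first by case: (adjoin_field iota (codom b)).
  by apply: alg_closure_mono xE0.
exists (clo iota (codom b)); split.
- exact: clo_field.
- move=> g x /clE0/alg_closureP[p [p0 pE rp]]; apply/clb/alg_closureP; exists p; split=> //.
  have Ep : map_poly (act g) p = p.
    apply/polyP=> i; rewrite coef_map /=; apply/fixed_fieldP.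
    by rewrite -L0E; apply/E0L.
  by rewrite -Ep rmorph_root.
- move=> g gfix; apply: Lf => x _.
  pose F : {pred L} := [pred z | act g z == z].
  have FP z : reflect (act g z = z) (z \in F) by apply: eqP.
  apply/FP; apply: (EL F).
  + split; last by move=> a; apply/FP; apply: act_const.
    split=> [|y z /FP Ey /FP Ez|y z /FP Ey /FP Ez]; apply/FP.
    * exact: rmorph1.
    * by rewrite rmorphB Ey Ez.
    * by rewrite fmorph_div Ey Ez.
  + move=> y yE; apply/FP/gfix/clb.
    exact: (finite_degree_alg E0F.1 EF.1 nE).
  + by move=> y; rewrite L0E => /fixed_fieldP yf; apply/FP.
- move=> k t tb it; apply: leq_trans md; rewrite -(card_ord m) -(size_codom b).
  exact: trdeg_le_clo tb it.
Qed.

Lemma essdim_le d : ed_le d -> (essdim iota L0 <= d)%N.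
Proof.
case/ed_le_descends => d' d'd dd'; rewrite /essdim; case: pselect => // ex_d.
by apply: leq_trans d'd; case: ex_minnP => n _; apply; apply/asboolP.
Qed.

Lemma ed_le_essdim d : faithful_on predT -> ed_le d -> ed_le (essdim iota L0).
Proof.
move=> Lf /ed_le_descends [d' _ dd']; rewrite /essdim; case: pselect => [ex_d|[]].
  by case: ex_minnP => n /asboolP dn _; apply: descends_ed_le Lf dn.
by exists d'; apply/asboolP.
Qed.

End Essdim.

End Action.

Local Notation "x %:F" := (FracField.tofrac x).

(** * Homomorphisms from local subrings of a field *)

Section FractionField.

Variable D : idomainType.

Lemma fraction_repr (z : {fraction D}) :
  \d_(repr z : {ratio D}) != 0 /\ z = (\n_(repr z : {ratio D}))%:F / (\d_(repr z : {ratio D}))%:F.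
Proof.
split; first exact: denom_ratioP.
have d0 : (\d_(repr z : {ratio D}))%:F != 0 :> {fraction D}.
  by rewrite tofrac_eq0 denom_ratioP.
apply: (canRL (mulfK d0)).
rewrite -{1}[z]reprK; unlock FracField.tofrac; rewrite -[LHS]FracField.pi_mul.
apply/eqmodP; rewrite /= FracField.equivfE /FracField.mulf.
by rewrite !numden_Ratio ?mulf_neq0 ?oner_neq0 ?denom_ratioP // !mulr1 mulrC.
Qed.

Lemma fraction_ex (z : {fraction D}) : exists a b : D, b != 0 /\ z = a%:F / b%:F.
Proof. by have [? ?] := fraction_repr z; do 2 eexists; split; last eassumption. Qed.

Variables (L : fieldType) (f : {rmorphism D -> L}).
Hypothesis f_inj : forall x, f x = 0 -> x = 0.

(** The extension of [f] to fractions. The formula is the one by which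
    [rat_act] extends [poly_act]; the proof argument lets instances be inferred. *)
Definition frac_ext (_ : forall x, f x = 0 -> x = 0) (z : {fraction D}) : L :=
  f \n_(repr z : {ratio D}) / f \d_(repr z : {ratio D}).

Lemma frac_extE a b : b != 0 -> frac_ext f_inj (a%:F / b%:F) = f a / f b.
Proof.
move=> b0; rewrite /frac_ext; set z := a%:F / b%:F.
have [d0 Ez] := fraction_repr z; move: d0 Ez.
set n := \n_(_); set d := \d_(_) => d0 Ez.
have fn0 (x : D) : x != 0 -> f x != 0 by apply: contra_neq => /f_inj.
have E : a * d = n * b.
  apply/eqP; rewrite -tofrac_eq !tofracM -subr_eq0; apply/eqP.
  have b0' : b%:F != 0 by rewrite tofrac_eq0.
  have d0' : d%:F != 0 by rewrite tofrac_eq0.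
  have -> : a%:F = z * b%:F by rewrite /z divfK.
  by rewrite Ez mulrAC divfK // subrr.
by apply/eqP; rewrite eqr_div ?fn0 // -!rmorphM E.
Qed.

Lemma frac_ext_tofrac a : frac_ext f_inj a%:F = f a.
Proof.
by rewrite -[a%:F]divr1 -tofrac1 frac_extE ?oner_neq0 // rmorph1 divr1.
Qed.

Lemma frac_ext_zmod : zmod_morphism (frac_ext f_inj).
Proof.
move=> x y; have [a [b [b0 ->]]] := fraction_ex x.
have [c [d [d0 ->]]] := fraction_ex y.
have fn0 (u : D) : u != 0 -> f u != 0 by apply: contra_neq => /f_inj.
have -> : a%:F / b%:F - c%:F / d%:F = (a * d - c * b)%:F / (b * d)%:F.
  rewrite tofracB !tofracM; apply: (canRL (mulfK _)).
    by rewrite mulf_neq0 // tofrac_eq0.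
  rewrite mulrBl mulrA divfK ?tofrac_eq0 //; congr (_ - _).
  by rewrite (mulrC b%:F) mulrA divfK ?tofrac_eq0.
rewrite !frac_extE ?mulf_neq0 // rmorphB !rmorphM; apply: (canLR (mulfK _)).
  by rewrite mulf_neq0 ?fn0.
rewrite mulrBl mulrA divfK ?fn0 //; congr (_ - _).
by rewrite (mulrC (f b)) mulrA divfK ?fn0.
Qed.

Lemma frac_ext_monoid : monoid_morphism (frac_ext f_inj).
Proof.
split=> [|x y]; first by rewrite -tofrac1 frac_ext_tofrac rmorph1.
have [a [b [b0 ->]]] := fraction_ex x; have [c [d [d0 ->]]] := fraction_ex y.
rewrite mulrACA -invfM -!tofracM !frac_extE ?mulf_neq0 // !rmorphM.
by rewrite invfM mulrACA.
Qed.

HB.instance Definition _ :=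
  GRing.isZmodMorphism.Build {fraction D} L (frac_ext f_inj) frac_ext_zmod.
HB.instance Definition _ :=
  GRing.isMonoidMorphism.Build {fraction D} L (frac_ext f_inj) frac_ext_monoid.

End FractionField.

Lemma eq_frac_rmorph (D : idomainType) (L : fieldType)
    (f g : {rmorphism {fraction D} -> L}) :
  (forall a : D, f a%:F = g a%:F) -> f =1 g.
Proof.
by move=> fg z; have [a [b [b0 ->]]] := fraction_ex z; rewrite !fmorph_div !fg.
Qed.

Section LocalHom.

Variables (K L F : fieldType) (iL : {rmorphism K -> L}) (iF : {rmorphism K -> F}).

(** [R] is the graph of a homomorphism to F from a local subring of L whose
    maximal ideal is the kernel. *)
Record local_hom (R : L -> F -> Prop) : Prop := LocalHom {
  local_hom_sub : forall z z' r r', R z r -> R z' r' -> R (z - z') (r - r');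
  local_hom_mul : forall z z' r r', R z r -> R z' r' -> R (z * z') (r * r');
  local_hom_inv : forall z r, R z r -> r != 0 -> R z^-1 r^-1;
  local_hom_const : forall a, R (iL a) (iF a);
  local_hom_0 : forall r, R 0 r -> r = 0 }.

Variable R : L -> F -> Prop.
Hypothesis RP : local_hom R.
Implicit Type E : {pred L}.

Lemma local_hom_zero : R 0 0.
Proof. by have := local_hom_const RP 0; rewrite !rmorph0. Qed.

Lemma local_hom_one : R 1 1.
Proof. by have := local_hom_const RP 1; rewrite !rmorph1. Qed.

Lemma local_hom_add z z' r r' : R z r -> R z' r' -> R (z + z') (r + r').
Proof.
move=> zr zr'; rewrite -[z']opprK -[r']opprK; apply: (local_hom_sub RP) => //.
rewrite -sub0r -[- r']sub0r; apply: (local_hom_sub RP) => //.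
exact: local_hom_zero.
Qed.

Lemma local_hom_exp z r n : R z r -> R (z ^+ n) (r ^+ n).
Proof.
move=> zr; elim: n => [|n IH]; first by rewrite !expr0; apply: local_hom_one.
by rewrite !exprS; apply: (local_hom_mul RP).
Qed.

Lemma local_hom_fun z r r' : R z r -> R z r' -> r = r'.
Proof.
move=> zr zr'; have := local_hom_sub RP zr zr'; rewrite subrr => /(local_hom_0 RP)/eqP.
by rewrite subr_eq0 => /eqP.
Qed.

Lemma local_hom_sum (I : Type) (s : seq I) z r :
  (forall i, R (z i) (r i)) -> R (\sum_(i <- s) z i) (\sum_(i <- s) r i).
Proof.
move=> zr; elim: s => [|i s IH]; first by rewrite !big_nil; apply: local_hom_zero.
by rewrite !big_cons; apply: local_hom_add.
Qed.

Lemma local_hom_prod (I : Type) (s : seq I) z r :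
  (forall i, R (z i) (r i)) -> R (\prod_(i <- s) z i) (\prod_(i <- s) r i).
Proof.
move=> zr; elim: s => [|i s IH]; first by rewrite !big_nil; apply: local_hom_one.
by rewrite !big_cons; apply: (local_hom_mul RP).
Qed.

Lemma local_hom_mmap n z r (p : {mpoly K[n]}) :
  (forall i, R (z i) (r i)) -> R (mmap iL z p) (mmap iF r p).
Proof.
move=> zr; apply: local_hom_sum => m; apply: (local_hom_mul RP).
  exact: local_hom_const.
by apply: local_hom_prod => i; apply: local_hom_exp.
Qed.

Definition residues E : {pred F} := [pred r | `[< exists2 z, z \in E & R z r >]].

Lemma residuesP E r : reflect (exists2 z, z \in E & R z r) (r \in residues E).
Proof. exact: asboolP. Qed.

Lemma residues_field E : intermediate_field iL E -> intermediate_field iF (residues E).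
Proof.
case=> [[E1 EB ED] EK]; split; last first.
  by move=> a; apply/residuesP; exists (iL a); [apply: EK | apply: local_hom_const].
split=> [|x y|x y].
- by apply/residuesP; exists 1 => //; apply: local_hom_one.
- case/residuesP=> z zE zx /residuesP[w wE wy]; apply/residuesP.
  by exists (z - w); [apply: EB | apply: (local_hom_sub RP)].
- case/residuesP=> z zE zx /residuesP[w wE wy]; apply/residuesP.
  have [->|y0] := eqVneq y 0.
    exists 0; last by rewrite invr0 mulr0; apply: local_hom_zero.
    by rewrite -(subrr 1); apply: EB.
  exists (z / w); first exact: ED.
  by apply: (local_hom_mul RP) => //; apply: (local_hom_inv RP).
Qed.

Lemma residues_lift E n (r : 'I_n -> F) : (forall i, r i \in residues E) ->
  exists z : 'I_n -> L, forall i, z i \in E /\ R (z i) (r i).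
Proof.
move=> rE; suff /choice[z zP] : forall i, exists z, z \in E /\ R z (r i) by exists z.
by move=> i; have /residuesP[z zE zr] := rE i; exists z.
Qed.

Lemma residues_trdeg E d : trdeg_le iL E d -> trdeg_le iF (residues E) d.
Proof.
move=> Ed n r rE ir; have [z zP] := residues_lift rE.
apply: (Ed n z) => [i|p pz]; first by case: (zP i).
apply: ir; apply: (local_hom_0 RP); rewrite -pz.
by apply: local_hom_mmap => i; case: (zP i).
Qed.

(** Lifts of independent residues remain independent, even together with a
    nonzero y of residue 0: in a relation of lowest degree in y, divide by the
    largest power of y that occurs in every term and take residues. *)
Lemma residues_trdeg_drop E d y : trdeg_le iL E d ->
  y \in E -> y != 0 -> R y 0 -> (0 < d)%N /\ trdeg_le iF (residues E) d.-1.
Proof.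
move=> Ed yE y0 yR.
suff key n (r : 'I_n -> F) : (forall i, r i \in residues E) ->
    alg_independent iF r -> (n < d)%N.
  have d0 : (0 < d)%N.
    by apply: (key 0%N (fun=> 0)) => [[]//|]; apply: alg_independent0.
  split=> // n r rE ir; rewrite -ltnS prednK //; exact: (key n r).
move=> rE ir; have [z zP] := residues_lift rE.
apply: (Ed n.+1 (extend_family z y)) => [|p].
  by apply: (extend_ind (P := fun z => z \in E)) => // j; case: (zP j).
rewrite mmap_muni extend_widen extend_max => Ep; apply/eqP; rewrite -muni_eq0.
apply: contrapT => /negP P0.
have [k [Q [EP Q0]]] : exists k Q, muni p = Q * 'X^k /\ Q`_0 != 0.
  have [k [Q]] := multiplicity_XsubC (muni p) 0; rewrite subr0 P0 /= => nr EP.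
  by exists k, Q; split=> //; rewrite -horner_coef0.
move: Ep; rewrite EP rmorphM /= map_polyXn hornerM hornerXn => /eqP.
rewrite mulf_eq0 expf_eq0 (negbTE y0) andbF orbF => /eqP Qy.
case/eqP: Q0; apply: ir; apply: (local_hom_0 RP); rewrite -[X in R X]Qy.
rewrite horner_coef.
have -> : mmap iF r Q`_0 = \sum_(i < size (map_poly (mmap iL z) Q)) mmap iF r Q`_i * 0 ^+ i.
  case E0 : (size _) => [|q]; last first.
    by rewrite big_ord_recl expr0 mulr1 big1 ?addr0 // => i _; rewrite expr0n mulr0.
  rewrite big_ord0; move/eqP: E0; rewrite size_poly_eq0 => /eqP E0.
  apply: (local_hom_0 RP).
  have <- : mmap iL z Q`_0 = 0 by rewrite -coef_map E0 coef0.
  by apply: local_hom_mmap => i; case: (zP i).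
apply: local_hom_sum => i; apply: (local_hom_mul RP); last exact: local_hom_exp.
by rewrite coef_map /=; apply: local_hom_mmap => j; case: (zP j).
Qed.

End LocalHom.

Section Specialization.

Variables (K F : fieldType) (D : idomainType) (iD : {rmorphism K -> D}).
Variables (phi : {rmorphism D -> F}).

(** The graph of the extension of [phi] to the localization of D at its kernel. *)
Definition specializes (z : {fraction D}) (r : F) : Prop :=
  exists a b : D, [/\ phi b != 0, z = a%:F / b%:F & r = phi a / phi b].

Let nz b : phi b != 0 -> b%:F != 0 :> {fraction D}.
Proof. by rewrite tofrac_eq0; apply: contra_neq => ->; rewrite rmorph0. Qed.

Lemma specializes_tofrac a : specializes a%:F (phi a).
Proof. by exists a, 1; rewrite tofrac1 rmorph1 !divr1 oner_neq0. Qed.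

Lemma specializes_local_hom :
  local_hom (@FracField.tofrac D \o iD)%FUN (phi \o iD)%FUN specializes.
Proof.
split=> [z z' r r'|z z' r r'|z r|a|r].
- case=> a [b [b0 -> ->]] [c [d [d0 -> ->]]].
  exists (a * d - c * b), (b * d); rewrite rmorphM mulf_neq0 //; split=> //.
    rewrite tofracB !tofracM; apply: (canRL (mulfK _)); first by rewrite mulf_neq0 ?nz.
    rewrite mulrBl mulrA divfK ?nz //; congr (_ - _).
    by rewrite (mulrC b%:F) mulrA divfK ?nz.
  rewrite rmorphB !rmorphM; apply: (canRL (mulfK _)); first by rewrite mulf_neq0.
  rewrite mulrBl mulrA divfK //; congr (_ - _).
  by rewrite (mulrC (phi b)) mulrA divfK.
- case=> a [b [b0 -> ->]] [c [d [d0 -> ->]]].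
  exists (a * c), (b * d); rewrite !rmorphM mulf_neq0 //.
  by split=> //; rewrite invfM mulrACA.
- case=> a [b [b0 -> ->]]; rewrite mulf_eq0 invr_eq0 negb_or => /andP[a0 _].
  by exists b, a; rewrite !invfM !invrK; split=> //; rewrite mulrC.
- exact: specializes_tofrac.
- case=> a [b [b0 /esym/eqP]]; rewrite mulf_eq0 invr_eq0 (negbTE (nz b0)) orbF.
  by rewrite tofrac_eq0 => /eqP -> ->; rewrite rmorph0 mul0r.
Qed.

End Specialization.

(** * The action on K(V) *)

Section RationalFunctions.

Variables (K : fieldType) (gT : finGroupType) (m : nat).
Variable V : mx_representation K [set: gT]%G m.
Implicit Types g h : gT.

HB.instance Definition _ g := GRing.RMorphism.copy (poly_act V g)
  (comp_mpoly [tuple \sum_(i < m) V g i j *: 'X_i | j < m]).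

Lemma poly_actC g c : poly_act V g c%:MP = c%:MP.
Proof. exact: comp_mpolyC. Qed.

Lemma poly_actX g j : poly_act V g 'X_j = \sum_(i < m) V g i j *: 'X_i.
Proof. by rewrite /poly_act comp_mpolyXU -tnth_nth tnth_mktuple. Qed.

Lemma poly_act1 p : poly_act V 1%g p = p.
Proof.
apply: (eq_mpoly_rmorph (f := poly_act V 1%g) (g := idfun)) => [c|j].
  by rewrite /= poly_actC.
rewrite /= poly_actX repr_mx1 (bigD1 j) //= mxE eqxx scale1r big1 ?addr0 // => i ij.
by rewrite mxE (negbTE ij) scale0r.
Qed.

Lemma poly_actM g h p : poly_act V (g * h)%g p = poly_act V g (poly_act V h p).
Proof.
pose f : {rmorphism {mpoly K[m]} -> {mpoly K[m]}} := (poly_act V g \o poly_act V h)%FUN.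
apply: (eq_mpoly_rmorph (f := poly_act V (g * h)%g) (g := f)) => [c|j] /=.
  by rewrite !poly_actC.
rewrite !poly_actX rmorph_sum /= repr_mxM ?inE //.
under [RHS]eq_bigr => i _.
  rewrite -mul_mpolyC rmorphM /= poly_actC poly_actX mul_mpolyC scaler_sumr.
  over.
rewrite exchange_big /=; apply: eq_bigr => i _; rewrite mxE scaler_suml.
by apply: eq_bigr => k _; rewrite scalerA mulrC.
Qed.

Lemma tofrac_poly_act_inj g p : (poly_act V g p)%:F = 0 -> p = 0.
Proof.
move/eqP; rewrite tofrac_eq0 => /eqP E.
by rewrite -(poly_act1 p) -(mulVg g) poly_actM E rmorph0.
Qed.

Definition rat_act_rmorph g : {rmorphism rat_field K m -> rat_field K m} :=
  frac_ext (f := (@FracField.tofrac {mpoly K[m]} \o poly_act V g)%FUN)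
           (@tofrac_poly_act_inj g).

Lemma rat_act_tofrac g p : rat_act_rmorph g p%:F = (poly_act V g p)%:F.
Proof. by rewrite [LHS]frac_ext_tofrac. Qed.

Lemma rat_act_action : is_action (rat_field_const K m) rat_act_rmorph.
Proof.
split=> [x|g h x|g a].
- apply: (eq_frac_rmorph (f := rat_act_rmorph 1%g) (g := idfun)) => p.
  by rewrite rat_act_tofrac poly_act1.
- apply: (eq_frac_rmorph (f := rat_act_rmorph (g * h)%g)
    (g := (rat_act_rmorph g \o rat_act_rmorph h)%FUN)) => p /=.
  rewrite [RHS](etrans (congr1 _ (rat_act_tofrac h p)) (rat_act_tofrac g _)).
  exact: etrans (rat_act_tofrac _ _) (congr1 _ (poly_actM g h p)).
- by rewrite rat_act_tofrac poly_actC.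
Qed.

Lemma rat_fixed_fieldE : rat_fixed_field V =i fixed_field rat_act_rmorph.
Proof.
move=> z; apply/forallP/forallP => H g; first by have := H g; rewrite inE.
by rewrite inE; apply: H.
Qed.

Lemma rat_act_faithful : mx_faithful V -> faithful_on rat_act_rmorph predT.
Proof.
move=> Vf g gfix; apply/set1gP; apply: (subsetP Vf); rewrite !inE mul1mx.
apply/eqP/matrixP => i j; have := gfix ('X_j)%:F isT; rewrite rat_act_tofrac => /eqP.
rewrite tofrac_eq poly_actX => /eqP/(congr1 (mcoeff U_(i))).
rewrite raddf_sum /= mcoeffX eq_mnm1 mxE => E; rewrite eq_sym -E.
rewrite (bigD1 i) //= mcoeffZ mcoeffX eqxx mulr1 big1 ?addr0 // => k ki.
by rewrite mcoeffZ mcoeffX eq_mnm1 (negbTE ki) mulr0.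
Qed.

Lemma rat_ed_le : mx_faithful V -> ed_le (rat_field_const K m) rat_act_rmorph m.
Proof.
move=> Vf; exists (predT : {pred rat_field K m}); split=> //; last 1 first.
- pose t (i : 'I_m) : rat_field K m := ('X_i)%:F.
  have tE : {subset predT <= clo (rat_field_const K m) (codom t)}.
    have [cP cK] := clo_field (rat_field_const K m) (codom t).
    move=> z _; have [p [q [_ ->]]] := fraction_ex z.
    have pc (r : {mpoly K[m]}) : r%:F \in clo (rat_field_const K m) (codom t).
      pose f := @FracField.tofrac {mpoly K[m]}.
      rewrite [_%:F](mpoly_rmorphE f) /mmap.
      apply: (@rpred_sum _ (subfield_pred cP)) => k _; apply: rpredM; first exact: cK.
      apply: rpred_prod => j _; apply: rpredX; apply: mem_clo; exact: codom_f.
    by apply: (let: And3 _ _ h := cP in h).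
  move=> n s sE is_; rewrite -(card_ord m) -(size_codom t).
  by apply: (trdeg_le_clo (s := codom t)) is_ => i; apply: tE.
- exact: rat_act_faithful.
Qed.

Lemma essdim_repr_le d : ed_le (rat_field_const K m) rat_act_rmorph d ->
  (essdim_repr V <= d)%N.
Proof. exact: essdim_le rat_act_action _ rat_fixed_fieldE _. Qed.

Lemma ed_le_essdim_repr : mx_faithful V ->
  ed_le (rat_field_const K m) rat_act_rmorph (essdim_repr V).
Proof.
move=> Vf; apply: (ed_le_essdim rat_act_action rat_fixed_fieldE).
  exact: rat_act_faithful.
exact: rat_ed_le.
Qed.

End RationalFunctions.

Section Infinite.

Definition infinite_pred (F : eqType) (S : {pred F}) :=
  forall s : seq F, exists2 x, x \in S & x \notin s.

Lemma infinite_powers (F : fieldType) (S : {pred F}) (x : F) :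
  (forall n, x ^+ n \in S) -> (forall n, (0 < n)%N -> x ^+ n != 1) -> x != 0 ->
  infinite_pred S.
Proof.
move=> xS x1 x0 s; apply: contrapT => H.
have inj : injective (fun i : 'I_(size s).+1 => x ^+ i).
  have key (i j : nat) : (i < j)%N -> x ^+ i = x ^+ j -> False.
    move=> ij E; have := x1 (j - i)%N; rewrite subn_gt0 => /(_ ij)/eqP; apply.
    by apply: (mulfI (expf_neq0 i x0)); rewrite -exprD subnKC ?(ltnW ij) // mulr1.
  move=> i j /= E; apply/val_inj; case: (ltngtP i j) => // ij.
    by have := key _ _ ij E.
  by have := key _ _ ij (esym E).
have sub : {subset [seq x ^+ i | i : 'I_(size s).+1] <= s}.
  move=> _ /mapP[i _ ->]; apply: contrapT => /negP ns.
  by apply: H; exists (x ^+ i).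
have := uniq_leq_size _ sub; rewrite size_map -cardE card_ord ltnn.
by rewrite (map_inj_uniq inj) enum_uniq => /(_ isT).
Qed.

Lemma mpoly_nonvanishing (F : fieldType) (S : {pred F}) n (p : {mpoly F[n]}) :
  infinite_pred S -> p != 0 ->
  exists2 v : 'I_n -> F, (forall i, v i \in S) & p.@[v] != 0.
Proof.
move=> Sinf; elim: n p => [|n IH] p p0.
  exists (fun=> 0) => [[]//|]; apply: contra p0.
  by rewrite (mpoly0E p) mevalC => /eqP ->; rewrite mpolyC0.
have up0 : muni p != 0 by rewrite muni_eq0.
have l0 : lead_coef (muni p) != 0 by rewrite lead_coef_eq0.
have [v vS vn] := IH _ l0.
have q0 : map_poly (meval v) (muni p) != 0 by rewrite map_poly_eq0_id0.
pose q := map_poly (meval v) (muni p).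
have [x xS xr] : exists2 x, x \in S & ~~ root q x.
  have [rs rsP] : exists rs : seq F, forall x, root q x -> x \in rs.
    apply: contrapT => H; move: (max_poly_roots (p := q)) => mx.
    have build k : exists2 rs : seq F, uniq rs && all (root q) rs & size rs = k.
      elim: k => [|k [rs /andP[u a] sz]]; first by exists [::].
      apply: contrapT => H'; apply: H; exists rs => x rx; apply: contrapT => /negP nx.
      by apply: H'; exists (x :: rs); rewrite /= ?nx ?u ?rx ?a ?sz.
    have [rs /andP[u a] sz] := build (size q); have := mx _ q0 a u.
    by rewrite sz ltnn.
  by have [x xS nx] := Sinf rs; exists x => //; apply: contra nx; apply: rsP.
exists (extend_family v x); first exact: (extend_ind (P := fun z => z \in S)).
by rewrite /meval mmap_muni extend_widen extend_max.
Qed.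

End Infinite.

(** * Equivariant points and specialization *)

Section StableClosure.

Variables (K L : fieldType) (iota : {rmorphism K -> L}).
Variables (gT : finGroupType) (act : gT -> {rmorphism L -> L}).
Hypothesis actP : is_action iota act.

Lemma stable_clo (s : seq L) :
  (forall g y, y \in s -> act g y \in clo iota s) -> stable act (clo iota s).
Proof.
move=> sS g x /alg_closureP[p [p0 pS rp]].
have [[c1 cB cD] cK] := clo_field iota s.
have sub : {subset adjoin iota s <= [pred z | act g z \in clo iota s]}.
  apply: adjoin_sub; last by move=> y; apply: sS.
  split; last by move=> a; rewrite inE (act_const actP).
  split=> [|y z yS zS|y z yS zS]; rewrite inE.
  - by rewrite rmorph1.
  - by rewrite rmorphB; apply: cB.
  - by rewrite fmorph_div; apply: cD.
have [aP _] := adjoin_field iota s.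
apply: alg_closure_idem => //; apply/alg_closureP; exists (map_poly (act g) p); split.
- by rewrite map_poly_eq0.
- by move=> i; rewrite coef_map; apply: sub.
- by rewrite fmorph_root.
Qed.

(** L is finite-dimensional over its fixed field, so that a finite fixed field
    would make L finite. *)
Lemma infinite_fixed_field : faithful_on act predT -> infinite_pred (F := L) predT ->
  infinite_pred (fixed_field act).
Proof.
move=> Lf Linf s; apply: contrapT => H.
have fs x : x \in fixed_field act -> x \in s.
  by move=> xf; apply: contrapT => /negP xs; apply: H; exists x.
have [|e [_ eB]] := artin_basis actP _ Lf; first by split.
have [||//|_ _ esp] := eB predT; try by split.
have [y _] := Linf [seq \sum_i nth 0 s (f i) * e i | f : {ffun 'I_#|gT| -> 'I_(size s)}].
case/negP; have [//|c cf ->] := esp y.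
have cs i : (index (c i) s < size s)%N.
  by rewrite index_mem; apply: fs; have := cf i; rewrite inE.
apply/mapP; exists [ffun i => Ordinal (cs i)]; first by rewrite mem_enum.
apply: eq_bigr => i _; rewrite ffunE /= nth_index //.
by apply: fs; have := cf i; rewrite inE.
Qed.

End StableClosure.

Section EquivariantPoint.

Variables (K F : fieldType) (kappa : {rmorphism K -> F}).
Variables (gT : finGroupType) (act : gT -> {rmorphism F -> F}).
Hypothesis actP : is_action kappa act.
Hypothesis act_faithful : faithful_on act predT.
Hypothesis F_inf : infinite_pred (F := F) predT.

Variables (m : nat) (rho : gT -> 'M[K]_m).
Hypothesis rho1 : rho 1%g = 1%:M.
Hypothesis rhoM : forall g h, rho (g * h)%g = rho g *m rho h.

Lemma mmap_nonvanishing (f : {mpoly K[m]}) : f != 0 ->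
  exists a : 'I_m -> F, mmap kappa a f != 0.
Proof.
move=> f0; have [|a _ af] := mpoly_nonvanishing F_inf (p := map_mpoly kappa f).
  apply/eqP => E; case/eqP: f0; apply/mpolyP => k.
  have /mpolyP/(_ k) := E; rewrite mcoeff_map_mpoly /= !mcoeff0 => /eqP.
  by rewrite fmorph_eq0 => /eqP.
exists a; suff -> : mmap kappa a f = (map_mpoly kappa f).@[a] by [].
pose h : {rmorphism {mpoly K[m]} -> F} := (meval a \o map_mpoly kappa)%FUN.
apply: (eq_mpoly_rmorph (f := mmap kappa a) (g := h)) => [c|i] /=.
  by rewrite mmapC map_mpolyC mevalC.
by rewrite mmapX mmap1U map_mpolyX mevalXU.
Qed.

Lemma linear_nonvanishing (S : {pred F}) n (A : 'I_n -> 'I_m -> F) (f : {mpoly K[m]})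
    (v : 'I_n -> F) : infinite_pred S ->
  mmap kappa (fun j => \sum_q v q * A q j) f != 0 ->
  exists2 u : 'I_n -> F, (forall q, u q \in S) &
    mmap kappa (fun j => \sum_q u q * A q j) f != 0.
Proof.
move=> Sinf fv.
pose T (j : 'I_m) : {mpoly F[n]} := \sum_q A q j *: 'X_q.
pose ft := mmap (@mpolyC n F \o kappa)%FUN T f.
have ftE u : ft.@[u] = mmap kappa (fun j => \sum_q u q * A q j) f.
  pose h : {rmorphism {mpoly K[m]} -> F} :=
    (meval u \o mmap (@mpolyC n F \o kappa)%FUN T)%FUN.
  apply: (eq_mpoly_rmorph (f := h) (g := mmap kappa _)) => [c|j] /=.
    by rewrite !mmapC /= mevalC.
  rewrite !mmapX !mmap1U /T raddf_sum /=; apply: eq_bigr => q _.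
  by rewrite mevalZ mevalXU mulrC.
have [|u uS fu] := mpoly_nonvanishing Sinf (p := ft).
  by apply: contraNneq fv => E; rewrite -ftE E meval0.
by exists u => //; rewrite -ftE.
Qed.

(** Points w of F^m with g w = w rho(g) abound: averaging
    sum_g g(e) * rho(g)^-1 u produces one for each e in F and each vector u, and
    by [conj_matrix_unit] these span F^m over F. So the polynomial f, read on
    coordinates with respect to them, is nonzero, hence nonzero at some
    coordinates in the infinite fixed field of F; fixed coordinates preserve
    equivariance. *)
Lemma equivariant_point (f : {mpoly K[m]}) : f != 0 -> exists w : 'I_m -> F,
  mmap kappa w f != 0 /\
  forall g j, act g (w j) = \sum_i w i * kappa (rho g i j).
Proof.
move=> f0; have [a af] := mmap_nonvanishing f0.
have Sinf := infinite_fixed_field actP act_faithful F_inf.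
have [||e _ Mu] := @conj_matrix_unit _ _ _ _ _ actP predT => //.
set n := #|{: gT}| in e Mu; set M := (\matrix_(_, _) _) in Mu.
pose W k i j : F := \sum_g act g (e k) * kappa (rho g^-1%g i j).
have WE k i j g : act g (W k i j) = \sum_l W k i l * kappa (rho g l j).
  rewrite /W rmorph_sum; under [RHS]eq_bigr => l _ do rewrite mulr_suml.
  rewrite exchange_big (reindex_inj (mulgI g^-1%g)) /=; apply: eq_bigr => h _.
  rewrite rmorphM (act_const actP) -(act_mul actP) mulKVg invMg invgK rhoM mxE.
  rewrite rmorph_sum mulr_sumr; apply: eq_bigr => l _.
  by rewrite rmorphM mulrA.
pose idx := enum_val (A := {: 'I_n * 'I_m}).
pose A (q : 'I_#|{: 'I_n * 'I_m}|) j := W (idx q).1 (idx q).2 j.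
have sumA (u : 'I_n -> 'I_m -> F) j :
    \sum_q u (idx q).1 (idx q).2 * A q j = \sum_k \sum_i u k i * W k i j.
  rewrite pair_big /=; symmetry; rewrite (reindex idx) /=; first by apply: eq_bigl => q.
  exact/onW_bij/enum_val_bij.
(* the coordinates t k * a i give the point a, at which f does not vanish *)
pose t := delta_mx 0 (enum_rank 1%g) *m invmx M : 'rV_n.
have tE g : \sum_k t 0 k * act g (e k) = (g == 1%g)%:R.
  have : t *m M = delta_mx 0 (enum_rank 1%g) by rewrite mulmxKV.
  move/rowP/(_ (enum_rank g)); rewrite !mxE eqxx (inj_eq enum_rank_inj) => <-.
  by apply: eq_bigr => k _; rewrite [M _ _]mxE enum_rankK.
have [|u uS fu] := linear_nonvanishing (A := A) (f := f)
    (v := fun q => t 0 (idx q).1 * a (idx q).2) Sinf.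
  suff -> : (fun j => \sum_q t 0 (idx q).1 * a (idx q).2 * A q j) = a by [].
  apply/funext => j; rewrite (sumA (fun k i => t 0 k * a i)).
  rewrite exchange_big /= (eq_bigr (fun i => a i * kappa (1%:M i j))); last first.
    move=> i _; transitivity (a i * \sum_g (g == 1%g)%:R * kappa (rho g^-1%g i j)).
      under [in RHS]eq_bigr => g _ do rewrite -tE mulr_suml.
      rewrite exchange_big mulr_sumr; apply: eq_bigr => k _.
      rewrite /W -mulrA [t 0 k * _]mulrC -mulrA mulr_suml; congr (_ * _).
      by apply: eq_bigr => g _; rewrite mulrC mulrA.
    rewrite (bigD1 1%g) //= big1 ?addr0 => [|g /negbTE ->]; last by rewrite mul0r.
    by rewrite eqxx mul1r invg1 rho1.
  rewrite (bigD1 j) //= mxE eqxx rmorph1 mulr1 big1 ?addr0 // => i ij.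
  by rewrite mxE (negbTE ij) rmorph0 mulr0.
exists (fun j => \sum_q u q * A q j); split=> // g j.
rewrite rmorph_sum; under [RHS]eq_bigr => i _ do rewrite mulr_suml.
rewrite exchange_big; apply: eq_bigr => q _; rewrite rmorphM WE.
have /fixed_fieldP -> := uS q.
by rewrite mulr_sumr; apply: eq_bigr => l _; rewrite mulrA.
Qed.

End EquivariantPoint.

Section SpecializationTheorem.

Variables (K F : fieldType) (kappa : {rmorphism K -> F}).
Variables (gT hT : finGroupType) (theta : hT -> gT).
Hypothesis thetaM : {morph theta : x y / (x * y)%g}.
Hypothesis theta_inj : injective theta.
Variables (m : nat) (V : mx_representation K [set: gT]%G m).
Variable act : hT -> {rmorphism F -> F}.
Hypothesis actP : is_action kappa act.
Hypothesis act_faithful : faithful_on act predT.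
Hypothesis F_inf : infinite_pred (F := F) predT.

Lemma theta_one : theta 1%g = 1%g.
Proof. by apply: (mulgI (theta 1%g)); rewrite -thetaM !mulg1. Qed.

(** Evaluation at an equivariant point. *)
Lemma equivariant_specialization (f : {mpoly K[m]}) : f != 0 ->
  exists phi : {rmorphism {mpoly K[m]} -> F}, [/\ phi f != 0,
    forall c, phi c%:MP = kappa c
  & forall h p, phi (poly_act V (theta h) p) = act h (phi p)].
Proof.
move=> f0.
have [|g h|w [wf wE]] := equivariant_point actP act_faithful F_inf
   (rho := fun h => V (theta h)) _ _ f0.
- by rewrite theta_one repr_mx1.
- by rewrite thetaM repr_mxM ?inE.
exists (mmap kappa w); split=> // [c|h p]; first by rewrite /= mmapC.
pose f1 : {rmorphism {mpoly K[m]} -> F} := (mmap kappa w \o poly_act V (theta h))%FUN.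
pose f2 : {rmorphism {mpoly K[m]} -> F} := (act h \o mmap kappa w)%FUN.
apply: (eq_mpoly_rmorph (f := f1) (g := f2)) => [c|j] /=.
  by rewrite poly_actC mmapC (act_const actP).
rewrite poly_actX raddf_sum /= mmapX mmap1U wE; apply: eq_bigr => i _.
by rewrite mmapZ mmapX mmap1U mulrC.
Qed.

Section Relation.

Variable phi : {rmorphism {mpoly K[m]} -> F}.
Hypothesis phiC : forall c, phi c%:MP = kappa c.
Hypothesis phi_eqv : forall h p, phi (poly_act V (theta h) p) = act h (phi p).

Lemma specializes_hom : local_hom (rat_field_const K m) kappa (specializes phi).
Proof.
have [h1 h2 h3 h4 h5] := specializes_local_hom (@mpolyC m K) phi.
by split=> // a; have := h4 a; rewrite /= phiC.
Qed.

Lemma specializes_eqv h z r : specializes phi z r ->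
  specializes phi (rat_act_rmorph V (theta h) z) (act h r).
Proof.
case=> a [b [b0 -> ->]]; exists (poly_act V (theta h) a), (poly_act V (theta h) b).
by rewrite !phi_eqv !fmorph_div !rat_act_tofrac fmorph_eq0; split.
Qed.

End Relation.

(** For each h <> 1 choose y = a / b in E moved by h. A specialization at which
    all the denominators b and all the numerators of h y - y survive still
    separates every h <> 1 from 1. *)
Lemma separating_polynomial (E : {pred rat_field K m}) :
  faithful_on (rat_act_rmorph V) E ->
  exists2 f : {mpoly K[m]}, f != 0 & forall phi : {rmorphism {mpoly K[m]} -> F},
    (forall h p, phi (poly_act V (theta h) p) = act h (phi p)) -> phi f != 0 ->
    forall h, h != 1%g -> exists z r, [/\ z \in E, specializes phi z r & act h r != r].
Proof.
move=> Ef.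
pose D h (a b : {mpoly K[m]}) :=
  poly_act V (theta h) a * b - a * poly_act V (theta h) b.
have /choice[ab abP] h : exists ab : {mpoly K[m]} * {mpoly K[m]}, h != 1%g ->
   [/\ ab.2 != 0, ab.1%:F / ab.2%:F \in E & D h ab.1 ab.2 != 0].
  have [->|h1] := eqVneq h 1%g; first by exists (0, 0); rewrite eqxx.
  have th1 : theta h != 1%g by rewrite -theta_one (inj_eq theta_inj).
  have [z zE nz] := faithful_moves (rat_act_action V) Ef th1.
  have [a [b [b0 Ez]]] := fraction_ex z; exists (a, b) => _ /=; split=> //.
    by rewrite -Ez.
  have b0' : b%:F != 0 by rewrite tofrac_eq0.
  have gb0' : (poly_act V (theta h) b)%:F != 0.
    by rewrite -rat_act_tofrac fmorph_eq0.
  apply: contra nz; rewrite Ez fmorph_div !rat_act_tofrac.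
  rewrite /D subr_eq0 => /eqP E0; rewrite (eqr_div _ _ gb0' b0').
  by apply/eqP; rewrite -[LHS]tofracM -[RHS]tofracM E0.
pose fh h := if h == 1%g then 1 else (ab h).2 * D h (ab h).1 (ab h).2.
exists (\prod_h fh h).
  apply/prodf_neq0 => h _; rewrite /fh; case: (eqVneq h 1%g) => [_|h1].
    exact: (oner_neq0 {mpoly K[m]}).
  by have [b0 _ d0] := abP h h1; rewrite mulf_neq0.
move=> phi phi_eqv; rewrite rmorph_prod => /prodf_neq0 nz h h1.
have := nz h isT; rewrite /fh (negbTE h1) rmorphM mulf_eq0 negb_or => /andP[b0 d0].
have [_ zE _] := abP h h1; move: b0 d0 zE; case: (ab h) => a b /= b0 d0 zE.
exists (a%:F / b%:F), (phi a / phi b); split=> //; first by exists a, b.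
apply: contra d0; rewrite fmorph_div eqr_div ?fmorph_eq0 // -!phi_eqv.
by rewrite /D rmorphB !rmorphM subr_eq0.
Qed.

Variables (K' : fieldType) (kappa' : {rmorphism K' -> F}) (ext : {rmorphism K -> K'}).
Hypothesis kappaE : forall a, kappa a = kappa' (ext a).
Hypothesis actP' : is_action kappa' act.

(** Essential dimension of G bounds that of every infinite field with a faithful
    action of a subgroup, also after extension of the ground field: the residues
    of E under an equivariant specialization form a stable faithful subfield of
    no larger transcendence degree over K, and its algebraic closure over K'(b),
    b a transcendence basis, has no larger transcendence degree over K'. *)
Lemma specialization_ed_le d :
  ed_le (rat_field_const K m) (rat_act_rmorph V) d -> ed_le kappa' act d.
Proof.
case=> E [EF Es Ef Ed]; have [f f0 fsep] := separating_polynomial Ef.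
have [phi [phif phiC phi_eqv]] := equivariant_specialization f0.
have RP := specializes_hom phiC.
have eqv := specializes_eqv phi_eqv.
have := residues_trdeg RP Ed; set E' := residues _ _ => E'd.
have E's h r : r \in E' -> act h r \in E'.
  case/residuesP=> z zE zr; apply/residuesP.
  by exists (rat_act_rmorph V (theta h) z); [apply: Es | apply: eqv].
have [n [b [nd bE' ib E'b _]]] := trdeg_basis E'd.
have E'cl : {subset E' <= clo kappa' (codom b)}.
  by move=> x /E'b; apply: clo_base_change.
exists (clo kappa' (codom b)); split.
- exact: clo_field.
- apply: stable_clo => // h _ /codomP[i ->]; exact/E'cl/E's.
- move=> h hfix; apply/eqP; apply: contrapT => /negP h1.
  have [z [r [zE zr nr]]] := fsep phi phi_eqv phif h h1.
  case/eqP: nr; apply/hfix/E'cl/residuesP; by exists z.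
- move=> k t tb it; apply: leq_trans nd; rewrite -(card_ord n) -(size_codom b).
  exact: trdeg_le_clo tb it.
Qed.

End SpecializationTheorem.

(** * Rational functions in one variable over a field with a group action *)

Lemma eq_poly_rmorph (R S : comNzRingType) (f g : {rmorphism {poly R} -> S}) :
  (forall c, f c%:P = g c%:P) -> f 'X = g 'X -> f =1 g.
Proof.
move=> fgC fgX; elim/poly_ind => [|p c IH]; first by rewrite !raddf0.
by rewrite !rmorphD !rmorphM IH fgC fgX.
Qed.

Section RationalFunctionField.

Variables (K F : fieldType) (kappa : {rmorphism K -> F}).
Variables (gT : finGroupType) (act : gT -> {rmorphism F -> F}).
Hypothesis actP : is_action kappa act.
Variables (a b : gT -> K).
Hypotheses (a1 : a 1%g = 1) (b1 : b 1%g = 0).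
Hypothesis aM : forall g h, a (g * h)%g = a g * a h.
Hypothesis bM : forall g h, b (g * h)%g = a h * b g + b h.

Definition ratfun := {fraction {poly F}}.

Definition ratfun_const : {rmorphism K -> ratfun} :=
  (@FracField.tofrac {poly F} \o (@polyC F \o kappa))%FUN.

(** g acts on the coefficients and sends t to a g * t + b g. Both actions needed
    below have this form: t |-> w^i t and t |-> t + i. *)
Definition affine_act g : {rmorphism {poly F} -> {poly F}} :=
  (comp_poly (kappa (a g) *: 'X + (kappa (b g))%:P) \o map_poly (act g))%FUN.

Lemma affine_actC g c : affine_act g c%:P = (act g c)%:P.
Proof. by rewrite /= map_polyC comp_polyC. Qed.

Lemma affine_actX g : affine_act g 'X = kappa (a g) *: 'X + (kappa (b g))%:P.
Proof. by rewrite /= map_polyX comp_polyX. Qed.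

Lemma affine_act1 p : affine_act 1%g p = p.
Proof.
apply: (eq_poly_rmorph (f := affine_act 1%g) (g := idfun)) => [c|].
  by rewrite affine_actC (act_one actP).
by rewrite affine_actX a1 b1 rmorph1 rmorph0 scale1r addr0.
Qed.

Lemma affine_actM g h p : affine_act (g * h)%g p = affine_act g (affine_act h p).
Proof.
pose f : {rmorphism {poly F} -> {poly F}} := (affine_act g \o affine_act h)%FUN.
apply: (eq_poly_rmorph (f := affine_act (g * h)%g) (g := f)) => [c|].
  by rewrite affine_actC /f /= map_polyC comp_polyC map_polyC comp_polyC (act_mul actP).
have -> : f 'X = affine_act g (affine_act h 'X) by [].
rewrite !affine_actX -[kappa (a h) *: 'X]mul_polyC [RHS]rmorphD [affine_act g (_ * _)]rmorphM.
rewrite !affine_actC affine_actX !(act_const actP) aM bM mulrDr !mul_polyC scalerA -addrA.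
congr (_ + _); first by rewrite -rmorphM mulrC.
by rewrite -mul_polyC -polyCM -polyCD -rmorphM -rmorphD.
Qed.

Lemma tofrac_affine_act_inj g p : (affine_act g p)%:F = 0 -> p = 0.
Proof.
move/eqP; rewrite tofrac_eq0 => /eqP E.
by rewrite -(affine_act1 p) -(mulVg g) affine_actM E rmorph0.
Qed.

Definition ratfun_act g : {rmorphism ratfun -> ratfun} :=
  frac_ext (f := (@FracField.tofrac {poly F} \o affine_act g)%FUN)
           (@tofrac_affine_act_inj g).

Lemma ratfun_act_tofrac g p : ratfun_act g p%:F = (affine_act g p)%:F.
Proof. by rewrite [LHS]frac_ext_tofrac. Qed.

Lemma ratfun_actP : is_action ratfun_const ratfun_act.
Proof.
split=> [x|g h x|g c].
- apply: (eq_frac_rmorph (f := ratfun_act 1%g) (g := idfun)) => p.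
  by rewrite ratfun_act_tofrac affine_act1.
- apply: (eq_frac_rmorph (f := ratfun_act (g * h)%g)
    (g := (ratfun_act g \o ratfun_act h)%FUN)) => p /=.
  by rewrite !ratfun_act_tofrac affine_actM.
- by rewrite ratfun_act_tofrac affine_actC (act_const actP).
Qed.

Lemma ratfun_act_faithful :
  (forall g, (forall x, act g x = x) -> a g = 1 -> b g = 0 -> g = 1%g) ->
  faithful_on ratfun_act predT.
Proof.
move=> H g gfix; apply: H => [x||].
- have := gfix x%:P%:F isT; rewrite ratfun_act_tofrac affine_actC => /eqP.
  by rewrite tofrac_eq => /eqP/polyC_inj.
- have := gfix 'X%:F isT; rewrite ratfun_act_tofrac affine_actX => /eqP.
  rewrite tofrac_eq => /eqP/(congr1 (fun p : {poly F} => p`_1)).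
  rewrite coefD coefZ coefX coefC addr0 mulr1 -(rmorph1 kappa).
  exact: fmorph_inj.
- have := gfix 'X%:F isT; rewrite ratfun_act_tofrac affine_actX => /eqP.
  rewrite tofrac_eq => /eqP/(congr1 (fun p : {poly F} => p`_0)).
  rewrite coefD coefZ coefX coefC /= mulr0 add0r => /eqP.
  by rewrite fmorph_eq0 => /eqP.
Qed.

Lemma ratfun_infinite : infinite_pred (F := ratfun) predT.
Proof.
apply: (@infinite_powers ratfun predT ('X%:F)) => // [n n0|].
  rewrite -tofracXn -tofrac1 tofrac_eq; apply/eqP => /(congr1 (fun p : {poly F} => p`_0)).
  by rewrite coefXn coef1 (ltn_eqF n0) => /eqP; rewrite eq_sym oner_eq0.
by rewrite tofrac_eq0 polyX_eq0.
Qed.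

End RationalFunctionField.

Section Eigenvector.

Variables (K L : fieldType) (iota : {rmorphism K -> L}).
Variables (hT aT : finGroupType) (act : hT -> {rmorphism L -> L}) (beta : aT -> hT).
Hypothesis actP : is_action iota act.
Hypotheses (betaM : {morph beta : x y / (x * y)%g}) (beta_inj : injective beta).
Variables (E : {pred L}) (psi : aT -> K).
Hypotheses (EF : intermediate_field iota E) (Es : stable act E) (Ef : faithful_on act E).
Hypotheses (psiM : {morph psi : x y / (x * y)%g >-> x * y}) (psi_nz : forall x, psi x != 0).

(** The projector sum_x psi(x)^-1 x onto the psi-eigenspace does not vanish on E,
    by the independence of automorphisms. *)
Lemma eigenvector : exists y, [/\ y \in E, y != 0 &
  forall x, act (beta x) y = iota (psi x) * y].
Proof.
case: (EF) => EP EK; case: (EP) => E1 _ _.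
have EM x y : x \in E -> y \in E -> x * y \in E.
  by move=> xE yE; apply: (@rpredM _ (subfield_pred EP)).
pose S x := \sum_i (iota (psi i))^-1 * act (beta i) x.
have [x xE Sx] : exists2 x, x \in E & S x != 0.
  apply: contrapT => H.
  suff /(_ 1%g)/eqP : forall i, (iota (psi i))^-1 = 0.
    by rewrite invr_eq0 fmorph_eq0 (negbTE (psi_nz _)).
  apply: (@dedekind_independence _ _ (fun i => act (beta i)) E) => // [i j ij|x xE].
    by apply: (faithful_sep actP Ef); rewrite (inj_eq beta_inj).
  by apply: contrapT => nz; apply: H; exists x => //; apply/eqP.
exists (S x); split=> // [|c].
  apply: (@rpred_sum _ (subfield_pred EP)) => i _; apply: rpredM; last exact: Es.
  by apply: rpredVr; apply: EK.
rewrite /S rmorph_sum mulr_sumr [RHS](reindex_inj (mulgI c)) /=.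
apply: eq_bigr => i _; rewrite rmorphM fmorphV (act_const actP) betaM (act_mul actP).
rewrite mulrA; congr (_ * _); rewrite psiM rmorphM invfM mulrA divff ?mul1r //.
by rewrite fmorph_eq0.
Qed.

End Eigenvector.

(** * Removing a cyclic factor *)

Lemma prim_order_dvdz (F : fieldType) n (w : F) (z : int) :
  n.-primitive_root w -> w ^ z = 1 -> (n %| `|z|)%N.
Proof.
move=> wP wz; rewrite (prim_order_dvd wP); case: z wz => k /=; first by move=> E; apply/eqP.
by move/eqP; rewrite invr_eq1.
Qed.

Lemma balanced_ratio (L : fieldType) (x u v : L) (k l k' l' : int) :
  x != 0 -> k * l' = l * k' -> (x ^ k * u) ^ l' / (x ^ l * v) ^ k' = u ^ l' / v ^ k'.
Proof.
move=> x0 Ekl; rewrite !expfzMl !exprz_exp Ekl invfM mulrACA divff ?mul1r //.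
exact: expfz_neq0.
Qed.

Lemma exprz_closed (L : fieldType) (E : {pred L}) (y : L) (n : int) :
  divring_closed E -> y \in E -> y ^ n \in E.
Proof.
move=> EP yE; case: n => n; first exact: (@rpredX _ (subfield_pred EP)).
by rewrite NegzE -exprnN; apply/(@rpredVr _ (subfield_pred EP))/(@rpredX _ (subfield_pred EP)).
Qed.

Lemma eigen_ratio (L M : fieldType) (f : {rmorphism L -> L}) (g : {rmorphism M -> L})
    (y1 y2 : L) (c1 c2 : M) (k l : int) :
  f y1 = g c1 * y1 -> f y2 = g c2 * y2 ->
  f (y1 ^ l / y2 ^ k) = g (c1 ^ l / c2 ^ k) * (y1 ^ l / y2 ^ k).
Proof.
move=> e1 e2; rewrite !fmorph_div !fmorphXz e1 e2 !expfzMl.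
by rewrite invfM mulrACA.
Qed.

Section Drop.

Variables (K F : fieldType) (kappa : {rmorphism K -> F}).
Variables (gT : finGroupType) (act : gT -> {rmorphism F -> F}).
Hypothesis actP : is_action kappa act.
Variables (q : nat) (omega : K).
Local Notation p := q.+2.
Hypothesis p_prime : prime p.
Hypothesis omegaP : p.-primitive_root omega.

Let hT : finGroupType := (gT * 'I_p)%type.
Let act1 (h : hT) : {rmorphism F -> F} := act h.1.
Let a (h : hT) : K := omega ^+ (h.2 : 'I_p).
Let b (h : hT) : K := 0.

Lemma omega_nz : omega != 0.
Proof.
apply: contraTneq isT => E; have := prim_expr_order omegaP.
by rewrite E expr0n /= => /eqP; rewrite eq_sym oner_eq0.
Qed.

Lemma omega_expM (i j : 'I_p) : omega ^+ (i * j)%g = omega ^+ i * omega ^+ j.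
Proof.
by rewrite -exprD /= -[RHS](prim_expr_mod omegaP).
Qed.

Lemma act1P : is_action kappa act1.
Proof.
case: actP => h1 h2 h3; split=> *; [exact: h1 | exact: h2 | exact: h3].
Qed.

Lemma drop_a1 : a 1%g = 1. Proof. exact: expr0. Qed.
Lemma drop_b1 : b 1%g = 0. Proof. by []. Qed.
Lemma drop_aM g h : a (g * h)%g = a g * a h. Proof. exact: omega_expM. Qed.
Lemma drop_bM g h : b (g * h)%g = a h * b g + b h.
Proof. by rewrite /b mulr0 addr0. Qed.

Local Notation L := (ratfun F).

Definition kummer_act : hT -> {rmorphism L -> L} :=
  ratfun_act act1P drop_a1 drop_b1 drop_aM drop_bM.

Lemma kummer_actP : is_action (ratfun_const kappa) kummer_act.
Proof. exact: ratfun_actP. Qed.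

Lemma kummer_act_faithful : faithful_on act predT -> faithful_on kummer_act predT.
Proof.
move=> Ff; apply: ratfun_act_faithful => -[g i] gfix ai _.
have -> : g = 1%g by apply: Ff => x _; apply: gfix.
congr (_, _); apply/val_inj => /=.
move/eqP: ai; rewrite /a /= -(prim_order_dvd omegaP) => /dvdnP[k Ek].
by move: (ltn_ord i); rewrite Ek; case: k {Ek} => // k; rewrite mulSn -ltn_subRL subnn.
Qed.

(* the residue map of the t-adic valuation *)
Let R : L -> F -> Prop := specializes (horner_eval (0 : F)).

Lemma drop_hom : local_hom (ratfun_const kappa) kappa R.
Proof.
have [h1 h2 h3 h4 h5] := specializes_local_hom (@polyC F \o kappa)%FUN (horner_eval (0 : F)).
split=> // c; have := h4 c; by rewrite /= /horner_eval hornerC.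
Qed.

Lemma drop_eqv h z r : R z r -> R (kummer_act h z) (act h.1 r).
Proof.
case=> A [B [B0 -> ->]].
have E (P : {poly F}) : (affine_act kappa act1 a b h P).[0] = act h.1 P.[0].
  by rewrite /= horner_comp hornerD hornerZ hornerX hornerC mulr0 rmorph0 addr0
    -{1}(rmorph0 (act1 h)) horner_map.
exists (affine_act kappa act1 a b h A), (affine_act kappa act1 a b h B).
split.
- by rewrite [X in X != 0]E fmorph_eq0.
- by rewrite fmorph_div /kummer_act !ratfun_act_tofrac.
- by rewrite fmorph_div; congr (_ / _); apply/esym/E.
Qed.

Lemma unit_decomposition (z : L) : z != 0 ->
  exists (k : int) (u : L) (r : F), [/\ r != 0, R u r & z = ('X%:F) ^ k * u].
Proof.
have [A [B [B0 ->]]] := fraction_ex z => z0.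
have A0 : A != 0 by apply: contra_neq z0 => ->; rewrite rmorph0 mul0r.
have dec (P : {poly F}) : P != 0 -> exists k P', P = P' * 'X^k /\ P'.[0] != 0.
  move=> P0; have [k [P']] := multiplicity_XsubC P 0; rewrite subr0 P0 /= => nr EP.
  by exists k, P'.
have [k [A' [EA A'0]]] := dec A A0; have [l [B' [EB B'0]]] := dec B B0.
exists (k%:Z - l%:Z), (A'%:F / B'%:F), (A'.[0] / B'.[0]); split.
- by rewrite mulf_neq0 ?invr_eq0.
- by exists A', B'.
have X0 : ('X : {poly F})%:F != 0 by rewrite tofrac_eq0 polyX_eq0.
rewrite EA EB !tofracM !tofracXn expfzDr // -exprnN /=.
by rewrite invfM mulrACA mulrC.
Qed.

Lemma local_hom_expz u r (k : int) : R u r -> r != 0 -> R (u ^ k) (r ^ k).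
Proof.
move=> ur r0; case: k => n; first exact: local_hom_exp drop_hom _ _ _ ur.
rewrite !NegzE /= -!exprnN; apply: (local_hom_inv drop_hom); last exact: expf_neq0.
exact: local_hom_exp drop_hom _ _ _ ur.
Qed.

Section Descent.

Variables (d : nat) (E : {pred L}).
Hypotheses (EF : intermediate_field (ratfun_const kappa) E) (Es : stable kummer_act E).
Hypotheses (Ef : faithful_on kummer_act E) (Ed : trdeg_le (ratfun_const kappa) E d).

(** Compare the residues of both sides. *)
Lemma unit_eigenvalue h u r c : R u r -> r != 0 -> act h.1 r = r ->
  kummer_act h u = ratfun_const kappa c * u -> c = 1.
Proof.
move=> ur r0 hr hu; have := drop_eqv h ur; rewrite hu hr => R1.
have R2 : R (ratfun_const kappa c * u) (kappa c * r).
  by apply: (local_hom_mul drop_hom) => //; apply: (local_hom_const drop_hom).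
have := local_hom_fun drop_hom R1 R2; rewrite -{1}[r]mul1r => /(mulIf r0).
by rewrite -(rmorph1 kappa) => /fmorph_inj.
Qed.

(** An eigenvector y of C_p with the character i |-> w^i cannot be a unit, since
    C_p acts trivially on residues. So y or its inverse has residue 0. *)
Lemma drop_trdeg : (0 < d)%N /\ trdeg_le kappa (residues R E) d.-1.
Proof.
have [|||i|y [yE y0 yeig]] := eigenvector (beta := fun i : 'I_p => ((1%g, i) : hT))
    (psi := fun i : 'I_p => omega ^+ i) kummer_actP _ _ EF Es Ef _ _.
- by move=> i j; rewrite /= -[RHS]/((1 * 1)%g, (i * j)%g) mulg1.
- by move=> i j [].
- exact: omega_expM.
- by rewrite expf_neq0 // omega_nz.
have [k [u [r [r0 ur Ey]]]] := unit_decomposition y0.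
have R0X : R 'X%:F 0.
  have E0 : horner_eval (0 : F) 'X = 0 by exact: hornerX.
  by rewrite -[X in R _ X]E0; apply: specializes_tofrac.
have X0 : ('X : {poly F})%:F != 0 by rewrite tofrac_eq0 polyX_eq0.
have R0Xn n : R ('X%:F ^+ n.+1) 0.
  by have := local_hom_exp drop_hom n.+1 R0X; rewrite expr0n.
case: k Ey => [[|n]|n] Ey.
- have yr : R y r by rewrite Ey expr0z mul1r.
  have := unit_eigenvalue yr r0 _ (yeig 1); rewrite (act_one actP) => /(_ erefl)/eqP.
  by rewrite -(prim_order_dvd omegaP).
- have yR : R y 0 by rewrite Ey -(mul0r r); exact: (local_hom_mul drop_hom (R0Xn n) ur).
  exact: (residues_trdeg_drop drop_hom Ed yE y0 yR).
- have yR : R y^-1 0.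
    rewrite Ey NegzE -exprnN invfM invrK -(mul0r r^-1).
    exact: (local_hom_mul drop_hom (R0Xn n) (local_hom_inv drop_hom ur r0)).
  have yVE : y^-1 \in E by case: EF => EP _; apply: (@rpredVr _ (subfield_pred EP)).
  have yV0 : y^-1 != 0 := invr_neq0 y0.
  exact: (residues_trdeg_drop drop_hom Ed yVE yV0 yR).
Qed.

Hypothesis normal_p : forall N : {group gT}, (N <| [set: gT])%g -> N :!=: 1%g ->
  (p %| #|N|)%N.

(** The elements of G that act trivially on the residues of E form a normal
    subgroup N; if N <> 1 it contains s of order p. Then <s> x C_p acts trivially
    on residues and faithfully on E, so there are eigenvectors y1, y2 in E for the
    two coordinate characters. Some y1^l' / y2^k' with l', k' not both divisible
    by p has valuation 0, so it is a unit with a nontrivial character, which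
    contradicts [unit_eigenvalue]. *)
Lemma drop_faithful : faithful_on act (residues R E).
Proof.
pose N := [set g | `[< forall r, r \in residues R E -> act g r = r >]].
have NP g : reflect (forall r, r \in residues R E -> act g r = r) (g \in N).
  by rewrite inE; apply: asboolP.
have E's g r : r \in residues R E -> act g r \in residues R E.
  case/residuesP=> z zE zr; apply/residuesP; exists (kummer_act ((g, 1%g) : hT) z).
    exact: Es.
  exact: (drop_eqv ((g, 1%g) : hT)).
have Ng : group_set N.
  apply/group_setP; split=> [|g h /NP gf /NP hf].
    by apply/NP => r _; rewrite (act_one actP).
  by apply/NP => r rE; rewrite (act_mul actP) hf // gf.
have nN : (group Ng <| [set: gT])%g.
  apply/andP; split; first exact: subsetT.
  apply/subsetP => h _; rewrite inE; apply/subsetP => _ /imsetP[g /NP gf ->].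
  apply/NP => r rE; rewrite conjgE !(act_mul actP) gf ?E's //.
  by rewrite -(act_mul actP) mulVg (act_one actP).
move=> g gfix; apply: contrapT => g1.
have N1 : group Ng :!=: 1%g.
  apply/eqP => N1; apply: g1; apply/set1gP; rewrite -N1; exact/NP.
have [s sN os] := Cauchy p_prime (normal_p nN N1).
have sfix r : r \in residues R E -> act s r = r by move/NP: sN; apply.
pose aT : finGroupType := ('I_p * 'I_p)%type.
pose beta (x : aT) : hT := (s ^+ x.1, x.2)%g.
have betaM : {morph beta : x y / (x * y)%g}.
  move=> [i j] [i' j']; rewrite /beta; congr (_, _) => /=.
  by rewrite -expgD -[RHS]expg_mod_order os.
have beta_inj : injective beta.
  move=> [i j] [i' j'] [] /eqP; rewrite eq_expg_mod_order os !modn_small // => /eqP Ei ->.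
  by congr (_, _); apply/val_inj.
have om0 (i : nat) : omega ^+ i != 0.
  by rewrite expf_neq0 // omega_nz.
have [||y1 [y1E y10 e1]] := eigenvector (psi := fun x : aT => omega ^+ x.1)
  kummer_actP betaM beta_inj EF Es Ef _ _.
- by move=> x y; apply: omega_expM.
- by move=> x; apply: om0.
have [||y2 [y2E y20 e2]] := eigenvector (psi := fun x : aT => omega ^+ x.2)
  kummer_actP betaM beta_inj EF Es Ef _ _.
- by move=> x y; apply: omega_expM.
- by move=> x; apply: om0.
have [k [u1 [r1 [r10 ur1 Ey1]]]] := unit_decomposition y10.
have [l [u2 [r2 [r20 ur2 Ey2]]]] := unit_decomposition y20.
have [k' [l' [Ekl nkl]]] : exists k' l' : int, k * l' = l * k' /\
    ~ ((p %| `|k'|)%N /\ (p %| `|l'|)%N).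
  have [->|k0] := eqVneq k 0.
    by exists 0, 1; rewrite mul0r mulr0; split=> // -[_]; rewrite dvdn1.
  exists (k %/ gcdz k l)%Z, (l %/ gcdz k l)%Z; split.
    transitivity ((k %/ gcdz k l)%Z * gcdz k l * (l %/ gcdz k l)%Z).
      by rewrite (divzK (dvdz_gcdl k l)).
    by rewrite mulrC mulrA mulrAC (divzK (dvdz_gcdr k l)).
  case=> pk pl; have g0 : gcdz k l != 0 by rewrite gcdz_eq0 negb_and k0.
  have : (p %| gcdn `|(k %/ gcdz k l)%Z| `|(l %/ gcdz k l)%Z|)%N by rewrite dvdn_gcd pk pl.
  have -> : gcdn `|(k %/ gcdz k l)%Z| `|(l %/ gcdz k l)%Z| = 1%N; last by rewrite dvdn1.
  have gp : (0 < gcdn `|k| `|l|)%N by rewrite gcdn_gt0 absz_gt0 k0.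
  apply/eqP; rewrite -(eqn_pmul2r gp) mul1n muln_gcdl.
  have absE x : (gcdz k l %| x)%Z -> (`|(x %/ gcdz k l)%Z| * gcdn `|k| `|l| = `|x|)%N.
    by move=> dx; rewrite -{2}(divzK dx) abszM.
  by rewrite !absE ?dvdz_gcdl ?dvdz_gcdr.
have X0 : ('X : {poly F})%:F != 0 by rewrite tofrac_eq0 polyX_eq0.
pose u := y1 ^ l' / y2 ^ k'.
pose r := r1 ^ l' / r2 ^ k'.
have ur : R u r.
  have -> : u = u1 ^ l' / u2 ^ k'.
    by rewrite /u Ey1 Ey2 (balanced_ratio _ _ X0 Ekl).
  apply: (local_hom_mul drop_hom); first exact: local_hom_expz.
  by apply: (local_hom_inv drop_hom); [apply: local_hom_expz | apply: expfz_neq0].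
have r0 : r != 0 by rewrite mulf_neq0 ?invr_eq0 ?expfz_neq0.
have uE : u \in E.
  case: EF => EP _; case: (EP) => _ _; apply; exact: exprz_closed.
have rE' : r \in residues R E by apply/residuesP; exists u.
have ueig x : kummer_act (beta x) u =
    ratfun_const kappa ((omega ^+ x.1) ^ l' / (omega ^+ x.2) ^ k') * u.
  exact: eigen_ratio.
apply: nkl; split.
- apply: (prim_order_dvdz omegaP).
  have := unit_eigenvalue ur r0 _ (ueig (1%g, inord 1)).
  rewrite /beta /= (act_one actP) => /(_ erefl); rewrite inordK // expr0 exp1rz mul1r.
  by move/eqP; rewrite invr_eq1 expr1 => /eqP.
- apply: (prim_order_dvdz omegaP).
  have := unit_eigenvalue ur r0 _ (ueig (inord 1, 1%g)).
  rewrite /beta /= inordK // expg1 sfix // => /(_ erefl).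
  by rewrite expr0 exp1rz invr1 mulr1 expr1.
Qed.

End Descent.

(** Tame ramification: E restricted to the t-adic valuation of F(t) is ramified
    by C_p, so that its residue field has smaller transcendence degree, and
    inertia, being cyclic, leaves no room for an element of order p of G. *)
Theorem ed_le_drop d :
  (forall N : {group gT}, (N <| [set: gT])%g -> N :!=: 1%g -> (p %| #|N|)%N) ->
  ed_le (ratfun_const kappa) kummer_act d -> (0 < d)%N /\ ed_le kappa act d.-1.
Proof.
move=> normal_p [E [EF Es Ef Ed]].
have [d0 E'd] := drop_trdeg EF Es Ef Ed.
split=> //; exists (residues R E); split=> //.
- exact: residues_field drop_hom _ EF.
- move=> g r /residuesP[z zE zr]; apply/residuesP.
  exists (kummer_act ((g, 1%g) : hT) z); first exact: Es.
  exact: (drop_eqv ((g, 1%g) : hT)).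
- exact: drop_faithful.
Qed.

End Drop.

(** * Symmetric groups *)

Section BlockPermutations.

Variables n k : nat.

Definition block_fun (s : 'S_n) (t : 'S_k) (i : 'I_(n + k)) : 'I_(n + k) :=
  match split i with inl j => lshift k (s j) | inr j => rshift n (t j) end.

Lemma block_fun_lshift s t j : block_fun s t (lshift k j) = lshift k (s j).
Proof. by have E := @unsplitK n k (inl j); rewrite /block_fun [split _]E. Qed.

Lemma block_fun_rshift s t j : block_fun s t (rshift n j) = rshift n (t j).
Proof. by have E := @unsplitK n k (inr j); rewrite /block_fun [split _]E. Qed.

Lemma block_funK s t : cancel (block_fun s t) (block_fun s^-1%g t^-1%g).
Proof.
move=> i; rewrite -(splitK i); case: (split i) => j /=.
  by rewrite !block_fun_lshift permK.
by rewrite !block_fun_rshift permK.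
Qed.

Definition block_perm s t : 'S_(n + k) := perm (can_inj (block_funK s t)).

Lemma block_perm_lshift s t j : block_perm s t (lshift k j) = lshift k (s j).
Proof. by rewrite permE block_fun_lshift. Qed.

Lemma block_perm_rshift s t j : block_perm s t (rshift n j) = rshift n (t j).
Proof. by rewrite permE block_fun_rshift. Qed.

Lemma block_permM s s' t t' :
  block_perm (s * s')%g (t * t')%g = (block_perm s t * block_perm s' t')%g.
Proof.
apply/permP => i; rewrite permM -(splitK i); case: (split i) => j /=.
  by rewrite !block_perm_lshift permM.
by rewrite !block_perm_rshift permM.
Qed.

Lemma block_perm_inj s s' t t' : block_perm s t = block_perm s' t' -> s = s' /\ t = t'.
Proof.
move=> /permP E; split; apply/permP => j.
  by apply: (@lshift_inj n k); have := E (lshift k j); rewrite !block_perm_lshift.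
by apply: (@rshift_inj n k); have := E (rshift n j); rewrite !block_perm_rshift.
Qed.

End BlockPermutations.

Section CyclicFactor.

Variables n q : nat.

Lemma shift_inj (i : 'I_q.+2) : injective (fun k : 'I_q.+2 => k + i).
Proof. exact: addIr. Qed.

Definition shift_perm (i : 'I_q.+2) : 'S_q.+2 := perm (shift_inj (i := i)).

Lemma shift_permM (i j : 'I_q.+2) : shift_perm (i * j)%g = (shift_perm i * shift_perm j)%g.
Proof. by apply/permP => k; rewrite permM !permE; exact: addrA. Qed.

Definition theta (x : 'S_n * 'I_q.+2) : 'S_(n + q.+2) := block_perm x.1 (shift_perm x.2).

Lemma theta_morph : {morph theta : x y / (x * y)%g}.
Proof. by move=> [s i] [t j]; rewrite /theta -block_permM -shift_permM. Qed.

Lemma theta_injective : injective theta.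
Proof.
move=> [s i] [t j] /block_perm_inj[/= -> /permP/(_ 0)].
by rewrite !permE !add0r => ->.
Qed.

End CyclicFactor.

Lemma sym_le1_trivial n (s : 'S_n) : (n <= 1)%N -> s = 1%g.
Proof.
move=> n1; apply/permP => i; rewrite perm1; apply/val_inj => /=.
move: (leq_trans (ltn_ord (s i)) n1) (leq_trans (ltn_ord i) n1).
by rewrite !ltnS !leqn0 => /eqP -> /eqP ->.
Qed.

Section NormalSubgroups.

Variables (n : nat) (N : {group 'S_n}).
Hypotheses (nN : (N <| [set: 'S_n])%g) (N1 : N :!=: 1%g).

(** N is transitive: if g in N moves a, then its conjugate by the transposition of
    g a and c sends a to c. *)
Lemma normal_sym_dvd : (n %| #|N|)%N.
Proof.
have [g gN g1] : exists2 g, g \in N & g != 1%g.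
  by case/trivgPn: N1 => g gN g1; exists g.
have [a ga] : exists a, g a != a.
  apply: contrapT => H; case/eqP: g1; apply/permP => a; rewrite perm1.
  by apply/eqP; apply: contrapT => ga; apply: H; exists a; apply/negP.
have orb : orbit 'P N a = [set: 'I_n].
  apply/setP => c; rewrite inE; apply/orbitP.
  have [->|ca] := eqVneq c a; first by exists 1%g; rewrite ?group1 // act1.
  exists (g ^ tperm (g a) c)%g; last first.
    have ta : tperm (g a) c a = a by rewrite tpermD.
    by rewrite /= /aperm conjgE !permM tpermV ta tpermL.
  by rewrite memJ_norm //; apply: (subsetP (normal_norm nN)); rewrite inE.
by have := dvdn_orbit 'P N a; rewrite orb cardsT card_ord.
Qed.

Lemma normal_sym_gt1 : ~ (n <= 1)%N.
Proof.
move=> n1; case/eqP: N1; apply/trivgP/subsetP => g _; rewrite inE; apply/eqP.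
exact: sym_le1_trivial.
Qed.

(** By simplicity of Alt, N contains it or meets it trivially; in the latter case
    #|N| <= 2, although n divides #|N|. And 4! divides n! = 2 * #|Alt|. *)
Lemma normal_sym_12 : (5 <= n)%N -> (12 %| #|N|)%N.
Proof.
move=> n5; have cT : (4 < #|'I_n|)%N by rewrite card_ord.
have sA := simple_Alt5 cT.
have cA : (2 * #|('Alt_('I_n))%g|)%N = n`! by rewrite card_Alt ?card_ord // (leq_trans _ n5).
have A12 : (12 %| #|('Alt_('I_n))%g|)%N.
  have : (24 %| n`!)%N.
    by rewrite -(bin_fact (m := 4) (n := n)) ?(leq_trans _ n5) // mulnA dvdn_mulr // dvdn_mull.
  by rewrite -cA (_ : 24 = 2 * 12)%N // dvdn_pmul2l.
have NA : (N :&: 'Alt_('I_n) <| 'Alt_('I_n))%g.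
  apply/andP; split; first exact: subsetIr.
  apply: (subset_trans (subsetT _)).
  apply: normsI; first exact: normal_norm nN.
  exact: normal_norm (Alt_normal _).
have [_ /(_ _ NA)] := simpleP _ sA; case => E.
  suff : (#|N| <= 2)%N.
    move=> N2; have := dvdn_leq (cardG_gt0 N) normal_sym_dvd.
    by move/leq_trans/(_ N2)/(leq_trans n5).
  have := mul_cardG N ('Alt_('I_n))%G; rewrite E cards1 muln1 => E2.
  have : (#|N| * #|('Alt_('I_n))%g| <= 2 * #|('Alt_('I_n))%g|)%N.
    by rewrite E2 cA -card_Sn -cardsT subset_leq_card ?subsetT.
  by rewrite leq_pmul2r ?cardG_gt0.
by apply: dvdn_trans A12 (cardSg _); apply/setIidPr.
Qed.

End NormalSubgroups.

Lemma normal_sym_2 n (N : {group 'S_n}) : n <> 3%N ->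
  (N <| [set: 'S_n])%g -> N :!=: 1%g -> (2 %| #|N|)%N.
Proof.
move=> n3 nN N1; have [n5|n5] := leqP 5 n.
  exact: dvdn_trans (normal_sym_12 nN N1 n5).
have dN := normal_sym_dvd nN N1; have f := normal_sym_gt1 N1.
by move: n3 f dN n5; case: n N nN N1 => [|[|[|[|[|n]]]]] N nN N1 n3 f dN n5 //;
  first [by case: (f isT) | by case: n3 | exact: dvdn_trans dN].
Qed.

Lemma normal_sym_3 n (N : {group 'S_n}) : n <> 2%N -> n <> 4%N ->
  (N <| [set: 'S_n])%g -> N :!=: 1%g -> (3 %| #|N|)%N.
Proof.
move=> n2 n4 nN N1; have [n5|n5] := leqP 5 n.
  exact: dvdn_trans (normal_sym_12 nN N1 n5).
have dN := normal_sym_dvd nN N1; have f := normal_sym_gt1 N1.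
by move: n2 n4 f dN n5; case: n N nN N1 => [|[|[|[|[|n]]]]] N nN N1 n2 n4 f dN n5 //;
  first [by case: (f isT) | by case: n2 | by case: n4 | exact: dvdn_trans dN].
Qed.

(** * Lueroth's theorem *)

Section Gauss.

Variable K : fieldType.
Implicit Types (b d : {poly K}) (D F Q : {poly {poly K}}).

Lemma coefs_dvd d F : (forall i, d %| F`_i) -> exists Q, F = d%:P * Q.
Proof.
move=> dF; exists (\poly_(i < size F) (F`_i %/ d)); apply/polyP => i.
rewrite coefCM coef_poly mulrC; case: ltnP => [_|si]; first by rewrite divpK.
by rewrite mul0r; apply/eqP; rewrite -[_ == _]/(F`_i == 0) nth_default.
Qed.

Definition primitive F := forall d, (1 < size d)%N -> ~ (forall i, d %| F`_i).

(** A nonconstant divisor of least size is irreducible, in the form used for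
    [gauss]. *)
Lemma minimal_divisor b : (1 < size b)%N -> exists d, [/\ (1 < size d)%N, d %| b
  & forall c, ~~ (d %| c) -> coprimep d c].
Proof.
move=> sb.
pose P n := `[< exists d, [/\ (1 < size d)%N, d %| b & size d = n] >].
have exP : exists n, P n by exists (size b); apply/asboolP; exists b.
case: (ex_minnP exP) => n /asboolP[d [sd db sn]] nmin; exists d; split=> // c dc.
apply: contraNT dc => ncop; have gd := dvdp_gcdl d c.
have d0 : d != 0 by rewrite -size_poly_gt0 ltnW.
have g0 : gcdp d c != 0 by rewrite gcdp_eq0 negb_and d0.
have sg : (1 < size (gcdp d c))%N.
  by rewrite ltn_neqAle eq_sym ncop size_poly_gt0.
have : (n <= size (gcdp d c))%N.
  by apply: nmin; apply/asboolP; exists (gcdp d c); rewrite (dvdp_trans gd).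
rewrite -sn => le; have : gcdp d c %= d by rewrite -dvdp_size_eqp // eqn_leq le dvdp_leq.
by move/eqp_dvdl => <-; apply: dvdp_gcdr.
Qed.

(** Gauss's lemma: an irreducible factor d of b divides F * Q. At the first
    coefficients of F and Q that d does not divide, the product would have a
    coefficient not divisible by d; so d divides Q and can be cancelled. *)
Lemma gauss F : primitive F ->
  forall b D Q, b != 0 -> b%:P * D = F * Q -> exists Q', D = F * Q'.
Proof.
move=> Fp b; have [n] := ubnP (size b); elim: n b => // n IH b sb D Q b0 E.
have [sb1|sb1] := leqP (size b) 1.
  have [c Ec] : exists c, b = c%:P by exists b`_0; apply: size1_polyC.
  exists ((c^-1)%:P%:P * Q); rewrite mulrCA -E Ec mulrA -!polyCM mulVf ?mul1r //.
  by move: b0; rewrite Ec polyC_eq0.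
have [d [sd db dcop]] := minimal_divisor sb1.
have d0 : d != 0 by rewrite -size_poly_gt0 ltnW.
have [Q' EQ] : exists Q', Q = d%:P * Q'.
  apply: coefs_dvd => j0; apply: contrapT => /negP nj0.
  have exQ : exists j, ~~ (d %| Q`_j) by exists j0.
  have exF : exists i, ~~ (d %| F`_i).
    apply: contrapT => H; apply: (Fp d sd) => i; apply: contrapT => /negP ni.
    by apply: H; exists i.
  case: (ex_minnP exQ) => j nj jmin; case: (ex_minnP exF) => i ni imin.
  have := congr1 (fun P : {poly {poly K}} => P`_(i + j)) E.
  rewrite coefCM coefM.
  have lt_i : (i < (i + j).+1)%N by rewrite ltnS leq_addr.
  rewrite (bigD1 (Ordinal lt_i)) //= addKn => Eij.
  have : d %| F`_i * Q`_j.
    have -> : F`_i * Q`_j = b * D`_(i + j) -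
        \sum_(k < (i + j).+1 | k != Ordinal lt_i) F`_k * Q`_(i + j - k).
      by rewrite Eij addrK.
    apply: dvdp_sub; first by rewrite dvdp_mulr.
    apply: (big_ind (fun x => d %| x)) => [|x y|k ki]; first exact: dvdp0.
      exact: dvdp_add.
    have [lt_ki|] := ltnP k i.
      apply: dvdp_mulr; apply: contrapT => /negP nk.
      by have := imin k nk; rewrite leqNgt lt_ki.
    rewrite leq_eqVlt => /orP[/eqP Eki|lt_ik].
      by case/eqP: ki; apply/val_inj; rewrite /= -Eki.
    apply: dvdp_mull; apply: contrapT => /negP nk.
    have := jmin _ nk; rewrite leqNgt => /negP; apply.
    have le_k : (k <= i + j)%N by rewrite -ltnS ltn_ord.
    by rewrite (ltn_subLR _ le_k) ltn_add2r.
  by rewrite Gauss_dvdpr ?dcop // (negbTE nj).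
have [b' Eb] : exists b', b = d * b' by have /dvdpP[b' ->] := db; exists b'; rewrite mulrC.
have b'0 : b' != 0 by apply: contra_neq b0 => b'0; rewrite Eb b'0 mulr0.
apply: (IH b' _ D Q' b'0).
  have : (size b' < size b)%N.
    rewrite Eb size_mul //; case: (size d) sd => [|[|m]] // _.
    by rewrite -[(_ + _).-1]/(m + size b').+1 ltnS leq_addl.
  by move=> lt; apply: leq_trans lt _; rewrite -ltnS.
have dP0 : d%:P != 0 :> {poly {poly K}} by rewrite polyC_eq0.
by apply: (mulfI dP0); rewrite mulrA -polyCM -Eb E EQ mulrCA.
Qed.

Lemma primitive_multiple F : F != 0 -> exists c F',
  [/\ c != 0, F = c%:P * F' & primitive F'].
Proof.
have [n] := ubnP (size (lead_coef F)); elim: n F => // n IH F sF F0.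
have [Fp|nFp] := pselect (primitive F).
  by exists 1, F; rewrite oner_neq0 mul1r.
have [d [sd dF]] : exists d, (1 < size d)%N /\ forall i, d %| F`_i.
  apply: contrapT => H; apply: nFp => d sd dF; apply: H; by exists d.
have [Q EF] := coefs_dvd dF.
have d0 : d != 0 by rewrite -size_poly_gt0 ltnW.
have Q0 : Q != 0 by apply: contra_neq F0 => Q0; rewrite EF Q0 mulr0.
have [|c [F' [c0 EQ Fp]]] := IH Q _ Q0.
  move: sF; rewrite EF lead_coefM lead_coefC size_mul ?lead_coef_eq0 //.
  case: (size d) sd => [|[|m]] // _; rewrite -[(_ + _).-1]/(m + size (lead_coef Q)).+1.
  by rewrite ltnS; apply: leq_trans; rewrite ltnS leq_addl.
by exists (d * c), F'; rewrite mulf_neq0 // polyCM -mulrA -EQ.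
Qed.

End Gauss.

Lemma coprime_representation (K M : fieldType) (f : {rmorphism {poly K} -> M}) z :
  z \in fractions f -> exists g h, [/\ coprimep g h, f h != 0 & z = f g / f h].
Proof.
case/fractionsP => P [Q [Q0 ->]].
set c := gcdp P Q.
have EP : P = P %/ c * c by rewrite divpK ?dvdp_gcdl.
have EQ : Q = Q %/ c * c by rewrite divpK ?dvdp_gcdr.
have fc0 : f c != 0 by apply: contra_neq Q0; rewrite EQ rmorphM => ->; rewrite mulr0.
have fQ' : f (Q %/ c) != 0.
  by apply: contra_neq Q0; rewrite {2}EQ rmorphM => ->; rewrite mul0r.
have Qn : Q != 0 by apply: contra_neq Q0 => ->; rewrite rmorph0.
exists (P %/ c), (Q %/ c); split=> //.
  by rewrite coprimep_div_gcd // Qn orbT.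
by rewrite {1}EP {1}EQ !rmorphM invfM mulrACA divff ?mulr1.
Qed.

Section FractionFieldOf.

Variables (K L : fieldType) (frac : {rmorphism {poly K} -> L}).
Hypothesis frac_inj : forall a, frac a = 0 -> a = 0.
Hypothesis frac_surj : forall z, exists a b, b != 0 /\ z = frac a / frac b.
Variable cst : {rmorphism K -> L}.
Hypothesis cstE : forall a, cst a = frac a%:P.

Lemma frac_eq0 a : (frac a == 0) = (a == 0).
Proof. by apply/eqP/eqP => [/frac_inj|->] //; rewrite rmorph0. Qed.

Lemma frac_eq a b : (frac a == frac b) = (a == b).
Proof. by rewrite -subr_eq0 -rmorphB frac_eq0 subr_eq0. Qed.

Lemma map_cst_frac (P : {poly K}) :
  map_poly cst P = map_poly frac (map_poly polyC P).
Proof. by rewrite -map_poly_comp; apply: eq_map_poly => a; rewrite /= cstE. Qed.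

Lemma horner_cst_X (P : {poly K}) : (map_poly cst P).[frac 'X] = frac P.
Proof.
rewrite map_cst_frac horner_map; congr (frac _).
by rewrite -/(comp_poly 'X P) comp_polyXr.
Qed.

Lemma mem_fractions_frac z : z \in fractions frac.
Proof.
have [a [b [b0 ->]]] := frac_surj z; apply/fractionsP.
by exists a, b; rewrite frac_eq0.
Qed.

End FractionFieldOf.

Section Homogenize.

Variable K : fieldType.
Implicit Types g h P : {poly K}.

(** h^n P(g/h), with n at least the degree of P. *)
Definition homogenize n g h P : {poly K} :=
  \sum_(i < n.+1) P`_i *: (g ^+ i * h ^+ (n - i)).

Lemma homogenize_top n g h P :
  exists S, homogenize n g h P = P`_n *: g ^+ n + h * S.
Proof.
exists (\sum_(i < n) P`_i *: (g ^+ i * h ^+ (n - i.+1))).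
rewrite /homogenize big_ord_recr /= subnn mulr1 addrC; congr (_ + _).
rewrite mulr_sumr; apply: eq_bigr => i _.
by rewrite -scalerAr mulrCA -exprS subnSK.
Qed.

Lemma homogenize_bot n g h P :
  exists S, homogenize n g h P = P`_0 *: h ^+ n + g * S.
Proof.
exists (\sum_(i < n) P`_i.+1 *: (g ^+ i * h ^+ (n - i.+1))).
rewrite /homogenize big_ord_recl /= mul1r subn0; congr (_ + _).
by rewrite mulr_sumr; apply: eq_bigr => i _; rewrite -scalerAr mulrA -exprS.
Qed.

Lemma homogenizeE (M : fieldType) (f : {rmorphism {poly K} -> M}) (cM : {rmorphism K -> M})
    n g h P : (forall c, f c%:P = cM c) -> f h != 0 -> (size P <= n.+1)%N ->
  f (homogenize n g h P) = f h ^+ n * (map_poly cM P).[f g / f h].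
Proof.
move=> fc h0 sP; rewrite (horner_coef_wide (n := n.+1)) ?size_map_poly //.
rewrite rmorph_sum mulr_sumr; apply: eq_bigr => i _.
rewrite -mul_polyC !rmorphM /= fc !rmorphXn coef_map /= [RHS]mulrCA; congr (_ * _).
have le_in : (i <= n)%N by rewrite -ltnS.
rewrite expr_div_n mulrCA mulrC [RHS]mulrC; congr (_ * _).
by apply: (canRL (mulfK (expf_neq0 i h0))); rewrite -exprD subnK.
Qed.

Lemma coprime_dvd_const g h : coprimep g h -> g %| h -> size g = 1%N.
Proof. by rewrite /coprimep => /eqP <- /dvdp_gcd_idl/eqp_size ->. Qed.

Lemma homogenize_eq0 n g h P : coprimep g h -> P`_0 != 0 -> P`_n != 0 ->
  homogenize n g h P = 0 -> size g = 1%N /\ size h = 1%N.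
Proof.
move=> cgh P0 Pn H0; split.
  apply: (coprime_dvd_const (h := h ^+ n)); first by rewrite coprimep_expr.
  have [S] := homogenize_bot n g h P; rewrite H0 => /esym/eqP.
  rewrite addr_eq0 => /eqP E; rewrite -(dvdpZr _ _ P0) E dvdpNr dvdp_mulIl //.
apply: (coprime_dvd_const (h := g ^+ n)); first by rewrite coprimep_expr // coprimep_sym.
have [S] := homogenize_top n g h P; rewrite H0 => /esym/eqP.
by rewrite addr_eq0 => /eqP E; rewrite -(dvdpZr _ _ Pn) E dvdpNr dvdp_mulIl.
Qed.

End Homogenize.

Section Transcendental.

Variables (K L : fieldType) (frac : {rmorphism {poly K} -> L}).
Hypothesis frac_inj : forall a, frac a = 0 -> a = 0.
Hypothesis frac_surj : forall z, exists a b, b != 0 /\ z = frac a / frac b.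
Variable cst : {rmorphism K -> L}.
Hypothesis cstE : forall a, cst a = frac a%:P.
Local Notation frac_eq0 := (frac_eq0 frac_inj).

Lemma fraction_coprime (z : L) :
  exists g h : {poly K}, [/\ coprimep g h, h != 0 & z = (frac g) / (frac h)].
Proof.
have [g [h [cgh h0 E]]] := coprime_representation (mem_fractions_frac frac_inj frac_surj z).
by exists g, h; split=> //; rewrite -frac_eq0.
Qed.

(** Clear denominators in P(g/h) = 0, with g and h coprime and P(0) <> 0: g divides
    P(0) h^n and h divides the leading coefficient of P times g^n, so that both
    are constant. *)
Lemma algebraic_constant (u : L) (P : {poly K}) : P != 0 -> root (map_poly cst P) u ->
  exists a, u = cst a.
Proof.
move=> P0 rP; have [->|u0] := eqVneq u 0; first by exists 0; rewrite rmorph0.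
have [g [h [cgh h0 Eu]]] := fraction_coprime u.
have [k [Q [EP Q0]]] : exists k Q, P = Q * 'X^k /\ Q`_0 != 0.
  have [k [Q]] := multiplicity_XsubC P 0; rewrite subr0 P0 /= => nr EP.
  by exists k, Q; rewrite -horner_coef0.
have rQ : (map_poly cst Q).[u] = 0.
  move/rootP: rP; rewrite EP rmorphM /= map_polyXn hornerM hornerXn => /eqP.
  by rewrite mulf_eq0 expf_eq0 (negbTE u0) andbF orbF => /eqP.
have Qn : Q != 0 by apply: contra_neq Q0 => ->; rewrite coef0.
have sQ : (size Q <= (size Q).-1.+1)%N by rewrite leqSpred.
have h0' : (frac h) != 0 by rewrite frac_eq0.
have := homogenizeE (f := frac) (cM := cst) g (fun c => esym (cstE c)) h0' sQ.
rewrite -Eu rQ mulr0 => /eqP; rewrite frac_eq0 => /eqP H0.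
have [|sg sh] := homogenize_eq0 cgh Q0 _ H0; first by rewrite -/(lead_coef Q) lead_coef_eq0.
have /size_poly1P[c _ Eg] : size g == 1%N by rewrite sg.
have /size_poly1P[d d0 Eh] : size h == 1%N by rewrite sh.
by exists (c / d); rewrite Eu Eg Eh -!cstE fmorph_div.
Qed.

Definition ev_cst (u : L) : {rmorphism {poly K} -> L} := (horner_eval u \o map_poly cst)%FUN.

Lemma ev_cst_inj u : (forall a, u != cst a) -> forall P, ev_cst u P = 0 -> P = 0.
Proof.
move=> uc P EP; apply: contrapT => /eqP P0.
by have [|a Ea] := algebraic_constant (u := u) P0; [apply/rootP | have := uc a; rewrite Ea eqxx].
Qed.

End Transcendental.

Section Luroth.

Variables (K L : fieldType) (frac : {rmorphism {poly K} -> L}).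
Hypothesis frac_inj : forall a, frac a = 0 -> a = 0.
Hypothesis frac_surj : forall z, exists a b, b != 0 /\ z = frac a / frac b.
Variable cst : {rmorphism K -> L}.
Hypothesis cstE : forall a, cst a = frac a%:P.
Local Notation frac_eq0 := (frac_eq0 frac_inj).
Local Notation frac_eq := (frac_eq frac_inj).
Let t : L := (frac 'X).

(** h(t) g(X) - g(t) h(X), with X the outer variable. For u = g(t)/h(t) it is a
    multiple of the equation g(X) - u h(X) of t over K(u), and it is symmetric in
    X and t up to sign, so that divisors in either variable can be compared. *)
Definition bezoutian (g h : {poly K}) : {poly {poly K}} :=
  h%:P * map_poly polyC g - g%:P * map_poly polyC h.

Lemma map_bezoutian g h : h != 0 ->
  map_poly frac (bezoutian g h) =
    (frac h) *: (map_poly cst g - ((frac g) / (frac h)) *: map_poly cst h).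
Proof.
move=> h0; rewrite rmorphB !rmorphM /= !map_polyC /= -!(map_cst_frac cstE).
rewrite scalerBr scalerA mulrCA divff ?mulr1 ?mul_polyC //.
by rewrite frac_eq0.
Qed.

Lemma swap_bezoutian g h :
  swapXY (bezoutian g h) = map_poly polyC h * g%:P - map_poly polyC g * h%:P.
Proof.
apply/polyP => i; apply/polyP => j; rewrite coef_swapXY !coefB.
by rewrite !coefCM !coefMC !coef_map /= !coefCM !coefMC.
Qed.

Lemma bezoutian_eq0 g h : h != 0 -> (forall a, (frac g) / (frac h) != cst a) ->
  bezoutian g h != 0.
Proof.
move=> h0 nc; apply/eqP => B0; have := map_bezoutian g h0.
rewrite B0 rmorph0 => /esym/eqP; rewrite scaler_eq0 frac_eq0 (negbTE h0) /= subr_eq0.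
move/eqP => E; have l0 : lead_coef h != 0 by rewrite lead_coef_eq0.
have := congr1 (fun p : {poly L} => p`_(size h).-1) E; rewrite coefZ !coef_map /= => E1.
have c0 : cst (lead_coef h) != 0 by rewrite fmorph_eq0.
have := nc (g`_(size h).-1 / lead_coef h); rewrite fmorph_div E1.
by rewrite mulfK // eqxx.
Qed.

(** A factor in X alone divides all the combinations h_j g - g_j h; two of these
    that are independent have g and h in their span, so that it divides both. *)
Lemma bezoutian_dvd (c g h : {poly K}) (Q : {poly {poly K}}) :
  coprimep g h -> h != 0 -> (forall a, (frac g) / (frac h) != cst a) ->
  bezoutian g h = Q * map_poly polyC c -> size c = 1%N.
Proof.
move=> cgh h0 nc EB.
have ES : swapXY (bezoutian g h) = swapXY Q * c%:P.
  by rewrite EB rmorphM /= swapXY_map_polyC.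
have dv j : c %| h`_j *: g - g`_j *: h.
  have := congr1 (fun P : {poly {poly K}} => P`_j) ES.
  rewrite swap_bezoutian coefB !coefMC !coef_map /= !mul_polyC => ->.
  exact: dvdp_mulIr.
have [j [k nz]] : exists j k, h`_j * g`_k - g`_j * h`_k != 0.
  apply: contrapT => H; have B0 := bezoutian_eq0 h0 nc.
  case/eqP: B0; rewrite -[bezoutian g h]swapXYK swap_bezoutian.
  apply/eqP; rewrite swapXY_eq0; apply/eqP/polyP => j; apply/polyP => k.
  rewrite coefB !coefMC !coef_map /= !mul_polyC coefB !coefZ !coef0.
  by apply/eqP; apply: contrapT => /negP nz; apply: H; exists j, k.
apply: (coprime_dvd_const (h := 1)); first by rewrite coprimep1.
have cg : c %| g.
  rewrite -(dvdpZr _ _ nz); have -> : (h`_j * g`_k - g`_j * h`_k) *: g =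
      g`_k *: (h`_j *: g - g`_j *: h) - g`_j *: (h`_k *: g - g`_k *: h).
    by rewrite -!mul_polyC polyCB !polyCM; ring.
  by apply: dvdp_sub; rewrite -mul_polyC; apply: dvdp_mull.
have ch : c %| h.
  rewrite -(dvdpZr _ _ nz); have -> : (h`_j * g`_k - g`_j * h`_k) *: h =
      h`_k *: (h`_j *: g - g`_j *: h) - h`_j *: (h`_k *: g - g`_k *: h).
    by rewrite -!mul_polyC polyCB !polyCM; ring.
  by apply: dvdp_sub; rewrite -mul_polyC; apply: dvdp_mull.
have : c %| gcdp g h by rewrite dvdp_gcd cg.
by move: cgh; rewrite -gcdp_eqp1 => /eqp_dvdr ->.
Qed.

Variable E : {pred L}.
Hypothesis EF : intermediate_field cst E.
Hypothesis E_nc : exists2 u, u \in E & forall a, u != cst a.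
Let EP : divring_closed E := EF.1.
Let EK : forall a, cst a \in E := EF.2.
Let memE_sub x y : x \in E -> y \in E -> x - y \in E.
Proof. by case: EP => _ + _; apply. Qed.
Let memE_div x y : x \in E -> y \in E -> x / y \in E.
Proof. by case: EP => _ _; apply. Qed.
Let memE_mul x y : x \in E -> y \in E -> x * y \in E.
Proof. by move=> xE yE; apply: (@rpredM _ (subfield_pred EP)). Qed.

Definition annihilates (f : {poly L}) := [/\ f != 0, forall i, f`_i \in E & f.[t] = 0].

Lemma annihilates_of u g h : u \in E -> (forall a, u != cst a) -> h != 0 ->
  u = (frac g) / (frac h) -> annihilates (map_poly cst g - u *: map_poly cst h).
Proof.
move=> uE nc h0 Eu; have h0' : (frac h) != 0 by rewrite frac_eq0.
split.
- have B0 : bezoutian g h != 0 by apply: bezoutian_eq0; rewrite -?Eu.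
  have : map_poly frac (bezoutian g h) != 0.
    rewrite map_poly_eq0_id0 // frac_eq0 lead_coef_eq0 //.
  by rewrite map_bezoutian // -Eu scaler_eq0 negb_or => /andP[].
- move=> i; rewrite coefB coefZ !coef_map; apply: memE_sub; first exact: EK.
  by apply: memE_mul => //; exact: EK.
- by rewrite hornerD hornerN hornerZ !(horner_cst_X cstE) Eu divfK // subrr.
Qed.

Lemma minimal_annihilator : exists f, annihilates f /\
  forall p : {poly L}, (forall i, p`_i \in E) -> p.[t] = 0 -> (size p < size f)%N -> p = 0.
Proof.
have [u uE nc] := E_nc; have [g [h [cgh h0 Eu]]] := fraction_coprime frac_inj frac_surj u.
pose P n := `[< exists2 f, annihilates f & size f = n >].
have exP : exists n, P n.
  exists (size (map_poly cst g - u *: map_poly cst h)); apply/asboolP.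
  by exists (map_poly cst g - u *: map_poly cst h) => //; apply: annihilates_of.
case: (ex_minnP exP) => n /asboolP[f fa fn] nmin; exists f; split=> // p pE pt lt.
apply: contrapT => /eqP p0; have : (n <= size p)%N.
  by apply: nmin; apply/asboolP; exists p.
by rewrite leqNgt -fn lt.
Qed.

(** Otherwise f / lead_coef f would have constant coefficients and t would be
    algebraic over K. *)
Lemma nonconstant_ratio f : annihilates f ->
  exists i, forall a, f`_i / lead_coef f != cst a.
Proof.
case=> f0 fE ft; apply: contrapT => H.
have /choice[c cP] i : exists a, f`_i / lead_coef f = cst a.
  apply: contrapT => H'; apply: H; exists i => a; apply/eqP => Ea; apply: H'; by exists a.
have l0 : lead_coef f != 0 by rewrite lead_coef_eq0.
pose P := \poly_(i < size f) c i.
have Ef : f = lead_coef f *: map_poly cst P.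
  apply/polyP => i; rewrite coefZ coef_map coef_poly /=.
  case: ltnP => [_|le]; first by rewrite -cP mulrCA divff ?mulr1.
  by rewrite rmorph0 mulr0 nth_default.
move: ft; rewrite Ef hornerZ (horner_cst_X cstE) => /eqP.
rewrite mulf_eq0 (negbTE l0) /= frac_eq0 => /eqP P0.
by case/eqP: f0; rewrite Ef P0 rmorph0 scaler0.
Qed.

Lemma primitive_form f : f != 0 -> exists F c,
  [/\ c != 0, map_poly frac F = c *: f & primitive F].
Proof.
move=> f0; have fr i : f`_i \in fractions frac.
  exact: mem_fractions_frac.
have [q [P [q0 EP']]] := clear_denominators fr.
have P0 : P != 0.
  apply: contra_neq f0 => P0; move/esym/eqP: EP'.
  by rewrite P0 rmorph0 scaler_eq0 (negbTE q0) => /eqP.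
have [c [F [c0 EF' Fp]]] := primitive_multiple P0.
have c0' : (frac c) != 0 by rewrite frac_eq0.
exists F, ((frac c)^-1 * (frac q)); split=> //.
  by rewrite mulf_neq0 ?invr_eq0.
rewrite -scalerA -EP' EF' rmorphM /= map_polyC /= mul_polyC scalerA mulVf //.
by rewrite scale1r.
Qed.

Lemma poly_mod_E (f p : {poly L}) : (forall i, f`_i \in E) -> (forall i, p`_i \in E) ->
  forall i, (p %% f)`_i \in E.
Proof.
move=> fE pE i; have [f1 ->] := poly_subfield EP fE; have [p1 ->] := poly_subfield EP pE.
by rewrite -map_modp coef_map /=; case: (_`_i).
Qed.

(** Let f be the minimal polynomial of t over E, F(t, X) a primitive multiple of f
    in K[t][X], and u = g(t)/h(t), in lowest terms, a nonconstant ratio of two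
    coefficients of f. Then f divides g(X) - u h(X), so that F divides
    h(t) g(X) - g(t) h(X), by Gauss's lemma. The degree of F in t is at least that
    of g and of h, because u is also a ratio of two coefficients of F; so the
    quotient is a polynomial in X alone, hence constant, and f is proportional to
    g(X) - u h(X), which is defined over K(u). *)
Theorem luroth_generator : exists u, [/\ u \in E, forall a, u != cst a
  & exists f, [/\ annihilates f,
      forall p : {poly L}, (forall i, p`_i \in E) -> p.[t] = 0 -> (size p < size f)%N -> p = 0
    & forall i, f`_i \in adjoin cst [:: u]]].
Proof.
have [f [fa fmin]] := minimal_annihilator; have [f0 fE ft] := fa.
have [i nc] := nonconstant_ratio fa; set u := f`_i / lead_coef f in nc.
have uE : u \in E by apply: memE_div; apply: fE.
have [g [h [cgh h0 Eu]]] := fraction_coprime frac_inj frac_surj u.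
have ncgh a : (frac g) / (frac h) != cst a by rewrite -Eu.
have [F [c [c0 EF' Fp]]] := primitive_form f0.
have F0 : F != 0.
  apply: contra_neq f0 => F0; move/esym/eqP: EF'.
  by rewrite F0 rmorph0 scaler_eq0 (negbTE c0) => /eqP.
have B0 := bezoutian_eq0 h0 ncgh.
pose fu := map_poly cst g - u *: map_poly cst h.
have fua : annihilates fu by apply: annihilates_of.
have dfu : f %| fu.
  rewrite dvdpE -Pdiv.Idomain.dvdpE; apply/modp_eq0P; apply: fmin.
  - by apply: poly_mod_E => //; case: fua.
  - have [_ _ fut] := fua; have := divp_eq fu f => /(congr1 (horner^~ t)) /=.
    by rewrite fut hornerD hornerM ft mulr0 add0r.
  - by rewrite ltn_modp.
have [Q EQ] : exists Q, bezoutian g h = F * Q.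
  have [q Eq] : exists q, map_poly frac (bezoutian g h) = map_poly frac F * q.
    have /dvdpP[q Eq] := dfu; exists (((frac h) / c) *: q).
    rewrite map_bezoutian // -Eu -/fu Eq EF' -scalerAl -scalerAr scalerA.
    by rewrite mulrCA divff ?mulr1 // mulrC.
  have qr j : q`_j \in fractions frac.
    exact: mem_fractions_frac.
  have [b [Q [b0 EQ]]] := clear_denominators qr.
  have b0' : b != 0 by rewrite -frac_eq0.
  apply: (gauss Fp b0' (Q := Q)); apply: (map_inj_poly (f := frac)).
  - by move=> x y /eqP; rewrite frac_eq => /eqP.
  - exact: rmorph0.
  by rewrite !rmorphM /= map_polyC /= Eq EQ mul_polyC -scalerAr.
have Q0 : Q != 0 by apply: contra_neq B0 => Q0; rewrite EQ Q0 mulr0.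
have hF : (size g <= sizeY F)%N /\ (size h <= sizeY F)%N.
  have l0 : lead_coef f != 0 by rewrite lead_coef_eq0.
  have Fj j : (frac F`_j) = c * f`_j.
    by have := congr1 (fun p : {poly L} => p`_j) EF'; rewrite coef_map coefZ.
  pose n := (size f).-1.
  have Fn0 : F`_n != 0.
    by rewrite -frac_eq0 Fj mulf_neq0.
  have E1 : F`_i * h = g * F`_n.
    apply/eqP; rewrite -frac_eq !rmorphM !Fj.
    have h0' : (frac h) != 0 by rewrite frac_eq0.
    have -> : (frac g) = u * (frac h) by rewrite Eu divfK.
    have -> : f`_i = u * lead_coef f by rewrite /u divfK.
    by rewrite /n -/(lead_coef f); apply/eqP; ring.
  have dh : h %| F`_n.
    by have := dvdp_mulIr F`_i h; rewrite E1 Gauss_dvdpr // coprimep_sym.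
  have dg : g %| F`_i.
    by have := dvdp_mulIl g F`_n; rewrite -E1 Gauss_dvdpl.
  have Fi0 : F`_i != 0.
    apply/eqP => Fi; have := nc 0; rewrite rmorph0 /u => /eqP; apply.
    move/eqP: Fi; rewrite -frac_eq0 Fj mulf_eq0 (negbTE c0) /= => /eqP ->.
    by rewrite mul0r.
  split; first exact: leq_trans (dvdp_leq Fi0 dg) (max_size_coefXY _ _).
  exact: leq_trans (dvdp_leq Fn0 dh) (max_size_coefXY _ _).
have [c' Ec'] : exists c', Q = map_poly polyC c'.
  suff : (size (swapXY Q) <= 1)%N.
    move/size1_polyC => E1; exists (swapXY Q)`_0.
    by rewrite -{1}[Q]swapXYK {1}E1 swapXY_polyC.
  have : (size (swapXY (bezoutian g h)) <= sizeY F)%N.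
    rewrite swap_bezoutian; apply: leq_trans (size_polyD _ _) _.
    rewrite size_polyN geq_max; apply/andP; split.
      rewrite mulrC mul_polyC; apply: leq_trans (size_scale_leq _ _) _.
      by rewrite size_map_polyC; case: hF.
    rewrite mulrC mul_polyC; apply: leq_trans (size_scale_leq _ _) _.
    by rewrite size_map_polyC; case: hF.
  rewrite EQ rmorphM /= size_mul ?swapXY_eq0 // sizeYE.
  have : (0 < size (swapXY F))%N by rewrite size_poly_gt0 swapXY_eq0.
  case: (size (swapXY F)) => // s _; rewrite addSn /= -addn1 [(_ + 1)%N]addn1.
  by rewrite -addn1 leq_add2l.
have sc : size c' = 1%N by apply: (bezoutian_dvd cgh h0 ncgh (Q := F)); rewrite -Ec'.
have /size_poly1P[a a0 Ec] : size c' == 1%N by rewrite sc.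
have [b Efu] : exists b, f = b *: fu.
  have h0' : frac h != 0 by rewrite frac_eq0.
  have : map_poly frac (bezoutian g h) = cst a *: (c *: f).
    by rewrite EQ Ec' Ec map_polyC rmorphM /= map_polyC /= -cstE EF' mulrC mul_polyC.
  rewrite map_bezoutian // -Eu -/fu => Ef.
  have ca0 : cst a * c != 0 by rewrite mulf_neq0 // fmorph_eq0.
  exists ((cst a * c)^-1 * frac h); rewrite -scalerA Ef [cst a *: _]scalerA scalerA.
  by rewrite mulVf // scale1r.
have sfu : size f = size fu.
  rewrite Efu size_scale //; apply: contra_neq f0 => b0.
  by rewrite Efu b0 scale0r.
exists u; split=> //; exists fu; split=> // [p pE pt|j].
  by rewrite -sfu; apply: fmin.
have [[_ aB _] aK] := adjoin_field cst [:: u].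
have [aP _] := adjoin_field cst [:: u].
rewrite coefB coefZ !coef_map; apply: aB; first exact: aK.
apply: (@rpredM _ (subfield_pred aP)); last exact: aK.
by apply: mem_adjoin; rewrite mem_head.
Qed.

Lemma adjoin_one u : {subset adjoin cst [:: u] <= fractions (ev_cst cst u)}.
Proof.
apply: adjoin_sub; last first.
  move=> _ /[!inE]/eqP ->; have E1 : ev_cst cst u 'X = u.
    by rewrite /= map_polyX; apply: hornerX.
  by have := mem_fractions (ev_cst cst u) 'X; rewrite E1.
split; first exact: fractions_divring.
move=> a; have E1 : ev_cst cst u a%:P = cst a.
  by rewrite /= map_polyC; apply: hornerC.
by have := mem_fractions (ev_cst cst u) a%:P; rewrite E1.
Qed.

(** Let w = P(t)/Q(t) be in E. Modulo f, P and Q become polynomials P' and Q' over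
    K(u) with the same values at t; w Q' - P' vanishes at t and has smaller degree
    than f, so that it is 0, and w is a ratio of coefficients of P' and Q'. *)
Theorem luroth : exists u, [/\ u \in E, forall a, u != cst a
  & {subset E <= fractions (ev_cst cst u)}].
Proof.
have [u [uE nc [f [fa fmin fA]]]] := luroth_generator; have [f0 fE ft] := fa.
exists u; split=> // w wE; apply: adjoin_one.
have [P [Q [_ Q0 Ew]]] := fraction_coprime frac_inj frac_surj w.
have [aP aK] := adjoin_field cst [:: u].
have [f1 Ef1] := poly_subfield aP fA.
have modA (p : {poly K}) : forall i, (map_poly cst p %% f)`_i \in adjoin cst [:: u].
  have pA i : (map_poly cst p)`_i \in adjoin cst [:: u] by rewrite coef_map; apply: aK.
  have [p1 ->] := poly_subfield aP pA; rewrite Ef1 -map_modp => i.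
  by rewrite coef_map /=; case: (_`_i).
have aE : {subset adjoin cst [:: u] <= E}.
  by apply: adjoin_sub => // _ /[!inE]/eqP ->.
have mod_t (p : {poly K}) : (map_poly cst p %% f).[t] = frac p.
  rewrite -(horner_cst_X cstE) -/t {2}(divp_eq (map_poly cst p) f).
  by rewrite hornerD hornerM ft mulr0 add0r.
have frQ : frac Q != 0 by rewrite frac_eq0.
have E0 : w *: (map_poly cst Q %% f) - map_poly cst P %% f = 0.
  apply: fmin => [i||].
  - rewrite coefB coefZ; apply: memE_sub; last exact/aE/modA.
    by apply: memE_mul => //; apply/aE/modA.
  - by rewrite hornerD hornerN hornerZ !mod_t Ew divfK // subrr.
  - apply: leq_ltn_trans (size_polyD _ _) _; rewrite size_polyN gtn_max.
    apply/andP; split; last by rewrite ltn_modp.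
    by apply: leq_ltn_trans (size_scale_leq _ _) _; rewrite ltn_modp.
have rQ0 : map_poly cst Q %% f != 0.
  by apply: contra_neq frQ => rQ; rewrite -mod_t rQ horner0.
have l0 : lead_coef (map_poly cst Q %% f) != 0 by rewrite lead_coef_eq0.
have -> : w = (map_poly cst P %% f)`_(size (map_poly cst Q %% f)).-1 /
              lead_coef (map_poly cst Q %% f).
  have := congr1 (fun p : {poly L} => p`_(size (map_poly cst Q %% f)).-1) E0.
  rewrite /= coefB coefZ coef0 => /eqP; rewrite subr_eq0 => /eqP <-.
  by rewrite -/(lead_coef _) mulfK.
by case: (aP) => _ _; apply; apply: modA.
Qed.

End Luroth.

(** * Moebius transformations *)

Section Moebius.

Variables (K L : fieldType) (cst : {rmorphism K -> L}) (z : L).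
Local Notation ev := (ev_cst cst).
Hypothesis ev_inj : forall P, ev z P = 0 -> P = 0.

Lemma ev_cstC u c : ev u c%:P = cst c.
Proof. by rewrite /= map_polyC; apply: hornerC. Qed.

Lemma ev_cstX u : ev u 'X = u.
Proof. by rewrite /= map_polyX; apply: hornerX. Qed.

Lemma size2_ev (g : {poly K}) : (size g <= 2)%N -> ev z g = cst g`_1 * z + cst g`_0.
Proof.
move=> sg; have -> : g = (g`_1)%:P * 'X + (g`_0)%:P.
  apply/polyP => i; rewrite coefD coefCM coefX coefC.
  case: i => [|[|i]] /=; rewrite ?mulr0 ?mulr1 ?addr0 ?add0r //.
  by rewrite nth_default // (leq_trans sg).
rewrite rmorphD rmorphM !ev_cstC ev_cstX !coefD !coefCM !coefX !coefC /=.
by rewrite !(mulr0, mulr1, addr0, add0r).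
Qed.

Let coef_lin a b : (a%:P - b *: 'X : {poly K})`_0 = a /\ (a%:P - b *: 'X : {poly K})`_1 = - b.
Proof. by rewrite !coefB !coefC !coefZ !coefX /= mulr0 mulr1 subr0 sub0r. Qed.

(** Write w = g(z)/h(z) and z = A(w)/B(w) in lowest terms and clear denominators in
    A(w) = z B(w): this gives A^h = X B^h, where ^h denotes homogenization in
    degree N = max (deg A, deg B). Modulo h and modulo g it says that h divides
    A_N - B_N X and g divides A_0 - B_0 X, so that both have degree at most 1. *)
Lemma moebius_of w : w \in fractions (ev z) -> z \in fractions (ev w) ->
  exists a b c d, cst c * z + cst d != 0 /\ w * (cst c * z + cst d) = cst a * z + cst b.
Proof.
move=> /coprime_representation[g [h [cgh h0 Ew]]] /coprime_representation[A [B [cAB B0 Ez]]].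
pose N := (maxn (size A) (size B)).-1.
have Bn : B != 0 by apply: contra_neq B0 => ->; rewrite rmorph0.
have mx : (maxn (size A) (size B) = N.+1)%N.
  by rewrite prednK // leq_max !size_poly_gt0 Bn orbT.
have sA : (size A <= N.+1)%N by rewrite -mx leq_maxl.
have sB : (size B <= N.+1)%N by rewrite -mx leq_maxr.
have ABN : (A`_N)%:P - B`_N *: 'X != 0.
  apply/eqP => E; have [] := coef_lin A`_N B`_N; rewrite E !coef0 => /esym A0 /eqP.
  rewrite eq_sym oppr_eq0 => /eqP BN0.
  have : (maxn (size A) (size B) <= N)%N.
    rewrite geq_max; apply/andP; split; apply/leq_sizeP => j; rewrite leq_eqVlt.
      by case/orP=> [/eqP <- //|lt]; rewrite nth_default // (leq_trans sA).
    by case/orP=> [/eqP <- //|lt]; rewrite nth_default // (leq_trans sB).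
  by rewrite mx ltnn.
have AB0 : (A`_0)%:P - B`_0 *: 'X != 0.
  apply/eqP => E; have [] := coef_lin A`_0 B`_0; rewrite E !coef0 => /esym A0 /eqP.
  rewrite eq_sym oppr_eq0 => /eqP BN0.
  have XA : 'X %| A by rewrite -['X]subr0 -polyC0 dvdp_XsubCl rootE horner_coef0 A0.
  have XB : 'X %| B by rewrite -['X]subr0 -polyC0 dvdp_XsubCl rootE horner_coef0 BN0.
  have : 'X %| gcdp A B by rewrite dvdp_gcd XA.
  move: cAB; rewrite -gcdp_eqp1 => /eqp_dvdr ->.
  by rewrite dvdp1 size_polyX.
have size_lin (a b : K) : (size (a%:P - b *: 'X)%R <= 2)%N.
  apply: leq_trans (size_polyD _ _) _; rewrite size_polyN geq_max.
  rewrite (leq_trans (size_polyC_leq1 _)) //=.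
  by apply: leq_trans (size_scale_leq _ _) _; rewrite size_polyX.
have hom : homogenize N g h A = 'X * homogenize N g h B.
  apply/eqP; rewrite -subr_eq0; apply/eqP/ev_inj; rewrite rmorphB rmorphM ev_cstX.
  rewrite !(homogenizeE g (ev_cstC z) h0) // -Ew.
  have -> : (map_poly cst A).[w] = z * (map_poly cst B).[w].
    by rewrite Ez divfK //; exact: B0.
  by rewrite mulrCA subrr.
have sh : (size h <= 2)%N.
  apply: leq_trans (size_lin A`_N B`_N); apply: dvdp_leq => //.
  have cp : coprimep h (g ^+ N) by rewrite coprimep_expr // coprimep_sym.
  rewrite -(Gauss_dvdpr _ cp).
  have [S ES] := homogenize_top N g h A; have [S' ES'] := homogenize_top N g h B.
  move: hom; rewrite ES ES' => E.
  have -> : g ^+ N * ((A`_N)%:P - B`_N *: 'X) = h * ('X * S' - S).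
    apply/eqP; rewrite -subr_eq0; move/eqP: E; rewrite -subr_eq0 => /eqP E.
    by rewrite -E -!mul_polyC; apply/eqP; ring.
  exact: dvdp_mulIl.
have sg : (size g <= 2)%N.
  apply: leq_trans (size_lin A`_0 B`_0); apply: dvdp_leq => //.
  have cp : coprimep g (h ^+ N) by rewrite coprimep_expr.
  rewrite -(Gauss_dvdpr _ cp).
  have [S ES] := homogenize_bot N g h A; have [S' ES'] := homogenize_bot N g h B.
  move: hom; rewrite ES ES' => E.
  have -> : h ^+ N * ((A`_0)%:P - B`_0 *: 'X) = g * ('X * S' - S).
    apply/eqP; rewrite -subr_eq0; move/eqP: E; rewrite -subr_eq0 => /eqP E.
    by rewrite -E -!mul_polyC; apply/eqP; ring.
  exact: dvdp_mulIl.
exists g`_1, g`_0, h`_1, h`_0; rewrite -!size2_ev //; split=> //.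
by rewrite Ew divfK.
Qed.

(** The denominator is kept on the left, so that composition is a matrix product. *)
Definition moebius (s : L -> L) a b c d :=
  cst c * z + cst d != 0 /\ s z * (cst c * z + cst d) = cst a * z + cst b.

Lemma moebius_comp (s t : {rmorphism L -> L}) a b c d a' b' c' d' :
  (forall x, s (cst x) = cst x) ->
  moebius s a b c d -> moebius t a' b' c' d' ->
  moebius (s \o t)%FUN (a' * a + b' * c) (a' * b + b' * d) (c' * a + d' * c) (c' * b + d' * d).
Proof.
move=> sK [n1 E1] [n2 E2]; set D := cst c * z + cst d in n1 E1.
have Ed : cst (c' * a + d' * c) * z + cst (c' * b + d' * d) = s (cst c' * z + cst d') * D.
  rewrite [s _]rmorphD [s (_ * _)]rmorphM !sK mulrDl -mulrA E1 /D.
  by rewrite !(rmorphD cst) !(rmorphM cst); ring.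
split; first by rewrite Ed mulf_neq0 // fmorph_eq0.
rewrite Ed mulrA /= -rmorphM E2 [s _]rmorphD [s (_ * _)]rmorphM !sK mulrDl -mulrA E1 /D.
by rewrite !(rmorphD cst) !(rmorphM cst); ring.
Qed.

Lemma moebius_id a b c d (s : L -> L) : moebius s a b c d -> s z = z -> b = 0 /\ a = d.
Proof.
move=> [n E] sz; move: E; rewrite sz => E.
have P0 : c%:P * ('X * 'X) + (d - a)%:P * 'X - b%:P = 0.
  apply: ev_inj; rewrite rmorphB rmorphD !rmorphM !ev_cstC !ev_cstX rmorphB.
  have -> : cst c * (z * z) + (cst d - cst a) * z - cst b =
    z * (cst c * z + cst d) - (cst a * z + cst b) by ring.
  by rewrite E subrr.
have := congr1 (fun p : {poly K} => p`_0) P0.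
have := congr1 (fun p : {poly K} => p`_1) P0.
rewrite /= !coef0 !coefB !coefD !coefCM -expr2 !coefXn !coefX !coefC /=.
rewrite !(mulr0, mulr1, addr0, add0r, subr0, sub0r) => /eqP; rewrite subr_eq0 => /eqP ->.
by move/eqP; rewrite oppr_eq0 => /eqP.
Qed.

(** Let M be the matrix of s. Its fourth power is scalar; in characteristic 2 this
    forces the diagonal entries of M^2, and then those of M, to have equal squares,
    hence to be equal. So M has trace 0, and M^2 is scalar by Cayley-Hamilton. *)
Lemma moebius_order4 (s : {rmorphism L -> L}) a b c d :
  2%N \in [pchar K] -> (forall x, s (cst x) = cst x) ->
  moebius s a b c d -> s (s (s (s z))) = z -> s (s z) = z.
Proof.
move=> ch2 sK M1 s4; have two : 2%:R = 0 :> K by case/andP: ch2 => _ /eqP.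
have sq (x y : K) : x ^+ 2 = y ^+ 2 -> x = y.
  move=> E; apply/eqP; rewrite -subr_eq0 -sqrf_eq0; apply/eqP.
  have -> : (x - y) ^+ 2 = x ^+ 2 - y ^+ 2 + 2%:R * (y * y - x * y) by ring.
  by rewrite E two; ring.
have M2 := moebius_comp sK M1 M1.
have sK2 x : (s \o s)%FUN (cst x) = cst x by rewrite /= !sK.
have M4 := moebius_comp (s := (s \o s)%FUN) (t := (s \o s)%FUN) sK2 M2 M2.
have [b4 ad4] := moebius_id M4 s4.
have ad2 : a * a + b * c = c * b + d * d.
  apply: sq; move: ad4; set a2 := a * a + b * c; set d2 := c * b + d * d.
  set b2 := a * b + b * d; set c2 := c * a + d * c => E.
  by apply: (addIr (b2 * c2)); rewrite !expr2 E; ring.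
have ad : a = d.
  by apply: sq; apply: (addrI (b * c)); rewrite addrC !expr2 ad2; ring.
case: M2; rewrite ad2 ad.
have dbl (x : K) : x + x = 0 by rewrite -mulr2n -mulr_natl two mul0r.
rewrite (mulrC d c) (mulrC b d) !dbl.
rewrite rmorph0 mul0r add0r addr0 => n E; apply: (mulIf n).
by rewrite E mulrC.
Qed.

End Moebius.

(** * Lower bounds in characteristic two *)

Section ActionPowers.

Variables (K L : fieldType) (iota : {rmorphism K -> L}).
Variables (gT : finGroupType) (act : gT -> {rmorphism L -> L}).
Hypothesis actP : is_action iota act.

Lemma act_exp2 s x : act (s ^+ 2)%g x = act s (act s x).
Proof. by rewrite expgS expg1 (act_mul actP). Qed.

Lemma act_exp4 s x : act (s ^+ 4)%g x = act s (act s (act s (act s x))).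
Proof. by rewrite (expgM s 2 2) !act_exp2. Qed.

End ActionPowers.

Section Involution.

Variables (gT : finGroupType) (s : gT).
Hypotheses (s2 : (s ^+ 2 = 1)%g) (s1 : s != 1%g).

Definition involution_morph (i : 'I_2) : gT := (s ^+ i)%g.

Lemma involution_morphM : {morph involution_morph : x y / (x * y)%g}.
Proof. by move=> i j; rewrite /involution_morph -expgD -[RHS](expg_mod _ s2). Qed.

Lemma involution_morph_inj : injective involution_morph.
Proof.
move=> [[|[|i]] hi] [[|[|j]] hj] //=; rewrite /involution_morph /= ?expg0 ?expg1 => E.
- exact/val_inj.
- by case/eqP: s1.
- by case/eqP: s1.
- exact/val_inj.
Qed.

End Involution.

Section ArtinSchreier.

Variable K : fieldType.
Hypothesis ch2 : 2%N \in [pchar K].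
Local Notation F := (ratfun K).

Definition triv_act (_ : 'I_2) : {rmorphism K -> K} := idfun.
Definition one_scal (_ : 'I_2) : K := 1.
Definition nat_shift (i : 'I_2) : K := (i : nat)%:R.

Lemma triv_actP : is_action (idfun : {rmorphism K -> K}) triv_act.
Proof. by []. Qed.
Lemma one_scalM g h : one_scal (g * h)%g = one_scal g * one_scal h.
Proof. by rewrite /one_scal mulr1. Qed.
Lemma nat_shiftM (g h : 'I_2) : nat_shift (g * h)%g = one_scal h * nat_shift g + nat_shift h.
Proof. by rewrite /one_scal mul1r /nat_shift -natrD -[RHS](GRing.natr_mod_pchar ch2). Qed.

(** The involution t |-> t + 1 of K(t). *)
Definition shift_act : 'I_2 -> {rmorphism F -> F} :=
  ratfun_act triv_actP (erefl : one_scal 1%g = 1) (erefl : nat_shift 1%g = 0)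
    one_scalM nat_shiftM.

Definition tcst : {rmorphism K -> F} := ratfun_const idfun.

Lemma shift_actP : is_action tcst shift_act.
Proof. exact: ratfun_actP. Qed.

Lemma shift_act_faithful : faithful_on shift_act predT.
Proof.
apply: ratfun_act_faithful => -[[|[|i]] hi] // _ _ /eqP; first by move=> _; apply/val_inj.
by rewrite /nat_shift oner_eq0.
Qed.

Lemma tofrac_inj (a : {poly K}) : a%:F = 0 -> a = 0.
Proof. by move/eqP; rewrite tofrac_eq0 => /eqP. Qed.

Lemma tofrac_surj (z : F) : exists a b : {poly K}, b != 0 /\ z = a%:F / b%:F.
Proof. exact: fraction_ex. Qed.

Lemma tcstE a : tcst a = a%:P%:F. Proof. by []. Qed.

(** K is algebraically closed in K(t). *)
Lemma trdeg0_constant (E : {pred F}) : trdeg_le tcst E 0 ->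
  forall x, x \in E -> exists a, x = tcst a.
Proof.
move=> E0 x xE; have [n [b [n0 _ _ Eb _]]] := trdeg_basis E0.
have /alg_closureP[p [p0 pA rp]] := Eb x xE.
have sub : {subset adjoin tcst (codom b) <= [pred y | `[< exists a, y = tcst a >]]}.
  apply: adjoin_sub; last first.
    move: n0; rewrite leqn0 => /eqP n0; move: b {Eb pA}; rewrite n0 => b.
    by rewrite /codom /image_mem enum_ord0.
  split; last by move=> a; apply/asboolP; exists a.
  split=> [|y z /asboolP[a ->] /asboolP[c ->]|y z /asboolP[a ->] /asboolP[c ->]];
    apply/asboolP.
  - by exists 1; rewrite rmorph1.
  - by exists (a - c); rewrite rmorphB.
  - by exists (a / c); rewrite fmorph_div.
have /choice[c cP] i : exists a, p`_i = tcst a by have /asboolP := sub _ (pA i).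
pose P := \poly_(i < size p) c i.
have EP : p = map_poly tcst P.
  apply/polyP => i; rewrite coef_map coef_poly /=.
  by case: ltnP => [_|le]; [rewrite cP | rewrite rmorph0 nth_default].
apply: (algebraic_constant tofrac_inj tofrac_surj tcstE (P := P)); last by rewrite -EP.
by apply: contra_neq p0; rewrite EP => ->; rewrite rmorph0.
Qed.

Variables (gT : finGroupType) (m : nat) (V : mx_representation K [set: gT]%G m).

(** A subfield of transcendence degree 0 would specialize to one of K(t), which
    consists of constants, where t |-> t + 1 is not faithful. *)
Lemma ed_gt0_involution (s : gT) d : (s ^+ 2 = 1)%g -> s != 1%g ->
  ed_le (rat_field_const K m) (rat_act_rmorph V) d -> (0 < d)%N.
Proof.
move=> s2 s1 dV; rewrite lt0n; apply/eqP => d0; rewrite d0 in dV.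
have [E [EF Es Ef Ed]] := specialization_ed_le (kappa := tcst) (ext := idfun)
  (involution_morphM s2) (involution_morph_inj s1) shift_actP shift_act_faithful
  (@ratfun_infinite K) (fun=> erefl) shift_actP dV.
have : (1 : 'I_2) = 1%g.
  by apply: Ef => x xE; have [a ->] := trdeg0_constant Ed xE; apply: act_const shift_actP _ _.
by move/(congr1 val).
Qed.

(** Suppose that E is stable and faithful of transcendence degree 1, and that y in
    E is moved by s^2. Specialize K(V) to K(t) so that s^2 becomes t |-> t + 1 and
    still moves the residue of y. This residue is then not constant, which by
    [residues_trdeg_drop] makes the specialization injective where it is defined
    on E. So the elements of E with all conjugates defined there form a stable
    field E2 that embeds in K(t); by Lueroth's theorem it is K(z), on which s acts
    by a Moebius transformation. By [moebius_order4] s^2 fixes z, hence y. *)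
Lemma ed_gt1_order4 (s : gT) d : (s ^+ 4 = 1)%g -> (s ^+ 2)%g != 1%g ->
  ed_le (rat_field_const K m) (rat_act_rmorph V) d -> (1 < d)%N.
Proof.
move=> s4 s2 [E [EF Es Ef Ed]]; rewrite ltnNge; apply/negP => d1.
have {d d1} Ed : trdeg_le (rat_field_const K m) E 1.
  by move=> n t tE it; apply: leq_trans d1; apply: Ed it.
have aP := rat_act_action V.
have s22 : ((s ^+ 2) ^+ 2 = 1)%g by rewrite -expgM.
have thM := involution_morphM s22; have thI := involution_morph_inj s2.
set g2 := (s ^+ 2)%g in s2 s22 thM thI.
have [y yE y2] := faithful_moves aP Ef s2.
have /choice[ab abP] g : exists ab : {mpoly K[m]} * {mpoly K[m]},
    ab.2 != 0 /\ rat_act_rmorph V g y = ab.1%:F / ab.2%:F.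
  by have [a [b [b0 Eab]]] := fraction_ex (rat_act_rmorph V g y); exists (a, b).
pose D := (ab g2).1 * (ab 1%g).2 - (ab 1%g).1 * (ab g2).2.
have nz2 g : (ab g).2%:F != 0 by rewrite tofrac_eq0; case: (abP g).
have D0 : D != 0.
  apply: contra_neq y2 => /eqP; rewrite subr_eq0 => /eqP D0.
  rewrite -[RHS](act_one aP); have [_ ->] := abP g2; have [_ ->] := abP 1%g.
  apply/eqP; rewrite (eqr_div _ _ (nz2 g2) (nz2 1%g)).
  by rewrite -[X in X == _]tofracM -[X in _ == X]tofracM D0.
(* phi f <> 0 keeps the conjugates of y defined and s^2 y distinct from y *)
pose f := D * \prod_g (ab g).2.
have f0 : f != 0.
  by rewrite mulf_neq0 //; apply/prodf_neq0 => g _; case: (abP g).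
have [phi [phif phiC phi_eqv]] := equivariant_specialization (kappa := tcst) thM V
  shift_actP shift_act_faithful (@ratfun_infinite K) f0.
have RP := specializes_hom phiC; have eqv := specializes_eqv phi_eqv.
set R := specializes phi in RP eqv.
move: phif; rewrite rmorphM mulf_eq0 negb_or rmorph_prod => /andP[phiD /prodf_neq0 phi2].
have Ry g : R (rat_act_rmorph V g y) (phi (ab g).1 / phi (ab g).2).
  by exists (ab g).1, (ab g).2; rewrite phi2 //; case: (abP g).
pose r1 := phi (ab 1%g).1 / phi (ab 1%g).2.
have Ry1 : R y r1 by have := Ry 1%g; rewrite (act_one aP).
have r1_nc a : r1 != tcst a.
  apply/eqP => E1; case/eqP: phiD; rewrite /D rmorphB !rmorphM.
  apply/eqP; rewrite subr_eq0 -eqr_div ?phi2 //; apply/eqP.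
  rewrite -/r1 E1; have Ra := eqv 1 y r1 Ry1.
  rewrite E1 (act_const shift_actP) in Ra.
  have E2 : involution_morph g2 1 = g2 by exact: expg1.
  by rewrite E2 in Ra; have := local_hom_fun RP (Ry g2) Ra.
have Rinj z : z \in E -> R z 0 -> z = 0.
  move=> zE Rz; apply/eqP; apply: contrapT => /negP z0.
  have [_ E0] := residues_trdeg_drop RP Ed zE z0 Rz.
  have [|a Ea] := trdeg0_constant E0 (x := r1); first by apply/residuesP; exists y.
  by have := r1_nc a; rewrite Ea eqxx.
pose E2 : {pred rat_field K m} :=
  [pred z | (z \in E) && `[< forall g, exists r, R (rat_act_rmorph V g z) r >]].
have E2P z : reflect (z \in E /\ forall g, exists r, R (rat_act_rmorph V g z) r) (z \in E2).
  by apply: (iffP andP) => [[h1 /asboolP h2]|[h1 h2]]; split=> //; apply/asboolP.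
have [[E1 EB ED] EK] := EF.
have E2F : intermediate_field (rat_field_const K m) E2.
  split; last first.
    move=> a; apply/E2P; split=> // g; exists (tcst a).
    by rewrite (act_const aP); apply: (local_hom_const RP).
  split=> [|z w /E2P[zE zR] /E2P[wE wR]|z w /E2P[zE zR] /E2P[wE wR]]; apply/E2P.
  - by split=> // g; exists 1; rewrite rmorph1; apply: local_hom_one RP.
  - split=> [|g]; first exact: EB.
    have [r zr] := zR g; have [r' wr'] := wR g; exists (r - r').
    by rewrite rmorphB; apply: (local_hom_sub RP).
  - split=> [|g]; first exact: ED.
    have [r zr] := zR g; have [r' wr'] := wR g; have [r'0|r'0] := eqVneq r' 0.
      exists 0; rewrite r'0 in wr'; have gw0 := Rinj _ (Es g w wE) wr'.
      by rewrite fmorph_div gw0 invr0 mulr0; apply: local_hom_zero RP.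
    exists (r / r'); rewrite fmorph_div; apply: (local_hom_mul RP) => //.
    exact: (local_hom_inv RP).
have E2E : {subset E2 <= E} by move=> z /E2P[].
have E2R z : z \in E2 -> exists r, R z r.
  by case/E2P=> _ /(_ 1%g); rewrite (act_one aP).
have E2s g z : z \in E2 -> rat_act_rmorph V g z \in E2.
  case/E2P=> zE zR; apply/E2P; split=> [|h]; first exact: Es.
  by rewrite -(act_mul aP); apply: zR.
have yE2 : y \in E2.
  by apply/E2P; split=> // g; exists (phi (ab g).1 / phi (ab g).2).
have rF := residues_field RP E2F.
have [|u [/residuesP[z zE2 Rz] u_nc uE]] := luroth tofrac_inj tofrac_surj tcstE rF.
  by exists r1 => //; apply/residuesP; exists y.
pose evz := ev_cst (rat_field_const K m) z.
have Rev P : R (evz P) (ev_cst tcst u P).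
  rewrite /evz /= /horner_eval !horner_coef !size_map_poly.
  apply: (local_hom_sum RP) => i; apply: (local_hom_mul RP); last exact: local_hom_exp RP _ _ _ Rz.
  by rewrite !coef_map; apply: (local_hom_const RP).
have evz_inj P : evz P = 0 -> P = 0.
  move=> P0; apply: (ev_cst_inj tofrac_inj tofrac_surj tcstE u_nc).
  by apply: (local_hom_0 RP); rewrite -P0.
have evzE P : evz P \in E2.
  have [E2P' E2K] := E2F; rewrite /evz /= /horner_eval horner_coef.
  apply: (@rpred_sum _ (subfield_pred E2P')) => i _; apply: rpredM; last exact: rpredX.
  by rewrite coef_map; apply: E2K.
have E2frac w : w \in E2 -> w \in fractions evz.
  move=> wE2; have [r wr] := E2R w wE2.
  have /fractionsP[P [Q [Q0 Er]]] : r \in fractions (ev_cst tcst u).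
    by apply: uE; apply/residuesP; exists w.
  have Qz0 : evz Q != 0.
    by apply: contra_neq Q0 => Q0; apply: (local_hom_0 RP); rewrite -Q0; apply: Rev.
  apply/fractionsP; exists P, Q; split=> //; apply/eqP; rewrite -subr_eq0; apply/eqP.
  apply: Rinj.
    have [[_ e2B e2D] _] := E2F.
    exact: (E2E _ (e2B _ _ wE2 (e2D _ _ (evzE P) (evzE Q)))).
  rewrite -(subrr r); apply: (local_hom_sub RP) => //; rewrite Er.
  by apply: (local_hom_mul RP) => //; apply: (local_hom_inv RP).
pose sg := rat_act_rmorph V s.
have sgC a : sg (rat_field_const K m a) = rat_field_const K m a by apply: act_const aP _ _.
have sev (h : gT) P : rat_act_rmorph V h (evz P) =
    ev_cst (rat_field_const K m) (rat_act_rmorph V h z) P.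
  rewrite /evz /= /horner_eval -horner_map -map_poly_comp; congr (_.[_]).
  by apply: eq_map_poly => a; apply: act_const aP _ _.
(* apply s to an expression of s^-1 z as a fraction in z *)
have zfrac : z \in fractions (ev_cst (rat_field_const K m) (sg z)).
  have /fractionsP[P [Q [Q0 EPQ]]] := E2frac _ (E2s s^-1%g z zE2).
  apply/fractionsP; exists P, Q; rewrite -!(sev s).
  have Ez : rat_act_rmorph V s (evz P / evz Q) = z.
    by rewrite -EPQ -(act_mul aP) mulgV (act_one aP).
  split; first by rewrite fmorph_eq0.
  exact: etrans (esym Ez) (fmorph_div _ _ _).
have [a [b [c [d [n1 M1]]]]] := moebius_of evz_inj (E2frac _ (E2s s z zE2)) zfrac.
have sg4 : sg (sg (sg (sg z))) = z.
  transitivity (rat_act_rmorph V (s ^+ 4)%g z); last by rewrite s4 (act_one aP).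
  exact: esym (act_exp4 aP s z).
have sg2 := moebius_order4 evz_inj ch2 sgC (conj n1 M1) sg4.
have g2z : rat_act_rmorph V g2 z = z := etrans (act_exp2 aP s z) sg2.
have /fractionsP[P [Q [Q0 EPQ]]] := E2frac y yE2.
by case/eqP: y2; rewrite EPQ fmorph_div !sev g2z.
Qed.

End ArtinSchreier.

(** * Upper bounds and auxiliary fields *)

Section OneGenerator.

Variables (K L : fieldType) (iota : {rmorphism K -> L}).
Variables (gT : finGroupType) (act : gT -> {rmorphism L -> L}).
Hypothesis actP : is_action iota act.

Lemma ed_le1_generator (x : L) :
  (forall g, act g x \in clo iota [:: x]) -> (forall g, act g x = x -> g = 1%g) ->
  ed_le iota act 1.
Proof.
move=> xs xf; exists (clo iota [:: x]); split.
- exact: clo_field.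
- by apply: (stable_clo actP) => g y /[!inE]/eqP ->; apply: xs.
- by move=> g gf; apply: xf; apply: gf; apply: mem_clo; rewrite mem_head.
- exact: (trdeg_le_clo (s := [:: x])).
Qed.

(** If s moves x, the ratio x / s x is inverted by s, and it is not 1, hence not
    its own inverse in characteristic 2. *)
Lemma ed_le1_order2 : 2%N \in [pchar L] -> faithful_on act predT ->
  #|{: gT}| = 2%N -> ed_le iota act 1.
Proof.
move=> ch2 Lf c2.
have [s s1] : exists s : gT, s != 1%g.
  apply: contrapT => H; have : (#|[set: gT]| <= 1)%N.
    rewrite -(cards1 (1%g : gT)); apply/subset_leq_card/subsetP => g _; rewrite inE.
    by apply: contrapT => g1; apply: H; exists g; apply/negP.
  by rewrite cardsT c2.
have s_all g : g = 1%g \/ g = s.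
  have /setP/(_ g) : [set 1%g; s] = [set: gT].
    apply/eqP; rewrite eqEcard subsetT cards2 cardsT c2 eq_sym s1 //.
  by rewrite !inE => /orP[/eqP->|/eqP->]; [left | right].
have ss : (s * s = 1)%g.
  by have [//|E] := s_all (s * s)%g; case/eqP: s1; apply: (mulgI s); rewrite E mulg1.
have [x _ xs] := faithful_moves actP Lf s1.
have x0 : x != 0 by apply: contra_neq xs => ->; rewrite rmorph0.
have sx0 : act s x != 0 by rewrite fmorph_eq0.
have [[c1 _ cD] _] := clo_field iota [:: x / act s x].
have lc : x / act s x \in clo iota [:: x / act s x] by apply: mem_clo; rewrite mem_head.
have sl : act s (x / act s x) = (x / act s x)^-1.
  by rewrite fmorph_div -(act_mul actP) ss (act_one actP) invfM invrK mulrC.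
apply: (@ed_le1_generator (x / act s x)) => g; case: (s_all g) => ->.
- by rewrite (act_one actP).
- by rewrite sl -[_^-1]mul1r; apply: cD.
- by [].
rewrite sl => E; case/eqP: xs.
set l := x / act s x in E; have l0 : l != 0 by rewrite mulf_neq0 ?invr_eq0.
have l1 : l = 1.
  apply/eqP; rewrite -subr_eq0 -sqrf_eq0 -(pFrobenius_autE ch2) rmorphB rmorph1 /=.
  by rewrite pFrobenius_autE expr2 -{1}E mulVf // subrr.
by transitivity (l * act s x); [rewrite l1 mul1r | rewrite /l divfK].
Qed.

End OneGenerator.

Section SymmetricThree.

Variables (K L : fieldType) (iota : {rmorphism K -> L}).
Variable act : 'S_3 -> {rmorphism L -> L}.
Hypothesis actP : is_action iota act.
Hypothesis act_faithful : faithful_on act predT.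
Hypothesis L_inf : infinite_pred (F := L) predT.

Let o0 : 'I_3 := @Ordinal 3 0 isT.
Let o1 : 'I_3 := @Ordinal 3 1 isT.
Let o2 : 'I_3 := @Ordinal 3 2 isT.

Let o3P (i : 'I_3) : [\/ i = o0, i = o1 | i = o2].
Proof.
by case: i => [[|[|[|i]]] hi] //; [apply: Or31 | apply: Or32 | apply: Or33]; apply/val_inj.
Qed.

Let rho (g : 'S_3) : 'M[K]_3 := \matrix_(i, j) (i == g^-1%g j)%:R.

Let rho1 : rho 1%g = 1%:M.
Proof. by apply/matrixP => i j; rewrite !mxE invg1 perm1. Qed.

Let rhoM g h : rho (g * h)%g = rho g *m rho h.
Proof.
apply/matrixP => i j; rewrite !mxE (bigD1 (h^-1%g j)) //= !mxE eqxx mulr1 big1.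
  by rewrite addr0 invMg permM.
by move=> k kj; rewrite !mxE (negbTE kj) mulr0.
Qed.

(* D a b c = 0 says that the triples X_a, X_b, X_c and X_0, X_1, X_2 have the
   same affine ratio *)
Let D (a b c : 'I_3) : {mpoly K[3]} :=
  ('X_a - 'X_c) * ('X_o1 - 'X_o2) - ('X_o0 - 'X_o2) * ('X_b - 'X_c).

Let D_neq0 (g : 'S_3) : g != 1%g -> D (g o0) (g o1) (g o2) != 0.
Proof.
move=> g1; have inj (i j : 'I_3) : i != j -> g i != g j by rewrite (inj_eq perm_inj).
have h01 := inj o0 o1 isT; have h02 := inj o0 o2 isT; have h12 := inj o1 o2 isT.
have evD (v : 'I_3 -> K) a b c : (D a b c).@[v] =
    (v a - v c) * (v o1 - v o2) - (v o0 - v o2) * (v b - v c).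
  by rewrite /D mevalB !mevalM !mevalB !mevalXU.
have [g0|g0] := eqVneq (g o0) o0.
  have [g1' g2'] : g o1 = o2 /\ g o2 = o1.
    move: h01 h02 h12; rewrite g0; case: (o3P (g o1)) => E1; rewrite E1 => //.
      case: (o3P (g o2)) => E2; rewrite E2 => // _ _ _; case/eqP: g1.
      by apply/permP => i; rewrite perm1; case: (o3P i) => ->.
    by case: (o3P (g o2)) => E2; rewrite E2.
  apply/eqP => /(congr1 (meval (fun i => (i == o1)%:R))).
  rewrite evD meval0 g0 g1' g2' /= => /eqP.
  by rewrite !(subr0, sub0r, mul0r, mulr1) oppr_eq0 oner_eq0.
apply/eqP => /(congr1 (meval (fun i => (i == o0)%:R))).
rewrite evD meval0 /= subrr mulr0 sub0r subr0 mul1r => /eqP; rewrite oppr_eq0 subr_eq0.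
have [i gi] : exists i, g i = o0 by exists (g^-1%g o0); rewrite permKV.
move: h12; case: (o3P i) gi => -> gi; first by rewrite gi eqxx in g0.
- rewrite gi; by rewrite eqxx eq_sym => /negbTE ->; rewrite oner_eq0.
- rewrite gi; by rewrite eqxx => /negbTE ->; rewrite eq_sym oner_eq0.
Qed.

(** Take elements z0, z1, z2 permuted by S_3. It acts on the affine ratio
    x = (z0 - z2) / (z1 - z2) by fractional linear substitutions, because all the
    differences of the z i are multiples of z1 - z2 by elements of K(x). For
    generic z i, that is, where the polynomials D do not vanish, x determines the
    order of the z i. *)
Lemma ed_le1_sym3 : ed_le iota act 1.
Proof.
pose f := ('X_o1 - 'X_o2 : {mpoly K[3]}) *
  \prod_(g : 'S_3 | g != 1%g) D (g o0) (g o1) (g o2).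
have f0 : f != 0.
  rewrite mulf_neq0 //; last by apply/prodf_neq0 => g; apply: D_neq0.
  rewrite subr_eq0; apply/eqP => /(congr1 (meval (fun i => (i == o1)%:R : K))).
  by rewrite !mevalXU /= => /eqP; rewrite oner_eq0.
have [z [zf zE]] := equivariant_point actP act_faithful L_inf rho1 rhoM f0.
have actz g j : act g (z j) = z (g^-1%g j).
  rewrite zE (bigD1 (g^-1%g j)) //= mxE eqxx rmorph1 mulr1 big1 ?addr0 // => i ij.
  by rewrite mxE (negbTE ij) rmorph0 mulr0.
have mX i : mmap iota z 'X_i = z i by rewrite mmapX mmap1U.
move: zf; rewrite rmorphM mulf_eq0 negb_or rmorphB /= !mX rmorph_prod.
move=> /andP[d0 /prodf_neq0 Dz]; set d := z o1 - z o2 in d0.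
pose x := (z o0 - z o2) / d.
have actx g : act g x = (z (g^-1%g o0) - z (g^-1%g o2)) / (z (g^-1%g o1) - z (g^-1%g o2)).
  by rewrite /x fmorph_div !rmorphB !actz.
apply: (@ed_le1_generator _ _ _ _ _ actP x) => g; last first.
  move=> gx; apply/eqP; rewrite -invg_eq1; apply: contrapT => /negP g1.
  case/eqP: (Dz _ g1); rewrite /D rmorphB !rmorphM !rmorphB /= !mX.
  have gd0 : z (g^-1%g o1) - z (g^-1%g o2) != 0.
    by rewrite -!actz -rmorphB fmorph_eq0.
  by move/eqP: gx; rewrite actx /x eqr_div // -/d => /eqP ->; rewrite subrr.
have [[c1 cB cD] _] := clo_field iota [:: x].
have xc : x \in clo iota [:: x] by apply: mem_clo; rewrite mem_head.
(* affine coordinates in which z2 is 0 and z1 is 1 *)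
pose a (i : 'I_3) : L := if i == o0 then x else if i == o1 then 1 else 0.
have aE i : a i \in clo iota [:: x].
  rewrite /a; case: eqP => // _; case: eqP => // _.
  by rewrite -(subrr 1); apply: cB.
have za i : z i = z o2 + a i * d.
  rewrite /a; case: (o3P i) => -> /=; first by rewrite /x divfK // addrC subrK.
    by rewrite mul1r /d addrC subrK.
  by rewrite mul0r addr0.
have zd i j : z i - z j = (a i - a j) * d.
  by rewrite (za i) (za j) mulrBl opprD addrACA subrr add0r.
rewrite actx !zd invfM mulrACA divff // mulr1.
by apply: cD; apply: cB.
Qed.

End SymmetricThree.

Section NaturalRepresentation.

Variables (K : fieldType) (n : nat).

Lemma perm_mx_repr : mx_repr [set: 'S_n] (fun s : 'S_n => perm_mx s : 'M[K]_n).
Proof. by split=> [|x y _ _]; [apply: perm_mx1 | apply: perm_mxM]. Qed.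

Definition natural_repr : mx_representation K [set: 'S_n]%G n :=
  MxRepresentation perm_mx_repr.

Lemma natural_repr_faithful : mx_faithful natural_repr.
Proof.
apply/subsetP => s; rewrite !inE mul1mx /= => /eqP E; apply/eqP/permP => i.
have /matrixP/(_ i (s i)) := E; rewrite !mxE eqxx perm1.
by case: eqP => [<- //|_ /eqP]; rewrite /= oner_eq0.
Qed.

End NaturalRepresentation.

Lemma rat_field_infinite (K : fieldType) l : (0 < l)%N ->
  infinite_pred (F := rat_field K l) predT.
Proof.
case: l => // l _; apply: (@infinite_powers _ predT (('X_0 : {mpoly K[l.+1]})%:F)) => // [n n0|].
  rewrite -tofracXn -tofrac1 tofrac_eq; apply/eqP => /(congr1 (meval (fun=> 0))).
  rewrite rmorphXn rmorph1 /= mevalXU expr0n eqn0Ngt n0 /= => /eqP.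
  by rewrite eq_sym oner_eq0.
rewrite tofrac_eq0; apply/eqP => /(congr1 (meval (fun=> 1))).
by rewrite mevalXU meval0 => /eqP; rewrite oner_eq0.
Qed.

Lemma faithful_dim_gt0 (K : fieldType) (gT : finGroupType) l
    (W : mx_representation K [set: gT]%G l) (s : gT) :
  mx_faithful W -> s != 1%g -> (0 < l)%N.
Proof.
move=> Wf s1; rewrite lt0n; apply: contra_neq s1 => l0; apply/set1gP.
apply: (subsetP Wf); rewrite !inE mul1mx; apply/eqP/matrixP => i.
by move: (ltn_ord i); rewrite {2}l0.
Qed.

Section RootsOfUnity.

Lemma prime_primitive_root (F : fieldType) p (w : F) :
  prime p -> w ^+ p = 1 -> w != 1 -> p.-primitive_root w.
Proof.
move=> pp wp w1; have [m mP mp] := prim_order_exists (prime_gt0 pp) wp.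
move/primeP: pp => [_ /(_ m mp)/orP[/eqP m1|/eqP <- //]].
by have := prim_expr_order mP; rewrite m1 expr1 => /eqP; rewrite (negbTE w1).
Qed.

Lemma primitive_root_m1 (K : fieldType) : 2%N \notin [pchar K] ->
  2.-primitive_root (-1 : K).
Proof.
move=> ch2; apply: prime_primitive_root => //; first by rewrite sqrrN expr1n.
apply: contra ch2 => /eqP E; rewrite inE /=.
by rewrite -[2%:R]/(1 + 1) -{1}E addNr.
Qed.

Lemma primitive_root_F4 (K : fieldType) : contains_F4 K ->
  exists w : K, 3.-primitive_root w.
Proof.
case=> F cF [f]; have [x x0 x1] : exists2 x : F, x != 0 & x != 1.
  apply: contrapT => H; have : (#|F| <= 2)%N; last by rewrite cF.
  have -> : 2%N = #|[set 0; 1 : F]| by rewrite cards2 eq_sym oner_eq0.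
  rewrite -cardsT; apply/subset_leq_card/subsetP => x _; rewrite !inE.
  apply: contrapT => /negP; rewrite negb_or => /andP[x0 x1]; apply: H; by exists x.
exists (f x); apply: prime_primitive_root => //.
  rewrite -rmorphXn -(rmorph1 f); congr (f _); apply: (mulfI x0).
  by rewrite -exprS -cF expf_card mulr1.
by rewrite -(rmorph1 f) (inj_eq (fmorph_inj f)).
Qed.

(** A root of X^2 + X + 1 is a nontrivial cube root of 1 unless 3 = 0. *)
Lemma adjoin_cube_root (K : fieldType) : 2%N \in [pchar K] ->
  exists (K' : fieldType) (ext : {rmorphism K -> K'}) (w : K'), 3.-primitive_root w.
Proof.
move=> ch2; pose p : {poly K} := 'X^2 + 'X + 1.
have two : 2%:R = 0 :> K by case/andP: ch2 => _ /eqP.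
have root3 (K' : fieldType) (ext : {rmorphism K -> K'}) w :
    root (map_poly ext p) w -> 3.-primitive_root w.
  have two' : 2%:R = 0 :> K' by rewrite -(rmorph_nat ext) two rmorph0.
  rewrite /p !rmorphD rmorphXn /= map_polyX rmorph1 rootE !hornerE => /eqP E.
  apply: prime_primitive_root => //.
    apply/eqP; rewrite -subr_eq0.
    have -> : w ^+ 3 - 1 = (w - 1) * (w ^+ 2 + w + 1) by ring.
    by rewrite E mulr0.
  apply: contra_eq_neq E => ->; rewrite expr1n -[1 + 1]/(2%:R) two' add0r.
  exact: oner_neq0.
have [[w rw]|nr] := pselect (exists w, root p w).
  exists K, idfun, w; apply: (root3 _ idfun); by rewrite map_poly_id.
have sp : size p = 3%N.
  by rewrite /p -addrA size_polyDl size_polyXn // size_polyDl size_polyX ?size_poly1.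
have ip : irreducible_poly p.
  apply: cubic_irreducible; first by rewrite sp.
  by move=> x; apply/negP => rx; apply: nr; exists x.
have [L _ [w rw _]] := irredp_FAdjoin ip.
exists L, (in_alg L), w; exact: root3 rw.
Qed.

End RootsOfUnity.

(** * Essential dimension of symmetric groups *)

Section DropStep.

Variables (K K' : fieldType) (ext : {rmorphism K -> K'}).
Variables (gT hT : finGroupType) (q : nat) (th : hT * 'I_q.+2 -> gT).
Hypotheses (thM : {morph th : x y / (x * y)%g}) (th_inj : injective th).
Variables (p_prime : prime q.+2) (w : K') (wP : q.+2.-primitive_root w).
Hypothesis normal_p : forall N : {group hT}, (N <| [set: hT])%g -> N :!=: 1%g ->
  (q.+2 %| #|N|)%N.
Variables (F : fieldType) (kappa : {rmorphism K' -> F}).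
Variable act : hT -> {rmorphism F -> F}.
Hypotheses (actP : is_action kappa act) (act_faithful : faithful_on act predT).
Variables (m : nat) (V : mx_representation K [set: gT]%G m).

(** K(V) specializes equivariantly to F(t) with its action of H x C_p, H on the
    coefficients and C_p by multiplying t by roots of unity; [ed_le_drop] goes
    from there to F. *)
Lemma ed_le_cyclic_factor d :
  ed_le (rat_field_const K m) (rat_act_rmorph V) d ->
  (0 < d)%N /\ ed_le kappa act d.-1.
Proof.
move=> dV; apply: (ed_le_drop (actP := actP) (omegaP := wP) p_prime normal_p).
have kP := kummer_actP actP wP.
apply: (specialization_ed_le (kappa := (ratfun_const kappa \o ext)%FUN) (ext := ext)
  thM th_inj _ (kummer_act_faithful (actP := actP) (omegaP := wP) act_faithful) (@ratfun_infinite F)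
  _ kP dV) => //.
by case: kP => h1 h2 h3; split=> // g a; apply: h3.
Qed.

End DropStep.

Section Symmetric.

Variable K : fieldType.

Lemma drop_sym (K' : fieldType) (ext : {rmorphism K -> K'}) n q (w : K') k l d
    (V : mx_representation K [set: 'S_(n + q.+2)]%G k)
    (W : mx_representation K' [set: 'S_n]%G l) :
  prime q.+2 -> q.+2.-primitive_root w ->
  (forall N : {group 'S_n}, (N <| [set: 'S_n])%g -> N :!=: 1%g -> (q.+2 %| #|N|)%N) ->
  mx_faithful W ->
  ed_le (rat_field_const K k) (rat_act_rmorph V) d ->
  (0 < d)%N /\ ed_le (rat_field_const K' l) (rat_act_rmorph W) d.-1.
Proof.
move=> pp wP Np Wf; apply: (ed_le_cyclic_factor ext (@theta_morph n q)
  (@theta_injective n q) pp wP Np (rat_act_action W)).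
exact: rat_act_faithful.
Qed.

Lemma essdim_drop n q (w : K) k l
    (V : mx_representation K [set: 'S_(n + q.+2)]%G k)
    (W : mx_representation K [set: 'S_n]%G l) :
  prime q.+2 -> q.+2.-primitive_root w ->
  (forall N : {group 'S_n}, (N <| [set: 'S_n])%g -> N :!=: 1%g -> (q.+2 %| #|N|)%N) ->
  mx_faithful V -> mx_faithful W -> (essdim_repr W + 1 <= essdim_repr V)%N.
Proof.
move=> pp wP Np Vf Wf.
have [d0 dW] := drop_sym idfun pp wP Np Wf (ed_le_essdim_repr Vf).
by rewrite addn1 -(prednK d0) ltnS; apply: essdim_repr_le.
Qed.

(** S_5 contains C_2 x C_2, as S_1 x C_2 x C_2, and each factor C_2 costs 1. *)
Lemma ed_sym5_ge2 k (V : mx_representation K [set: 'S_5]%G k) d :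
  2%N \notin [pchar K] ->
  ed_le (rat_field_const K k) (rat_act_rmorph V) d -> (1 < d)%N.
Proof.
move=> ch2 dV; have wP := primitive_root_m1 ch2.
pose hT : finGroupType := ('S_1 * 'I_2)%type.
pose th (x : hT * 'I_2) : 'S_5 := theta ((theta x.1 : 'S_3), x.2).
have thM : {morph th : x y / (x * y)%g}.
  move=> [x i] [y j]; have E : theta (x * y)%g = (theta x * theta y)%g :> 'S_3.
    exact: (@theta_morph 1 0).
  exact: etrans (congr1 (fun a => @theta 3 0 (a, (i * j)%g)) E)
    (@theta_morph 3 0 (theta x, i) (theta y, j)).
have th_inj : injective th.
  move=> [x i] [y j] /(@theta_injective 3 0)[E ->].
  by rewrite (@theta_injective 1 0 _ _ E).
pose act0 (_ : 'S_1) : {rmorphism K -> K} := idfun.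
have act0P : is_action (idfun : {rmorphism K -> K}) act0 by [].
have act0f : faithful_on act0 predT by move=> g _; apply: sym_le1_trivial.
have N1 (N : {group hT}) : (N <| [set: hT])%g -> N :!=: 1%g -> (2 %| #|N|)%N.
  move=> _ Nn; have : (#|N| %| 2)%N.
    have := cardSg (subsetT N); rewrite cardsT card_prod card_ord.
    by rewrite -cardsT cardsE card_Sn.
  move: Nn; rewrite -cardG_gt1 => c1 c2.
  by move: (@dvdn_leq _ 2 isT c2) c1; case: #|N| => [|[|[|]]].
have N0 (N : {group 'S_1}) : (N <| [set: 'S_1])%g -> N :!=: 1%g -> (2 %| #|N|)%N.
  by move=> _ /normal_sym_gt1 H; case: H.
have [d0 d1] := ed_le_cyclic_factor idfun thM th_inj (isT : prime 2) wP N1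
  (kummer_actP act0P wP) (kummer_act_faithful (actP := act0P) (omegaP := wP) act0f) dV.
have [d2 _] := ed_le_drop (isT : prime 2) N0 d1.
by case: d d0 d2 {dV d1} => [|[|d]].
Qed.

Lemma theta_exp n q x i : theta (x ^+ i)%g = (@theta n q x ^+ i)%g.
Proof.
elim: i => [|i IH]; last by rewrite !expgS theta_morph IH.
by rewrite !expg0; apply: (theta_one (@theta_morph n q)).
Qed.

Lemma sym_order2 n : exists s : 'S_(n + 2), (s ^+ 2 = 1)%g /\ s != 1%g.
Proof.
exists (@theta n 0 (1%g, 1)); split.
  rewrite -theta_exp -[RHS](theta_one (@theta_morph n 0)); congr (theta _).
  by rewrite expgS expg1; congr (_, _); [apply: mulg1 | apply/val_inj].
rewrite -(theta_one (@theta_morph n 0)) (inj_eq (@theta_injective n 0)).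
by apply/eqP => -[].
Qed.

Lemma sym_order4 n : exists s : 'S_(n + 4), (s ^+ 4 = 1)%g /\ (s ^+ 2)%g != 1%g.
Proof.
exists (@theta n 2 (1%g, 1)); rewrite -!theta_exp -(theta_one (@theta_morph n 2)); split.
  congr (theta _); rewrite !expgS expg0.
  by congr (_, _); [rewrite /= !mulg1 | apply/val_inj].
rewrite (inj_eq (@theta_injective n 2)).
by apply/eqP => -[].
Qed.

(** Enough because the essential dimension is itself such a d. *)
Lemma essdim_ge n k (V : mx_representation K [set: 'S_n]%G k) b : mx_faithful V ->
  (forall d, ed_le (rat_field_const K k) (rat_act_rmorph V) d -> (b <= d)%N) ->
  (b <= essdim_repr V)%N.
Proof. by move=> Vf; apply; apply: ed_le_essdim_repr. Qed.

(** The normal subgroup A_3 of S_3 has odd order, so n = 3 is special: there S_3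
    has essential dimension at most 1 and S_5 at least 2. *)
Theorem sym_odd_char n k l (V : mx_representation K [set: 'S_(n + 2)]%G k)
    (W : mx_representation K [set: 'S_n]%G l) : 2%N \notin [pchar K] ->
  mx_faithful V -> mx_faithful W -> (essdim_repr W + 1 <= essdim_repr V)%N.
Proof.
move=> ch2 Vf Wf; have [n3|n3] := eqVneq n 3%N; last first.
  apply: (essdim_drop _ (primitive_root_m1 ch2)) => // N; apply: normal_sym_2; exact/eqP.
subst n; apply: (@leq_trans 2); last by apply: essdim_ge => // d; apply: ed_sym5_ge2.
rewrite addn1 ltnS; apply: essdim_repr_le.
apply: (ed_le1_sym3 (rat_act_action W) (rat_act_faithful Wf)).
apply: rat_field_infinite; have [s [_ s1]] := sym_order2 1.
exact: (faithful_dim_gt0 Wf s1).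
Qed.

Theorem sym_odd_char_bound n k (V : mx_representation K [set: 'S_n]%G k) :
  2%N \notin [pchar K] -> mx_faithful V -> (n %/ 2 <= essdim_repr V)%N.
Proof.
move=> ch2; have [N] := ubnP n; elim: N n k V => // N IH [|[|n]] k V // le_n.
move: V; rewrite -addn2 => V Vf.
apply: leq_trans (sym_odd_char ch2 Vf (natural_repr_faithful K n)).
rewrite divnDr // divnn /= leq_add2r; apply: IH; last exact: natural_repr_faithful.
by rewrite -ltnS; apply: leq_trans le_n; rewrite !ltnS.
Qed.

(** The normal subgroups of S_2 and S_4 include 2-groups. For n = 2 one compares
    directly: S_2 has essential dimension at most 1, and S_5 contains an element
    of order 4. *)
Theorem sym_char2_F4 n k l (V : mx_representation K [set: 'S_(n + 3)]%G k)
    (W : mx_representation K [set: 'S_n]%G l) : 2%N \in [pchar K] -> contains_F4 K ->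
  n <> 4%N -> mx_faithful V -> mx_faithful W -> (essdim_repr W + 1 <= essdim_repr V)%N.
Proof.
move=> ch2 /primitive_root_F4[w wP] n4 Vf Wf; have [n2|n2] := eqVneq n 2%N; last first.
  by apply: (essdim_drop _ wP) => // N; apply: normal_sym_3 => //; apply/eqP.
subst n; apply: (@leq_trans 2).
  rewrite addn1 ltnS; apply: essdim_repr_le.
  apply: (ed_le1_order2 (rat_act_action W) _ (rat_act_faithful Wf)).
    by rewrite (fmorph_pchar (rat_field_const K l)).
  by rewrite -cardsT cardsE card_Sn.
have [s [s4 s2]] := sym_order4 1.
by apply: essdim_ge => // d; apply: (ed_gt1_order4 ch2 s4 s2).
Qed.

End Symmetric.

(** Induction in steps of 3 must not pass from S_7 to S_4, nor from S_5 to S_2;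
    involutions for n <= 4 and elements of order 4 for 5 <= n <= 7 give the bounds
    1 and 2 there directly. *)
Lemma ed_sym_char2 (K : fieldType) (w : K) : 2%N \in [pchar K] -> 3.-primitive_root w ->
  forall n k (V : mx_representation K [set: 'S_n]%G k) d,
  ed_le (rat_field_const K k) (rat_act_rmorph V) d -> ((n + 1) %/ 3 <= d)%N.
Proof.
move=> ch2 wP n; have [N] := ubnP n; elim: N n => // N IH n le_n k V d.
have [n1|n1] := leqP n 1; first by rewrite divn_small // addn1.
have [n4|n4] := leqP n 4.
  have bound : ((n + 1) %/ 3 <= 1)%N.
    by rewrite -ltnS ltn_divLR // addn1 -[(_ * _)%N]/6%N !ltnS.
  move: V; rewrite -(subnK n1) => V dV; rewrite subnK //.
  have [s [s2 s1]] := sym_order2 (n - 2).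
  exact: leq_trans bound (ed_gt0_involution ch2 s2 s1 dV).
have [n7|n7] := leqP n 7.
  have bound : ((n + 1) %/ 3 <= 2)%N.
    by rewrite -ltnS ltn_divLR // addn1 -[(_ * _)%N]/9%N !ltnS.
  move: V; rewrite -(subnK (ltnW n4)) => V dV; rewrite subnK ?(ltnW n4) //.
  have [s [s4 s2]] := sym_order4 (n - 4).
  exact: leq_trans bound (ed_gt1_order4 ch2 s4 s2 dV).
have n3 : (3 <= n)%N by apply: leq_trans n7.
move: V; rewrite -(subnK n3) => V dV; rewrite subnK //.
have normal (M : {group 'S_(n - 3)}) : (M <| [set: 'S_(n - 3)])%g -> M :!=: 1%g -> (3 %| #|M|)%N.
  by apply: normal_sym_3 => E; move: n7; rewrite -(subnK n3) E.
have [d0 dW] := drop_sym idfun (isT : prime 3) wP normal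
  (natural_repr_faithful K (n - 3)) dV.
have -> : ((n + 1) %/ 3 = (n - 3 + 1) %/ 3 + 1)%N by rewrite -{1}(subnK n3) addnAC divnDr.
rewrite addn1 -(prednK d0) ltnS; apply: IH dW.
by rewrite ltnS in le_n; apply: leq_trans le_n; rewrite ltn_subrL (leq_trans _ n3).
Qed.

(** The essential dimension does not increase when a cube root of unity is
    adjoined to K. *)
Theorem sym_char2_bound (K : fieldType) n k (V : mx_representation K [set: 'S_n]%G k) :
  2%N \in [pchar K] -> mx_faithful V -> ((n + 1) %/ 3 <= essdim_repr V)%N.
Proof.
move=> ch2 Vf; have [n1|n1] := leqP n 1; first by rewrite divn_small // addn1.
have [K' [ext [w wP]]] := adjoin_cube_root ch2.
have ch2' : 2%N \in [pchar K'] by rewrite (fmorph_pchar ext).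
apply: essdim_ge => // d dV.
pose W := natural_repr K' n; have Wf := natural_repr_faithful K' n.
apply: (ed_sym_char2 ch2' wP (V := W)).
have aP := rat_act_action W.
apply: (specialization_ed_le (kappa := (rat_field_const K' n \o ext)%FUN) (ext := ext)
  (theta := id) _ _ _ (rat_act_faithful Wf) _ _ aP dV) => //.
  by case: aP => h1 h2 h3; split=> // g a; apply: h3.
by apply: rat_field_infinite; apply: ltnW.
Qed.

Theorem theorem5p4 (K : fieldType) :
  (2%N \notin [pchar K] ->
    (forall n, (1 <= n)%N ->
      forall k l (V : mx_representation K [set: 'S_(n + 2)]%G k)
                 (W : mx_representation K [set: 'S_n]%G l),
        mx_faithful V -> mx_faithful W ->
        (essdim_repr V >= essdim_repr W + 1)%N) /\
    (forall n, (1 <= n)%N ->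
      forall k (V : mx_representation K [set: 'S_n]%G k),
        mx_faithful V -> (essdim_repr V >= n %/ 2)%N))
  /\
  (2%N \in [pchar K] -> contains_F4 K ->
    forall n, (1 <= n)%N -> n <> 4%N ->
      forall k l (V : mx_representation K [set: 'S_(n + 3)]%G k)
                 (W : mx_representation K [set: 'S_n]%G l),
        mx_faithful V -> mx_faithful W ->
        (essdim_repr V >= essdim_repr W + 1)%N)
  /\
  (2%N \in [pchar K] ->
    forall n, (1 <= n)%N ->
      forall k (V : mx_representation K [set: 'S_n]%G k),
        mx_faithful V -> (essdim_repr V >= (n + 1) %/ 3)%N).
Proof.
split; first by move=> ch2; split=> n _ *; [apply: sym_odd_char | apply: sym_odd_char_bound].
split=> [ch2 F4 n _ n4 *|ch2 n _ *]; first exact: sym_char2_F4.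
exact: sym_char2_bound.
Qed.
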